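(* The numbers $\mathcal N_g(m_1,\dots,m_q)$ satisfy the initial condition $\mathcal N_0(m)=\delta_{m,1}\frac{1}{2CJ}$ (for the one-part composition $(m)$), and, whenever $2g-2+|m|+q\ge1$, for every $r\in\{1,\dots,q\}$: $$m_r\,\mathcal N_g(m_1,\dots,m_q)=\sum_{j\ne r}(m_r+m_j)\,\mathcal N_g(m_1,\dots,\hat m_j,\dots,m_r+m_j,\dots,m_q)+m_r(m_r-1)\,T\,\mathcal N_{g-\frac12}(m_1,\dots,m_q)$$ $$+\sum_{\alpha+\beta=m_r}2CJ\,\alpha\beta\Big(\mathcal N_{g-1}(m_1,\dots,\hat m_r,\alpha,\beta,\dots,m_q)+\sum_{g_1+g_2=g}\ \sum_{\substack{I_1\cup I_2=\{1,\dots,q\}\\ I_1\cap I_2=\{r\}}}\mathcal N_{g_1}\big(m_{I_1}(m_r\mapsto\beta)\big)\,\mathcal N_{g_2}\big(m_{I_2}(m_r\mapsto\alpha)\big)\Big),$$ where $\alpha,\beta\ge1$, $g_1,g_2\in\frac12\mathbb Z_{\ge0}$, $\hat m_j$ denotes omission of the part $m_j$, $m_r+m_j$ replaces $m_r$, $m_{I}(m_r\mapsto\beta)$ is the subcomposition of $(m_1,\dots,m_q)$ formed by the parts with indices in $I$ with $m_r$ replaced by $\beta$, and any $\mathcal N$ with negative genus is $0$.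
   Context: Let $[\bar n]=\{1,\bar 1,\dots,n,\bar n\}$ with the total order $1<\bar1<\cdots<n<\bar n$, $S_{2n}$ the symmetric group on it, $\tau=(1\ \bar1)\cdots(n\ \bar n)$, $\sigma.\rho=\sigma\rho\sigma^{-1}$. The type of a fixed-point-free involution $\rho$ is the partition whose parts are half the numbers of vertices of the connected components of the graph $\rho\cup\tau$ on $[\bar n]$ with edges $\{x,\rho(x)\},\{x,\tau(x)\}$. A transposition $\sigma$ has weight $C$, $J$ or $T$ ($C,J,T$ indeterminates) for $\rho$ according as the type of $\sigma.\rho$ has one more part than that of $\rho$, one fewer part, or equals it. For a composition $m=(m_1,\dots,m_q)$ of $n=|m|$ and $g\in\frac12\mathbb Z_{\ge0}$ with $k=2g-2+n+q\ge0$, consider pairs $((\sigma_1,\dots,\sigma_k),\preccurlyeq)$ where $\sigma_i=(p_i\ q_i)$ with $q_i\in\{1,\dots,n\}$, $p_i\in[\bar n]$, $p_i<q_i$; $q_1\le\cdots\le q_k$; $\langle\tau,\sigma_1,\dots,\sigma_k\rangle$ is transitive on $[\bar n]$; and, with $\varrho=\sigma_k\cdots\sigma_1.\tau$, $\preccurlyeq$ labels the connected components of $\varrho\cup\tau$ by $1,\dots,q$ so that the component labelled $j$ has $2m_j$ vertices. The weight of a pair is $\prod_{i=1}^kw(\sigma_{i-1}\cdots\sigma_1.\tau,\sigma_i)$. Define $\mathcal N_g(m_1,\dots,m_q)=\frac{1}{n!\,C^qJ^n2^n}\sum(\text{weights of all such pairs})$, and $\mathcal N_g(m)=0$ if $k<0$.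 (These numbers do not depend on the order of the parts $m_j$.)
   Formalization: The initial condition N_0(m)=δ_{m,1}/(2CJ) is stated only for one-part (m) outside the recursion's range (2·0-2+m+1≤0, i.e. m=1), because for m≥2 it is false: N_0(2)=1/(4CJ)≠0. *)

(* Defs.v *)
From HB Require Import structures.
From mathcomp Require Import all_boot all_order all_algebra all_fingroup.
From mathcomp.multinomials Require Import mpoly.

Set Implicit Arguments.
Unset Strict Implicit.
Unset Printing Implicit Defensive.

Import Order.TTheory GRing.Theory.

Local Open Scope ring_scope.

Definition coefField : fieldType := {fraction {mpoly rat[3]}}.
Definition Cvar : coefField := tofrac ('X_(0 : 'I_3) : {mpoly rat[3]}).
Definition Jvar : coefField := tofrac ('X_(1 : 'I_3) : {mpoly rat[3]}).
Definition Tvar : coefField := tofrac ('X_(2 : 'I_3) : {mpoly rat[3]}).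

(* The set {1, bar 1, ..., n, bar n}: the ordinal i encodes the label i + 1,
   and the boolean says whether the label is barred. The lexicographic order
   is then 1 < bar 1 < 2 < bar 2 < ... *)
Definition bvert (n : nat) := ('I_n *l bool)%type.

Definition unbar n (i : 'I_n) : bvert n := (i, false).

Definition flip_bar n (x : bvert n) : bvert n := (x.1, ~~ x.2).

Lemma flip_barK n : involutive (@flip_bar n).
Proof. by case=> i b; rewrite /flip_bar /= negbK. Qed.

Definition tau n : {perm bvert n} := perm (inv_inj (@flip_barK n)).

(* sigma.rho = sigma rho sigma^-1. Permutations are multiplied left to right
   in the library, (s * t) x = t (s x), so this is
   rho ^ sigma = sigma^-1 * rho * sigma. *)
Definition twist n (sigma rho : {perm bvert n}) : {perm bvert n} :=
  (rho ^ sigma)%g.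

Definition union_graph n (rho : {perm bvert n}) : rel (bvert n) :=
  fun x y => (y == rho x) || (y == tau n x).

Definition components n (rho : {perm bvert n}) : {set {set bvert n}} :=
  equivalence_partition (connect (union_graph rho)) [set: bvert n].

Definition inv_type n (rho : {perm bvert n}) : seq nat :=
  sort geq [seq #|A|./2 | A : {set bvert n} in components rho].

(* For rho a fixed-point-free involution and sigma a transposition, one of the
   first three cases always holds. *)
Definition weight n (rho sigma : {perm bvert n}) : coefField :=
  let old := inv_type rho in
  let new := inv_type (twist sigma rho) in
  if size new == (size old).+1 then Cvar
  else if (size new).+1 == size old then Jvar
  else if new == old then Tvar
  else 0.

(* A sequence of transpositions (p_i q_i) is stored as the sequence of the
   pairs (p_i, q_i); as p_i < q_i, the transposition determines the pair. *)
Definition transp n (x : bvert n * 'I_n) : {perm bvert n} :=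
  tperm x.1 (unbar x.2).

(* sigma_i ... sigma_1 . tau *)
Definition partial_inv n (s : seq (bvert n * 'I_n)) (i : nat) :
    {perm bvert n} :=
  foldl (fun rho x => twist (transp x) rho) (tau n) (take i s).

Definition monotone_transitive n (s : seq (bvert n * 'I_n)) : bool :=
  [&& all (fun x => (x.1 < unbar x.2)%O) s,
      sorted leq [seq nat_of_ord x.2 | x <- s] &
      [transitive <<tau n |: [set transp x | x in s]>>%g,
         on [set: bvert n] | 'P]].

Definition labelling n (m : seq nat) (rho : {perm bvert n})
    (lab : {ffun 'I_(size m) -> {set bvert n}}) : bool :=
  [&& injectiveb lab,
      [set lab j | j : 'I_(size m)] == components rho &
      [forall j : 'I_(size m), #|lab j| == (nth 0%N m j).*2]].

Definition seq_weight n k (s : k.-tuple (bvert n * 'I_n)) : coefField :=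
  \prod_(i < k) weight (partial_inv s i) (transp (tnth s i)).

Definition is_composition (m : seq nat) : bool := all (fun a => (0 < a)%N) m.

(* The genus g, a half-integer, is represented by the integer h = 2 g. The
   number is 0 when g < 0 or k = 2 g - 2 + |m| + q < 0. *)
Definition hurwitz (h : int) (m : seq nat) : coefField :=
  let n := sumn m in
  let q := size m in
  let k : int := h - 2 + n%:Z + q%:Z in
  if (0 <= h) && (0 <= k) then
    (\sum_(x : (absz k).-tuple (bvert n * 'I_n)
               * {ffun 'I_q -> {set bvert n}}
           | monotone_transitive x.1
             && labelling (partial_inv x.1 (absz k)) x.2)
        seq_weight x.1)
    / (n`!%:R * Cvar ^+ q * Jvar ^+ n * 2 ^+ n)
  else 0.

(* In the following operations positions in m are counted from 0. *)

(* (m_1, ..., omit m_j, ..., m_r + m_j, ..., m_q) *)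
Definition merge_parts (m : seq nat) (r j : nat) : seq nat :=
  let m' := set_nth 0%N m r (nth 0%N m r + nth 0%N m j)%N in
  take j m' ++ drop j.+1 m'.

(* (m_1, ..., omit m_r, a, b, ..., m_q) *)
Definition split_part (m : seq nat) (r a b : nat) : seq nat :=
  take r m ++ [:: a; b] ++ drop r.+1 m.

(* m_I (m_r |-> a); enum lists the indices of I in increasing order. *)
Definition sub_replace (m : seq nat) (I : {set 'I_(size m)}) (r a : nat) :
    seq nat :=
  [seq nth 0%N (set_nth 0%N m r a) i | i : 'I_(size m) in I].

(* Main.v *)
Require Import Defs.
From mathcomp Require Import all_boot all_order all_algebra all_fingroup.
From mathcomp Require Import ring zify.

Set Implicit Arguments.
Unset Strict Implicit.
Unset Printing Implicit Defensive.
Import GRing.Theory.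

(* Undo the last transposition (p q) of a monotone sequence: by monotonicity and
   transitivity q is the largest label n, and p runs over the other vertices. If p
   lies in another component of the final matching, that component was created by
   a cut (weight C); if it lies in the component of n with the opposite colour,
   nothing changes (weight T); with the same colour, two components were joined
   (weight J), and the orbits may split. This is the cut-and-join recursion, but
   only for the part r containing the label n. It holds for every r as soon as the
   weighted number of sequences ending at a matching only depends on the type of
   the matching, with its components grouped by orbits. That is proved together
   with the recursion by induction on the length: expanding a part i and then a
   part j gives the same result as j and then i, which is the closure of the
   Virasoro algebra and the only place where the weights interact. Grouping by
   orbits makes the disconnected terms products of connected ones. Finally, the
   labelled matchings of type m number n! 2^n / prod_j (2 m_j), which gives the
   normalization. *)

Section PermInd.
Variable T : eqType.

Lemma perm_cons2C (x y : T) s : perm_eq [:: x, y & s] [:: y, x & s].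
Proof. by have /permEl := perm_catCA [:: x] [:: y] s. Qed.

Lemma perm_eq_ind (P : seq T -> seq T -> Prop) :
  P [::] [::] ->
  (forall x m m', perm_eq m m' -> P m m' -> P (x :: m) (x :: m')) ->
  (forall x y m, P [:: x, y & m] [:: y, x & m]) ->
  (forall m1 m2 m3, P m1 m2 -> P m2 m3 -> P m1 m3) ->
  forall m m', perm_eq m m' -> P m m'.
Proof.
move=> P0 PS Pxy Ptr m m'.
have Prefl : forall s, P s s by elim=> // x s IH; apply: PS.
have [n] := ubnP (size m); elim: n m m' => // n IH [|x m] m' /=.
  by move=> _; rewrite perm_sym => /perm_nilP ->.
rewrite ltnS => szm; case: m' => [|y m'] pm.
  by move/perm_nilP: pm.
have [exy|nxy] := eqVneq x y.
  by subst y; rewrite perm_cons in pm; apply: PS => //; apply: IH.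
have ym : y \in m.
  by have := perm_mem pm y; rewrite !inE eqxx /= eq_sym (negPf nxy).
have pmy := perm_to_rem ym.
have szr : (size (x :: rem y m) <= size m)%N by rewrite (perm_size pmy).
have pm' : perm_eq (x :: rem y m) m'.
  rewrite -(perm_cons y) -(permPr pm) /= perm_sym.
  apply: (perm_trans (y := [:: x, y & rem y m])); first by rewrite perm_cons.
  exact: perm_cons2C.
apply: (Ptr _ [:: x, y & rem y m]).
  by apply: PS => //; apply: IH.
apply: (Ptr _ [:: y, x & rem y m]); first exact: Pxy.
by apply: PS => //; apply: IH => //; apply: leq_ltn_trans szm.
Qed.

End PermInd.

Section Picks.
Variable T : Type.

Fixpoint picks (m : seq T) : seq (T * seq T) :=
  if m is x :: m' then (x, m') :: [seq (y.1, x :: y.2) | y <- picks m']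
  else [::].

Fixpoint splits (m : seq T) : seq (seq T * seq T) :=
  if m is x :: m' then
    [seq (x :: y.1, y.2) | y <- splits m'] ++
    [seq (y.1, x :: y.2) | y <- splits m']
  else [:: ([::], [::])].

End Picks.

Section PicksSplits.
Local Open Scope ring_scope.
Variables (T : eqType).
Implicit Types (m : seq T).

Lemma picks_map (U : Type) (f : T -> U) m :
  picks (map f m) = [seq (f y.1, map f y.2) | y <- picks m].
Proof.
elim: m => //= x m ->; rewrite -!map_comp; congr (_ :: _).
Qed.

Lemma splits_map (U : Type) (f : T -> U) m :
  splits (map f m) = [seq (map f y.1, map f y.2) | y <- splits m].
Proof. by elim: m => //= x m ->; rewrite map_cat -!map_comp. Qed.

Lemma picks_sum (R : nmodType) (F : T -> R) m :
  \sum_(x <- m) F x = \sum_(y <- picks m) F y.1.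
Proof.
by elim: m => [|x m IH] /=; rewrite ?big_nil // !big_cons big_map IH.
Qed.

Lemma picks_mem m y : y \in picks m -> perm_eq m (y.1 :: y.2).
Proof.
elim: m y => //= x m IH y; rewrite inE => /orP[/eqP -> //|/mapP[z /IH pz ->]] /=.
apply: perm_trans (perm_cons2C _ _ _); by rewrite perm_cons.
Qed.

Lemma splits_mem m y : y \in splits m -> perm_eq m (y.1 ++ y.2).
Proof.
elim: m y => [|x m IH] y /=; first by rewrite inE => /eqP ->.
rewrite mem_cat => /orP[] /mapP[z /IH pz ->] /=; first by rewrite perm_cons.
by rewrite perm_sym perm_catC /= perm_cons perm_catC perm_sym.
Qed.

End PicksSplits.

Section Sums.
Local Open Scope ring_scope.
Variables (R : comPzRingType) (T : Type).
Implicit Types (m : seq T).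

Lemma picks_nil (f : T * seq T -> R) : \sum_(y <- picks [::]) f y = 0.
Proof. by rewrite big_nil. Qed.

Lemma picks_cons x m (f : T * seq T -> R) :
  \sum_(y <- picks (x :: m)) f y =
  f (x, m) + \sum_(y <- picks m) f (y.1, x :: y.2).
Proof. by rewrite /= big_cons big_map. Qed.

Lemma splits_nil (f : seq T * seq T -> R) :
  \sum_(y <- splits [::]) f y = f ([::], [::]).
Proof. by rewrite big_seq1. Qed.

Lemma splits_cons x m (f : seq T * seq T -> R) :
  \sum_(y <- splits (x :: m)) f y =
  \sum_(y <- splits m) f (x :: y.1, y.2) + \sum_(y <- splits m) f (y.1, x :: y.2).
Proof. by rewrite /= big_cat !big_map. Qed.

#[global] Arguments picks : simpl never.
#[global] Arguments splits : simpl never.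

Lemma splitsC m (f : seq T -> seq T -> R) :
  \sum_(y <- splits m) f y.1 y.2 = \sum_(y <- splits m) f y.2 y.1.
Proof.
elim: m f => [|x m IH] f; first by rewrite !splits_nil.
rewrite !splits_cons /= addrC (IH (fun a b => f a (x :: b))).
by rewrite (IH (fun a b => f (x :: a) b)).
Qed.

Lemma splitsA m (f : seq T -> seq T -> seq T -> R) :
  \sum_(y <- splits m) \sum_(z <- splits y.1) f z.1 z.2 y.2 =
  \sum_(y <- splits m) \sum_(z <- splits y.2) f y.1 z.1 z.2.
Proof.
elim: m f => [|x m IH] f; first by rewrite !splits_nil.
rewrite !splits_cons /=.
under [X in X + _ = _]eq_bigr => y _ do rewrite splits_cons.
rewrite big_split /= (IH (fun a b c => f (x :: a) b c)).
rewrite (IH (fun a b c => f a (x :: b) c)) (IH (fun a b c => f a b (x :: c))).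
under [X in _ = _ + X]eq_bigr => y _ do rewrite splits_cons.
by rewrite big_split /= addrA.
Qed.

Lemma picks2C m (f : T -> T -> seq T -> R) :
  \sum_(y <- picks m) \sum_(z <- picks y.2) f y.1 z.1 z.2 =
  \sum_(y <- picks m) \sum_(z <- picks y.2) f z.1 y.1 z.2.
Proof.
elim: m f => [|x m IH] f; first by rewrite !picks_nil.
rewrite !picks_cons /=.
under [X in _ + X = _]eq_bigr => y _ do rewrite picks_cons.
under [X in _ = _ + X]eq_bigr => y _ do rewrite picks_cons.
rewrite !big_split /= addrCA; congr (_ + (_ + _)) => //.
exact: (IH (fun a b c => f a b (x :: c))).
Qed.

Lemma splits_picksl m (f : T -> seq T -> seq T -> R) :
  \sum_(y <- splits m) \sum_(z <- picks y.1) f z.1 z.2 y.2 =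
  \sum_(z <- picks m) \sum_(y <- splits z.2) f z.1 y.1 y.2.
Proof.
elim: m f => [|x m IH] f; first by rewrite splits_nil !picks_nil.
rewrite splits_cons picks_cons /=.
under [X in X + _ = _]eq_bigr => y _ do rewrite picks_cons.
under [X in _ = _ + X]eq_bigr => y _ do rewrite splits_cons.
rewrite !big_split /= -addrA; congr (_ + (_ + _)).
  exact: (IH (fun a b c => f a (x :: b) c)).
exact: (IH (fun a b c => f a b (x :: c))).
Qed.

End Sums.

Section PermSums.
Local Open Scope ring_scope.
Variables (R : comPzRingType) (T : eqType).
Implicit Types (m : seq T).

Lemma picks_perm m m' (f : T -> seq T -> R) :
  (forall x s s', perm_eq s s' -> f x s = f x s') -> perm_eq m m' ->
  \sum_(y <- picks m) f y.1 y.2 = \sum_(y <- picks m') f y.1 y.2.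
Proof.
move=> fP pm; elim/perm_eq_ind: pm f fP.
- by [].
- move=> x s s' ps IH f fP; rewrite !picks_cons /= (fP _ _ _ ps); congr (_ + _).
  by apply: (IH (fun a b => f a (x :: b))) => a b b' pb; apply: fP; rewrite perm_cons.
- move=> x y s f fP; rewrite !picks_cons /= addrCA; congr (_ + (_ + _)).
  by apply: eq_bigr => z _; apply: fP; apply: perm_cons2C.
- by move=> s1 s2 s3 IH1 IH2 f fP; rewrite IH1 ?IH2.
Qed.

Lemma splits_perm m m' (f : seq T -> seq T -> R) :
  (forall s1 s2 s1' s2', perm_eq s1 s1' -> perm_eq s2 s2' ->
     f s1 s2 = f s1' s2') -> perm_eq m m' ->
  \sum_(y <- splits m) f y.1 y.2 = \sum_(y <- splits m') f y.1 y.2.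
Proof.
move=> fP pm; elim/perm_eq_ind: pm f fP.
- by [].
- move=> x s s' ps IH f fP; rewrite !splits_cons /=; congr (_ + _).
    by apply: (IH (fun a b => f (x :: a) b)) => *; apply: fP; rewrite ?perm_cons.
  by apply: (IH (fun a b => f a (x :: b))) => *; apply: fP; rewrite ?perm_cons.
- move=> x y s f fP; rewrite !splits_cons /= [in RHS]addrACA.
  by congr (_ + _ + (_ + _)); apply: eq_bigr => z _; apply: fP => //;
    apply: perm_cons2C.
- by move=> s1 s2 s3 IH1 IH2 f fP; rewrite IH1 ?IH2.
Qed.

End PermSums.

(** * The cut-and-join recursion *)

Section CutJoin.
Local Open Scope ring_scope.
Variables (R : comNzRingType) (u v w : R).

(* The part a of a component is encoded by a.-1, so that no positivity hypothesis
   is needed. A block [i :: m] lists the components in one orbit of the group; the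
   moves undo the last transposition (p q), where i is the component of q: p lies
   in another component (merge), in i with the colour opposite to q (twist), or in
   i with the colour of q (cut, which may also split the orbit). *)
Definition moves (x : seq nat) : seq (R * seq (seq nat)) :=
  if x is i :: m then
    [seq (u * y.1.+1%:R, [:: (i + y.1).+1 :: y.2]) | y <- picks m] ++
    [:: (i%:R * w, [:: i :: m])] ++
    [seq (v, [:: [:: a, i.-1 - a & m]%N]) | a <- iota 0 i] ++
    flatten [seq [seq (v, [:: a :: y.1; (i.-1 - a)%N :: y.2]) | y <- splits m]
            | a <- iota 0 i]
  else [::].

Definition step (f : seq (seq nat) -> R) (x : seq nat) : R :=
  \sum_(y <- moves x) y.1 * f y.2.

Fixpoint cutjoin_rec (f : seq (seq nat) -> R) (L : seq (seq nat)) : R :=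
  if L is x :: L' then
    (x == [:: 0%N])%:R * cutjoin_rec f L' + step (fun Y => f (Y ++ L')) x
  else 0.

Fixpoint cutjoin (k : nat) : seq (seq nat) -> R :=
  if k is k'.+1 then cutjoin_rec (cutjoin k')
  else fun L => (all (fun x => x == [:: 0%N]) L)%:R.

Definition cutjoin_pred k L := if k is k'.+1 then cutjoin k' L else 0.

Lemma stepE f i m :
  step f (i :: m) =
  u * (\sum_(y <- picks m) y.1.+1%:R * f [:: (i + y.1).+1 :: y.2])
  + w * (i%:R * f [:: i :: m])
  + v * (\sum_(0 <= a < i) (f [:: [:: a, i.-1 - a & m]%N]))
  + v * (\sum_(0 <= a < i)
      \sum_(y <- splits m) f [:: a :: y.1; (i.-1 - a)%N :: y.2]).
Proof.
rewrite /step /= !big_cat /= big_cons big_cat /= !big_map big_flatten /= big_map /index_iota.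
rewrite !subn0 !addrA; congr (_ + _ + _ + _).
- by rewrite mulr_sumr; apply: eq_bigr => y _; rewrite mulrA.
- by rewrite mulrA; congr (_ * _); rewrite mulrC.
- by rewrite mulr_sumr.
- rewrite mulr_sumr; apply: eq_bigr => a _; rewrite big_map /=.
  by rewrite mulr_sumr.
Qed.

Lemma cutjoin_cons k x L :
  cutjoin k (x :: L) = (x == [:: 0%N])%:R * cutjoin k L
    + step (fun Y => cutjoin_pred k (Y ++ L)) x.
Proof.
case: k => [|k] //=.
rewrite /step big1 ?addr0 => [|y _]; last by rewrite mulr0.
by rewrite -natrM mulnb.
Qed.

Definition blockwise (f : seq (seq nat) -> R) :=
  (forall L L', perm_eq L L' -> f L = f L') /\
  (forall x x' L, perm_eq x x' -> f (x :: L) = f (x' :: L)).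

Lemma sum_anti (F : nat -> nat -> R) i :
  \sum_(0 <= a < i) F a (i.-1 - a)%N = \sum_(0 <= a < i) F (i.-1 - a)%N a.
Proof.
rewrite big_nat_rev /= !big_nat; apply: eq_bigr => a /andP[_ lai].
by congr (F _ _); lia.
Qed.

Lemma convolution_sym (f : nat -> R) i j :
  (forall a, (a <= i + j)%N -> f a = f (i + j - a)%N) ->
  j.+1%:R * (\sum_(0 <= a < (i + j).+1) f a)
    + 2 * (\sum_(0 <= a < i) a.+1%:R * f (j + a).+1) =
  i.+1%:R * (\sum_(0 <= a < (i + j).+1) f a)
    + 2 * (\sum_(0 <= a < j) a.+1%:R * f (i + a).+1).
Proof.
have trunc p q : (forall a, (a <= p + q)%N -> f a = f (p + q - a)%N) ->
    2 * (\sum_(0 <= a < p) a.+1%:R * f (q + a).+1) =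
    \sum_(0 <= x < (p + q).+1) ((x - q) + (p - x))%N%:R * f x.
  move=> fs; have e1 : \sum_(0 <= a < p) a.+1%:R * f (q + a).+1 =
      \sum_(0 <= x < (p + q).+1) (x - q)%N%:R * f x.
    rewrite [RHS](big_cat_nat (n := q.+1)) //=; last by lia.
    rewrite [X in _ = X + _]big_nat [X in _ = X + _]big1 ?add0r => [|x /andP[_ xq]]; last first.
      by rewrite (_ : (x - q = 0)%N) ?mul0r //; apply/eqP; rewrite subn_eq0.
    rewrite -[X in _ = \big[_/_]_(X <= _ < _) _](add0n q.+1) big_addn subSS addnK.
    by apply: eq_bigr => a _; rewrite addnS subSn ?leq_addl // addnK addnC.
  have e2 : \sum_(0 <= a < p) a.+1%:R * f (q + a).+1 =
      \sum_(0 <= x < (p + q).+1) (p - x)%N%:R * f x.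
    rewrite e1 big_nat_rev /= !big_nat; apply: eq_bigr => x /andP[_ xn].
    rewrite add0n subSS -fs //; congr (_%:R * _).
    by rewrite subnAC addnK.
  rewrite (_ : 2 = 1 + 1) // mulrDl mul1r {1}e1 e2 -big_split /=.
  by apply: eq_bigr => x _; rewrite natrD mulrDl.
move=> fs; rewrite trunc // [X in _ = _ + X]trunc; last by rewrite addnC.
rewrite [(j + i)%N]addnC !mulr_sumr -!big_split /=; apply: eq_bigr => x _.
rewrite -!mulrDl -!natrD; congr (_%:R * _).
by rewrite !addSn; congr _.+1; case: (leqP x i); case: (leqP x j); lia.
Qed.

Lemma convolution_sym2 (F : nat -> nat -> R) i j :
  (forall a b, F a b = F b a) ->
  j.+1%:R * (\sum_(0 <= a < (i + j).+1) F a (i + j - a)%N)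
    + 2 * (\sum_(0 <= a < i) a.+1%:R * F (j + a).+1 (i.-1 - a)%N) =
  i.+1%:R * (\sum_(0 <= a < (j + i).+1) F a (j + i - a)%N)
    + 2 * (\sum_(0 <= a < j) a.+1%:R * F (i + a).+1 (j.-1 - a)%N).
Proof.
move=> FC; have E p q : \sum_(0 <= a < p) a.+1%:R * F (q + a).+1 (p.-1 - a)%N
    = \sum_(0 <= a < p) a.+1%:R * F (q + a).+1 (p + q - (q + a).+1)%N.
  by rewrite !big_nat; apply: eq_bigr => a ap; congr (_ * F _ _); lia.
rewrite !E [(j + i)%N]addnC.
apply: (convolution_sym (f := fun a => F a (i + j - a)%N)) => a ai.
by rewrite FC; congr F; lia.
Qed.

End CutJoin.

Section Commutation.
Local Open Scope ring_scope.
Variables (R : comNzRingType) (u v w : R).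
Variables (g : seq (seq nat) -> R) (m : seq nat).
Hypothesis gB : blockwise g.
Implicit Types i j : nat.

Let g1 x x' : perm_eq x x' -> g [:: x] = g [:: x'].
Proof. by move=> px; apply: gB.2. Qed.

Let g2 x x' y y' : perm_eq x x' -> perm_eq y y' -> g [:: x; y] = g [:: x'; y'].
Proof.
move=> px py; rewrite (gB.2 _ _ _ px) (gB.1 [:: x'; y] [:: y; x']).
  by rewrite (gB.2 _ _ _ py); apply: gB.1; apply: perm_cons2C.
exact: perm_cons2C.
Qed.

Let g2C x y : g [:: x; y] = g [:: y; x].
Proof. by apply: gB.1; apply: perm_cons2C. Qed.

Let g3 x x' y z : perm_eq x x' -> g [:: x; y; z] = g [:: x'; y; z].
Proof. by move=> px; apply: gB.2. Qed.

Let g3C x y z : g [:: x; y; z] = g [:: x; z; y].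
Proof. by apply: gB.1; rewrite perm_cons; apply: perm_cons2C. Qed.

Ltac pperm := by apply/seq.permP => ?; rewrite /= ?count_cat /=; ring.

(* Q_xy collects the terms of coefficient x * y when the first two parts i and j of
   a block are expanded one after the other, i first; each is symmetric in i and j. *)
Definition Q_uu1 i j := \sum_(y <- picks m)
  (y.1.+1 * (i + j + y.1 + 3))%N%:R * g [:: (i + j + y.1).+2 :: y.2].
Definition Q_uu2 i j := \sum_(y <- picks m) y.1.+1%:R *
  \sum_(z <- picks y.2) z.1.+1%:R * g [:: [:: (j + z.1).+1, (i + y.1).+1 & z.2]].
Definition Q_uw1 i j :=
  (j.+1 * (i + j).+1 + i * i.+1)%N%:R * g [:: (i + j).+1 :: m].
Definition Q_uw2 i j := \sum_(y <- picks m) (y.1.+1 * j)%N%:R *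
    g [:: [:: j, (i + y.1).+1 & y.2]]
  + \sum_(y <- picks m) (y.1.+1 * i)%N%:R * g [:: [:: i, (j + y.1).+1 & y.2]].
Definition Q_ww i j := (i * j)%N%:R * g [:: [:: j, i & m]].
Definition Q_uv1 i j :=
  j.+1%:R * (\sum_(0 <= a < (i + j).+1) g [:: [:: a, i + j - a & m]%N])
  + 2 * (\sum_(0 <= a < i) a.+1%:R * g [:: [:: (j + a).+1, i.-1 - a & m]%N]).
Definition Q_uv2 i j :=
  j.+1%:R * (\sum_(0 <= a < (i + j).+1)
      \sum_(y <- splits m) g [:: a :: y.1; (i + j - a)%N :: y.2])
  + 2 * (\sum_(0 <= a < i) a.+1%:R *
      \sum_(y <- splits m) g [:: (j + a).+1 :: y.1; (i.-1 - a)%N :: y.2]).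
Definition Q_uv3 i j :=
  \sum_(y <- picks m) y.1.+1%:R *
    (\sum_(0 <= c < j) g [:: [:: c, j.-1 - c, (i + y.1).+1 & y.2]%N])
  + \sum_(0 <= a < i) \sum_(y <- picks m)
      y.1.+1%:R * g [:: [:: (j + y.1).+1, a, i.-1 - a & y.2]%N].
Definition Q_uv4 i j :=
  \sum_(y <- picks m) y.1.+1%:R * (\sum_(0 <= c < j) \sum_(z <- splits y.2)
     g [:: [:: c, (i + y.1).+1 & z.1]; (j.-1 - c)%N :: z.2])
  + \sum_(0 <= a < i) \sum_(y <- splits m) \sum_(z <- picks y.1)
      z.1.+1%:R * g [:: [:: (j + z.1).+1, a & z.2]; (i.-1 - a)%N :: y.2].
Definition Q_vw1 i j :=
  i%:R * (\sum_(0 <= c < j) g [:: [:: c, j.-1 - c, i & m]%N])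
  + j%:R * (\sum_(0 <= a < i) g [:: [:: j, a, i.-1 - a & m]%N]).
Definition Q_vw2 i j :=
  i%:R * (\sum_(0 <= c < j) \sum_(y <- splits m)
    g [:: [:: c, i & y.1]; (j.-1 - c)%N :: y.2])
  + j%:R * (\sum_(0 <= a < i) \sum_(y <- splits m)
    g [:: [:: j, a & y.1]; (i.-1 - a)%N :: y.2]).
Definition Q_vv1 i j := \sum_(0 <= a < i) \sum_(0 <= c < j)
  g [:: [:: c, j.-1 - c, a, i.-1 - a & m]%N].
Definition Q_vv2 i j :=
  \sum_(0 <= a < i) \sum_(0 <= c < j) \sum_(y <- splits m)
    g [:: [:: c, a, i.-1 - a & y.1]%N; (j.-1 - c)%N :: y.2]
  + \sum_(0 <= a < i) \sum_(y <- splits m) \sum_(0 <= c < j)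
    g [:: [:: c, j.-1 - c, a & y.1]%N; (i.-1 - a)%N :: y.2].
Definition Q_vv3 i j := \sum_(0 <= a < i) \sum_(0 <= c < j) \sum_(y <- splits m)
    g [:: [:: c, a & y.1]; [:: j.-1 - c, i.-1 - a & y.2]%N].
Definition Q_vv4 i j :=
  \sum_(0 <= a < i) \sum_(y <- splits m) \sum_(0 <= c < j) \sum_(z <- splits y.1)
    g [:: [:: c, a & z.1]; (j.-1 - c)%N :: z.2; (i.-1 - a)%N :: y.2].

Lemma Q_uu1C i j : Q_uu1 i j = Q_uu1 j i.
Proof. by apply: eq_bigr => y _; rewrite (addnC i j). Qed.

Lemma Q_uu2C i j : Q_uu2 i j = Q_uu2 j i.
Proof.
rewrite /Q_uu2; under eq_bigr => y _ do rewrite mulr_sumr.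
under [RHS]eq_bigr => y _ do rewrite mulr_sumr.
rewrite (picks2C _ (fun a b c => a.+1%:R * (b.+1%:R * g [:: [:: (j + b).+1, (i + a).+1 & c]]))).
apply: eq_bigr => y _; apply: eq_bigr => z _.
by rewrite mulrCA; congr (_ * (_ * _)); apply: g1; pperm.
Qed.

Lemma Q_uw1C i j : Q_uw1 i j = Q_uw1 j i.
Proof. by rewrite /Q_uw1 (addnC i j); congr (_%:R * _); lia. Qed.

Lemma Q_uw2C i j : Q_uw2 i j = Q_uw2 j i.
Proof. by rewrite /Q_uw2 addrC. Qed.

Lemma Q_wwC i j : Q_ww i j = Q_ww j i.
Proof. by rewrite /Q_ww mulnC; congr (_ * _); apply: g1; pperm. Qed.

Lemma Q_uv1C i j : Q_uv1 i j = Q_uv1 j i.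
Proof.
apply: (convolution_sym2 (F := fun a b => g [:: [:: a, b & m]])) => a b.
by apply: g1; pperm.
Qed.

Lemma Q_uv2C i j : Q_uv2 i j = Q_uv2 j i.
Proof.
apply: (convolution_sym2 (F := fun a b =>
  \sum_(y <- splits m) g [:: a :: y.1; b :: y.2])) => a b.
rewrite (splitsC _ (fun y z => g [:: a :: y; b :: z])).
by apply: eq_bigr => y _; apply: g2C.
Qed.

Lemma Q_uv3C i j : Q_uv3 i j = Q_uv3 j i.
Proof.
have E p q : \sum_(0 <= a < p) \sum_(y <- picks m)
      y.1.+1%:R * g [:: [:: (q + y.1).+1, a, p.-1 - a & y.2]%N] =
  \sum_(y <- picks m) y.1.+1%:R *
    (\sum_(0 <= c < p) g [:: [:: c, p.-1 - c, (q + y.1).+1 & y.2]%N]).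
  rewrite exchange_big; apply: eq_bigr => y _; rewrite mulr_sumr.
  by apply: eq_bigr => a _; congr (_ * _); apply: g1; pperm.
by rewrite /Q_uv3 !E addrC.
Qed.

Lemma Q_uv4C i j : Q_uv4 i j = Q_uv4 j i.
Proof.
have E p q : \sum_(0 <= a < p) \sum_(y <- splits m) \sum_(z <- picks y.1)
      z.1.+1%:R * g [:: [:: (q + z.1).+1, a & z.2]; (p.-1 - a)%N :: y.2] =
  \sum_(y <- picks m) y.1.+1%:R * (\sum_(0 <= c < p) \sum_(z <- splits y.2)
     g [:: [:: c, (q + y.1).+1 & z.1]; (p.-1 - c)%N :: z.2]).
  under [RHS]eq_bigr => y _ do rewrite mulr_sumr.
  rewrite [RHS]exchange_big; apply: eq_bigr => a _ /=.
  rewrite (splits_picksl _ (fun x b c => x.+1%:R *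
     g [:: [:: (q + x).+1, a & b]; (p.-1 - a)%N :: c])).
  apply: eq_bigr => y _; rewrite mulr_sumr; apply: eq_bigr => z _.
  by congr (_ * _); apply: g2 => //; pperm.
by rewrite /Q_uv4 !E addrC.
Qed.

Lemma Q_vw1C i j : Q_vw1 i j = Q_vw1 j i.
Proof.
rewrite /Q_vw1 addrC; congr (_ * _ + _ * _); apply: eq_bigr => a _;
  apply: g1; pperm.
Qed.

Lemma Q_vw2C i j : Q_vw2 i j = Q_vw2 j i.
Proof.
rewrite /Q_vw2 addrC; congr (_ * _ + _ * _); apply: eq_bigr => a _;
  apply: eq_bigr => y _; apply: g2 => //; pperm.
Qed.

Lemma Q_vv1C i j : Q_vv1 i j = Q_vv1 j i.
Proof.
rewrite /Q_vv1 exchange_big; apply: eq_bigr => a _; apply: eq_bigr => c _.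
by apply: g1; pperm.
Qed.

Lemma Q_vv2C i j : Q_vv2 i j = Q_vv2 j i.
Proof.
have E p q :  \sum_(0 <= a < p) \sum_(y <- splits m) \sum_(0 <= c < q)
    g [:: [:: c, q.-1 - c, a & y.1]%N; (p.-1 - a)%N :: y.2] =
  \sum_(0 <= a < q) \sum_(0 <= c < p) \sum_(y <- splits m)
    g [:: [:: c, a, q.-1 - a & y.1]%N; (p.-1 - c)%N :: y.2].
  rewrite [RHS]exchange_big; apply: eq_bigr => a _ /=.
  rewrite exchange_big; apply: eq_bigr => c _; apply: eq_bigr => y _.
  by apply: g2 => //; pperm.
by rewrite /Q_vv2 !E addrC.
Qed.

Lemma Q_vv3C i j : Q_vv3 i j = Q_vv3 j i.
Proof.
rewrite /Q_vv3 exchange_big; apply: eq_bigr => a _; apply: eq_bigr => c _.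
by apply: eq_bigr => y _; apply: g2; pperm.
Qed.

Lemma Q_vv4C i j : Q_vv4 i j = Q_vv4 j i.
Proof.
rewrite /Q_vv4.
under eq_bigr => a _ do rewrite exchange_big.
under [RHS]eq_bigr => a _ do rewrite exchange_big.
rewrite exchange_big; apply: eq_bigr => a _; apply: eq_bigr => c _ /=.
rewrite (splitsA _ (fun y z t => g [:: [:: a, c & y]; (j.-1 - a)%N :: z; (i.-1 - c)%N :: t])).
rewrite (splitsA _ (fun y z t => g [:: [:: c, a & y]; (i.-1 - c)%N :: z; (j.-1 - a)%N :: t])).
apply: eq_bigr => y _.
rewrite (splitsC _ (fun z t => g [:: [:: a, c & y.1]; (j.-1 - a)%N :: z; (i.-1 - c)%N :: t])).
apply: eq_bigr => z _; rewrite g3C; apply: g3; pperm.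
Qed.

Lemma splits_consC x a b :
  \sum_(0 <= c < x) \sum_(z <- splits (a :: b))
    g [:: c :: z.1; (x.-1 - c)%N :: z.2] = 2 * \sum_(0 <= c < x)
    \sum_(z <- splits b) g [:: [:: c, a & z.1]; (x.-1 - c)%N :: z.2].
Proof.
under eq_bigr => c _ do rewrite splits_cons /=.
rewrite big_split /= mulr2n mulrDl mul1r; congr (_ + _).
rewrite [RHS](sum_anti (fun c d => \sum_(z <- splits b)
  g [:: [:: c, a & z.1]; d :: z.2])).
apply: eq_bigr => c _.
rewrite (splitsC _ (fun z t => g [:: c :: z; [:: (x.-1 - c)%N, a & t]])).
by apply: eq_bigr => z _; apply: g2C.
Qed.

Variable f : seq (seq nat) -> R.
Hypothesis fB : blockwise f.
Hypothesis fE : forall x Y, f (x :: Y) = (x == [:: 0%N])%:R * f Y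
  + step u v w (fun Z => g (Z ++ Y)) x.

Let f1 x x' Y : perm_eq x x' -> f (x :: Y) = f (x' :: Y).
Proof. by move=> px; apply: fB.2. Qed.

Lemma expand_merge i j :
  f [:: (i + j).+1 :: m] =
  u * (\sum_(y <- picks m) y.1.+1%:R * g [:: (i + j + y.1).+2 :: y.2])
  + w * ((i + j).+1%:R * g [:: (i + j).+1 :: m])
  + v * (\sum_(0 <= a < (i + j).+1) g [:: [:: a, i + j - a & m]%N])
  + v * (\sum_(0 <= a < (i + j).+1)
      \sum_(y <- splits m) g [:: a :: y.1; (i + j - a)%N :: y.2]).
Proof. by rewrite fE mul0r add0r stepE. Qed.

Lemma expand_pick i j :
  \sum_(y <- picks m) y.1.+1%:R * f [:: [:: (i + y.1).+1, j & y.2]] =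
  u * (\sum_(y <- picks m) (y.1.+1 * (i + y.1).+2)%N%:R
          * g [:: (i + j + y.1).+2 :: y.2] + Q_uu2 i j)
  + w * (\sum_(y <- picks m) (y.1.+1 * j)%N%:R
          * g [:: [:: j, (i + y.1).+1 & y.2]])
  + v * (\sum_(y <- picks m) y.1.+1%:R *
    (\sum_(0 <= c < j) g [:: [:: c, j.-1 - c, (i + y.1).+1 & y.2]%N]))
  + v * (2 * \sum_(y <- picks m) y.1.+1%:R * (\sum_(0 <= c < j) \sum_(z <- splits y.2)
     g [:: [:: c, (i + y.1).+1 & z.1]; (j.-1 - c)%N :: z.2])).
Proof.
rewrite /Q_uu2 !mulrDr !mulr_sumr -!big_split /=; apply: eq_bigr => y _.
rewrite (f1 _ (perm_cons2C _ _ _)) fE eqseq_cons andbF mul0r add0r stepE /=.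
rewrite picks_cons /=.
rewrite splits_consC.
rewrite (_ : (j + (i + y.1).+1).+1 = (i + j + y.1).+2); last by lia.
rewrite !natrM; ring.
Qed.

Lemma expand_twist i j :
  i%:R * f [:: [:: i, j & m]] =
  u * ((i * i.+1)%N%:R * g [:: (i + j).+1 :: m]
      + \sum_(y <- picks m) (y.1.+1 * i)%N%:R * g [:: [:: i, (j + y.1).+1 & y.2]])
  + w * Q_ww i j
  + v * (i%:R * (\sum_(0 <= c < j) g [:: [:: c, j.-1 - c, i & m]%N]))
  + v * (2 * (i%:R * (\sum_(0 <= c < j) \sum_(y <- splits m)
    g [:: [:: c, i & y.1]; (j.-1 - c)%N :: y.2]))).
Proof.
rewrite (f1 _ (perm_cons2C _ _ _)) fE eqseq_cons andbF mul0r add0r stepE /=.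
rewrite picks_cons /= splits_consC /Q_ww (addnC i j).
have -> : \sum_(y <- picks m) (y.1.+1 * i)%N%:R
      * g [:: [:: i, (j + y.1).+1 & y.2]] =
    i%:R * \sum_(y <- picks m) y.1.+1%:R * g [:: [:: (j + y.1).+1, i & y.2]].
  rewrite mulr_sumr; apply: eq_bigr => y _.
  by rewrite natrM mulrA (mulrC i%:R); congr (_ * _); apply: g1; pperm.
by rewrite !natrM; ring.
Qed.

Lemma expand_cut i j :
  \sum_(0 <= a < i) f [:: [:: a, i.-1 - a, j & m]%N] =
  u * (2 * (\sum_(0 <= a < i) a.+1%:R * g [:: [:: (j + a).+1, i.-1 - a & m]%N])
      + \sum_(0 <= a < i) \sum_(y <- picks m)
          y.1.+1%:R * g [:: [:: (j + y.1).+1, a, i.-1 - a & y.2]%N])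
  + w * (j%:R * (\sum_(0 <= a < i) g [:: [:: j, a, i.-1 - a & m]%N]))
  + v * Q_vv1 i j
  + v * (2 * (\sum_(0 <= a < i) \sum_(0 <= c < j) \sum_(y <- splits m)
      g [:: [:: c, a, i.-1 - a & y.1]%N; (j.-1 - c)%N :: y.2])
      + 2 * Q_vv3 i j).
Proof.
have -> : 2 * (\sum_(0 <= a < i) a.+1%:R * g [:: [:: (j + a).+1, i.-1 - a & m]%N])
  = \sum_(0 <= a < i) a.+1%:R * g [:: [:: (j + a).+1, i.-1 - a & m]%N]
  + \sum_(0 <= a < i) (i.-1 - a).+1%:R * g [:: [:: (j + (i.-1 - a)).+1, a & m]%N].
  rewrite mulr2n mulrDl mul1r; congr (_ + _).
  exact: (sum_anti (fun a b => a.+1%:R * g [:: [:: (j + a).+1, b & m]])).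
rewrite /Q_vv1 /Q_vv3 !mulrDr !mulr_sumr -!big_split /=; apply: eq_bigr => a _.
rewrite (f1 (x' := [:: j, a, (i.-1 - a)%N & m]) _); last by pperm.
rewrite fE eqseq_cons andbF mul0r add0r stepE /=.
rewrite !picks_cons /= splits_consC.
under [X in v * (2 * X)]eq_bigr => c _ do rewrite splits_cons /=.
rewrite big_split /=.
by ring.
Qed.

Lemma expand_splitl i j :
  \sum_(0 <= a < i) \sum_(y <- splits m)
    f [:: [:: a, j & y.1]; (i.-1 - a)%N :: y.2] =
  u * (\sum_(0 <= a < i) a.+1%:R *
        (\sum_(y <- splits m) g [:: (j + a).+1 :: y.1; (i.-1 - a)%N :: y.2])
      + \sum_(0 <= a < i) \sum_(y <- splits m) \sum_(z <- picks y.1)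
      z.1.+1%:R * g [:: [:: (j + z.1).+1, a & z.2]; (i.-1 - a)%N :: y.2])
  + w * (j%:R * (\sum_(0 <= a < i) \sum_(y <- splits m)
      g [:: [:: j, a & y.1]; (i.-1 - a)%N :: y.2]))
  + v * (\sum_(0 <= a < i) \sum_(y <- splits m) \sum_(0 <= c < j)
      g [:: [:: c, j.-1 - c, a & y.1]%N; (i.-1 - a)%N :: y.2])
  + v * (2 * Q_vv4 i j).
Proof.
rewrite /Q_vv4 !mulrDr !mulr_sumr -!big_split /=; apply: eq_bigr => a _.
rewrite !mulr_sumr -!big_split /=; apply: eq_bigr => y _.
rewrite (f1 _ (perm_cons2C _ _ _)) fE eqseq_cons andbF mul0r add0r stepE /=.
rewrite picks_cons /=.
have -> : \sum_(0 <= c < j) \sum_(z <- splits (a :: y.1))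
    g [:: c :: z.1; (j.-1 - c)%N :: z.2; (i.-1 - a)%N :: y.2] = 2 *
    \sum_(0 <= c < j) \sum_(z <- splits y.1)
    g [:: [:: c, a & z.1]; (j.-1 - c)%N :: z.2; (i.-1 - a)%N :: y.2].
  under eq_bigr => c _ do rewrite splits_cons /=.
  rewrite big_split /= mulr2n mulrDl mul1r; congr (_ + _).
  rewrite [RHS](sum_anti (fun c d => \sum_(z <- splits y.1)
    g [:: [:: c, a & z.1]; d :: z.2; (i.-1 - a)%N :: y.2])).
  apply: eq_bigr => c _.
  rewrite (splitsC _ (fun z t => g [:: c :: z; [:: (j.-1 - c)%N, a & t]; (i.-1 - a)%N :: y.2])).
  by apply: eq_bigr => z _; apply: gB.1; apply: perm_cons2C.
by ring.
Qed.

Lemma expand_splitr i j :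
  \sum_(0 <= a < i) \sum_(y <- splits m)
    f [:: a :: y.1; [:: (i.-1 - a)%N, j & y.2]] =
  \sum_(0 <= a < i) \sum_(y <- splits m)
    f [:: [:: a, j & y.1]; (i.-1 - a)%N :: y.2].
Proof.
rewrite [RHS](sum_anti (fun a b => \sum_(y <- splits m)
    f [:: [:: a, j & y.1]; b :: y.2])).
apply: eq_bigr => a _.
rewrite (splitsC _ (fun y z => f [:: a :: y; [:: (i.-1 - a)%N, j & z]])).
by apply: eq_bigr => y _; apply: fB.1; apply: perm_cons2C.
Qed.

Lemma step_swap_expand i j :
  step u v w f [:: i, j & m] =
  u * u * (Q_uu1 i j + Q_uu2 i j) + u * w * (Q_uw1 i j + Q_uw2 i j)
  + w * w * Q_ww i j
  + u * v * (Q_uv1 i j + Q_uv2 i j + Q_uv3 i j + 2 * Q_uv4 i j)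
  + v * w * (Q_vw1 i j + 2 * Q_vw2 i j)
  + v * v * (Q_vv1 i j + 2 * Q_vv2 i j + 2 * Q_vv3 i j + 4 * Q_vv4 i j).
Proof.
rewrite stepE picks_cons /=.
under [X in _ + v * X = _]eq_bigr => a _ do rewrite splits_cons /=.
rewrite [X in _ + v * X = _]big_split /= expand_splitr expand_splitl expand_cut.
rewrite expand_twist expand_merge expand_pick.
rewrite /Q_uw1 /Q_uw2 /Q_uv1 /Q_uv2 /Q_uv3 /Q_uv4 /Q_vw1 /Q_vw2 /Q_vv2.
have -> : Q_uu1 i j =
    j.+1%:R * (\sum_(y <- picks m) y.1.+1%:R * g [:: (i + j + y.1).+2 :: y.2])
    + \sum_(y <- picks m) (y.1.+1 * (i + y.1).+2)%N%:R
          * g [:: (i + j + y.1).+2 :: y.2].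
  rewrite /Q_uu1 mulr_sumr -big_split; apply: eq_bigr => y _ /=.
  rewrite mulrA -mulrDl -natrM -natrD; congr (_%:R * _); lia.
rewrite !natrM !natrD !natrM; ring.
Qed.

(* This is the commutation of the Virasoro constraints attached to i and j. *)
Lemma step_swap i j : step u v w f [:: i, j & m] = step u v w f [:: j, i & m].
Proof.
rewrite !step_swap_expand Q_uu1C Q_uu2C Q_uw1C Q_uw2C Q_wwC Q_uv1C Q_uv2C Q_uv3C.
by rewrite Q_uv4C Q_vw1C Q_vw2C Q_vv1C Q_vv2C Q_vv3C Q_vv4C.
Qed.

End Commutation.

Section Blockwise.
Local Open Scope ring_scope.
Variables (R : comNzRingType) (u v w : R).
Local Notation step := (step u v w).
Local Notation cutjoin := (cutjoin u v w).
Local Notation cutjoin_pred := (cutjoin_pred u v w).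

Lemma blockwise_cat (g : seq (seq nat) -> R) L :
  blockwise g -> blockwise (fun Y => g (Y ++ L)).
Proof.
case=> gL gx; split=> [Y Y' pY|x x' Y px]; last exact: gx.
by apply: gL; rewrite perm_cat2r.
Qed.

Lemma eq_step (f f' : seq (seq nat) -> R) x : f =1 f' -> step f x = step f' x.
Proof. by move=> ff; apply: eq_bigr => y _; rewrite ff. Qed.

Lemma step_perm (f g : seq (seq nat) -> R) :
  blockwise f -> blockwise g ->
  (forall x Y, f (x :: Y) = (x == [:: 0%N])%:R * f Y
     + step (fun Z => g (Z ++ Y)) x) ->
  forall x x', perm_eq x x' -> step f x = step f x'.
Proof.
move=> fB gB fE x x' px; elim/perm_eq_ind: px.
- by [].
- move=> i m m' pm _.
  have p1 a Y : f ((a :: m) :: Y) = f ((a :: m') :: Y).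
    by apply: fB.2; rewrite perm_cons.
  rewrite !stepE; congr (_ * _ + _ * _ + _ * _ + _ * _).
  + apply: (picks_perm (f := fun a b => a.+1%:R * f [:: (i + a).+1 :: b])) pm.
    by move=> a s s' ps; rewrite (fB.2 _ ((i + a).+1 :: s')) // perm_cons.
  + by rewrite p1.
  + by apply: eq_bigr => a _; rewrite (fB.2 _ [:: a, i.-1 - a & m']%N) ?perm_cons.
  + apply: eq_bigr => a _.
    apply: (splits_perm (f := fun b c => f [:: a :: b; (i.-1 - a)%N :: c])) pm.
    move=> s1 s2 s1' s2' p12 p12'.
    rewrite (fB.2 _ (a :: s1')) ?perm_cons // (fB.1 _ _ (perm_cons2C _ _ _)).
    rewrite (fB.2 _ ((i.-1 - a)%N :: s2')) ?perm_cons //.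
    by rewrite (fB.1 _ _ (perm_cons2C _ _ _)).
- by move=> i j m; apply: (step_swap m gB fB fE).
- by move=> a b c -> ->.
Qed.

Lemma cutjoin_blockwise k : blockwise (cutjoin k) /\ blockwise (cutjoin_pred k).
Proof.
have eq1 x x' : perm_eq x x' -> (x == [:: 0%N]) = (x' == [:: 0%N]).
  by move=> px; apply/eqP/eqP => e; move: px; rewrite e ?(perm_sym [:: _]);
    move/perm_small_eq => ->.
elim: k => [|k [fB gB]].
  split; split=> //= [L L' pL|x x' L px]; first by rewrite (perm_all _ pL).
  by rewrite (eq1 _ _ px).
have fE L x Y : cutjoin k ((x :: Y) ++ L) = (x == [:: 0%N])%:R * cutjoin k (Y ++ L)
     + step (fun Z => cutjoin_pred k ((Z ++ Y) ++ L)) x.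
  by rewrite cutjoin_cons; congr (_ + _); apply: eq_step => Z; rewrite catA.
split=> //; split=> [L1 L2 pL|x x' L px]; last first.
  rewrite !cutjoin_cons (eq1 _ _ px); congr (_ + _).
  apply: (step_perm (f := fun Y => cutjoin k (Y ++ L))
    (g := fun Y => cutjoin_pred k (Y ++ L))) px; try exact: blockwise_cat.
  by move=> y Y; apply: fE.
elim/perm_eq_ind: pL => // [x m m' pm IH|x y m|m1 m2 m3 -> -> //].
  rewrite !cutjoin_cons IH; congr (_ + _); apply: eq_step => Y.
  by apply: fB.1; rewrite perm_cat2l.
have E z t L : step (fun Y => cutjoin k (Y ++ t :: L)) z =
    (t == [:: 0%N])%:R * step (fun Y => cutjoin k (Y ++ L)) z +
    \sum_(a <- moves u v w z) \sum_(b <- moves u v w t)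
      a.1 * b.1 * cutjoin_pred k (b.2 ++ a.2 ++ L).
  rewrite mulr_sumr -big_split; apply: eq_bigr => a _ /=.
  rewrite (fB.1 _ (t :: a.2 ++ L)); last by have /permEl := perm_catCA a.2 [:: t] L.
  rewrite cutjoin_cons mulrDr mulrCA; congr (_ + _).
  by rewrite mulr_sumr; apply: eq_bigr => b _; rewrite mulrA.
rewrite !cutjoin_cons !E !mulrDr !addrA mulrCA -!addrA; congr (_ + _).
rewrite addrCA; congr (_ + (_ + _)).
rewrite exchange_big; apply: eq_bigr => a _; apply: eq_bigr => b _.
rewrite [b.1 * _]mulrC; congr (_ * _); apply: gB.1.
by have /permEl := perm_catCA a.2 b.2 m.
Qed.

Lemma cutjoin_perm k L L' : perm_eq L L' -> cutjoin k L = cutjoin k L'.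
Proof. by apply: (cutjoin_blockwise k).1.1. Qed.

Lemma cutjoin_perm1 k x x' L :
  perm_eq x x' -> cutjoin k (x :: L) = cutjoin k (x' :: L).
Proof. by apply: (cutjoin_blockwise k).1.2. Qed.

Lemma cutjoin_trivial k L :
  all (pred1 [:: 0%N]) L -> cutjoin k.+1 L = 0.
Proof.
elim: L => // x L IH /= /andP[/eqP -> aL]; rewrite -/(cutjoin k.+1 L) IH //.
by rewrite mulr0 add0r stepE picks_nil !big_geq // !(mulr0, mul0r, addr0).
Qed.

Lemma cutjoin_nil k : cutjoin k [::] = (k == 0%N)%:R.
Proof. by case: k. Qed.

Lemma cutjoin_cat k L1 L2 :
  cutjoin k (L1 ++ L2) =
  \sum_(0 <= k1 < k.+1) cutjoin k1 L1 * cutjoin (k - k1) L2.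
Proof.
elim: k L1 => [|k IH] L1.
  by rewrite big_nat1 /= all_cat -mulnb natrM.
elim: L1 => [|x L1 IHL].
  rewrite big_nat_recl // cutjoin_nil mul1r subn0 big1_seq ?addr0 // => i _.
  by rewrite cutjoin_nil mul0r.
rewrite cat_cons cutjoin_cons IHL.
under [RHS]eq_bigr => k1 _ do rewrite cutjoin_cons mulrDl -mulrA.
rewrite big_split /= -mulr_sumr; congr (_ + _).
rewrite big_nat_recl //= {2}/step [X in _ = X * _ + _]big1 => [|y _];
  last by rewrite mulr0.
rewrite mul0r add0r /step.
under [RHS]eq_bigr => k1 _ do rewrite mulr_suml.
rewrite exchange_big; apply: eq_bigr => y _ /=.
rewrite catA IH mulr_sumr; apply: eq_bigr => k1 _.
by rewrite subSS mulrA.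
Qed.

Definition connected k m := cutjoin k [:: m].

Lemma connected_perm k m m' : perm_eq m m' -> connected k m = connected k m'.
Proof. exact: cutjoin_perm1. Qed.

Lemma connected0 m : connected 0 m = (m == [:: 0%N])%:R.
Proof. by rewrite /connected /= andbT. Qed.

Lemma connectedS k i m :
  connected k.+1 (i :: m) =
  u * (\sum_(y <- picks m) y.1.+1%:R * connected k ((i + y.1).+1 :: y.2))
  + w * (i%:R * connected k (i :: m))
  + v * (\sum_(0 <= a < i) (connected k [:: a, i.-1 - a & m]%N
      + \sum_(y <- splits m) \sum_(0 <= k1 < k.+1)
         connected k1 (a :: y.1) * connected (k - k1) ((i.-1 - a)%N :: y.2))).
Proof.
rewrite /connected cutjoin_cons cutjoin_nil mulr0 add0r stepE -!addrA.
congr (_ + (_ + _)); rewrite -mulrDr -big_split; congr (_ * _).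
apply: eq_bigr => a _; congr (_ + _); apply: eq_bigr => y _.
exact: (cutjoin_cat k [:: a :: y.1] [:: (i.-1 - a)%N :: y.2]).
Qed.

End Blockwise.

(** * Matchings and their components *)

Section Matchings.
Variable n : nat.
Local Notation V := (bvert n).
Local Notation tau := (tau n).
Implicit Types (rho : {perm V}) (x y z p q : V) (A B Y : {set V}).

Definition matching rho := [forall x, (rho (rho x) == x) && (rho x != x)].

Lemma matchingP rho :
  reflect ((forall x, rho (rho x) = x) /\ forall x, rho x != x) (matching rho).
Proof.
apply: (iffP forallP) => [H|[H1 H2] x]; last by rewrite H1 eqxx H2.
by split=> x; have /andP[/eqP ? ?] := H x.
Qed.

Lemma tauE x : tau x = (x.1, ~~ x.2).
Proof. by rewrite permE. Qed.

Lemma tauK x : tau (tau x) = x.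
Proof. by rewrite !tauE /= negbK; case: x. Qed.

Lemma tau_neq x : tau x != x.
Proof. by rewrite tauE; case: x => i []; apply/eqP => -[]. Qed.

Lemma tau_fst x : (tau x).1 = x.1.
Proof. by rewrite tauE. Qed.

Lemma fst_tau x y : x.1 = y.1 -> y = x \/ y = tau x.
Proof.
by rewrite tauE; case: x => i []; case: y => j [] /= ->; [left|right|right|left].
Qed.

Lemma matching_tau : matching tau.
Proof. by apply/matchingP; split; [apply: tauK|apply: tau_neq]. Qed.

Definition stable rho Y := [forall x in Y, (rho x \in Y) && (tau x \in Y)].

Lemma stableP rho Y :
  reflect (forall x, x \in Y -> rho x \in Y /\ tau x \in Y) (stable rho Y).
Proof.
apply: (iffP forall_inP) => H x xY; last by apply/andP; apply: H.
by apply/andP; apply: H.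
Qed.

Lemma stable_rho rho Y x : matching rho -> stable rho Y -> (rho x \in Y) = (x \in Y).
Proof.
move=> /matchingP[rK _] /stableP sY; apply/idP/idP => [/sY[]|/sY[]] //.
by rewrite rK.
Qed.

Lemma stable_tau rho Y x : stable rho Y -> (tau x \in Y) = (x \in Y).
Proof.
move=> /stableP sY; apply/idP/idP => [/sY[_]|/sY[]] //.
by rewrite tauK.
Qed.

Lemma stableI rho A B : stable rho A -> stable rho B -> stable rho (A :&: B).
Proof.
move=> /stableP sA /stableP sB; apply/stableP => x; rewrite !inE.
by move=> /andP[/sA[-> ->] /sB[-> ->]].
Qed.

Lemma stableU rho A B : stable rho A -> stable rho B -> stable rho (A :|: B).
Proof.
move=> /stableP sA /stableP sB; apply/stableP => x; rewrite !inE.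
by move=> /orP[/sA[-> ->]|/sB[-> ->]]; rewrite ?orbT.
Qed.

Lemma stableD rho A B :
  matching rho -> stable rho A -> stable rho B -> stable rho (A :\: B).
Proof.
move=> mr sA sB; apply/stableP => x; rewrite !inE.
by rewrite !(stable_rho _ mr) // !(stable_tau _ sA) (stable_tau _ sB).
Qed.

Lemma union_graph_sym rho : matching rho -> symmetric (union_graph rho).
Proof.
move=> /matchingP[rK _] x y; rewrite /union_graph.
congr (_ || _); apply/eqP/eqP => ->; by rewrite ?rK ?tauK.
Qed.

Lemma componentsP rho A : matching rho ->
  reflect [/\ A != set0, stable rho A &
    forall Y, Y \subset A -> stable rho Y -> Y != set0 -> Y = A]
  (A \in components rho).
Proof.
move=> mr; have cs := sym_connect_sym (union_graph_sym mr).
have stC Y : stable rho Y -> forall x y, connect (union_graph rho) x y ->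
    x \in Y -> y \in Y.
  move=> sY x y xy xin; rewrite -(closed_connect _ xy) //.
  apply: intro_closed => // a b /orP[]/eqP -> aY.
    by rewrite stable_rho.
  by rewrite (stable_tau _ sY).
have cS x : stable rho [set y in setT | connect (union_graph rho) x y].
  apply/stableP => y; rewrite !inE /= => xy.
  by split; apply: (connect_trans xy); apply: connect1; rewrite /union_graph eqxx ?orbT.
apply: (iffP imsetP) => [[x _ ->]|[A0 sA minA]].
  split=> //; first by apply/set0Pn; exists x; rewrite !inE connect0.
  move=> Y YA sY /set0Pn[y yY]; apply/eqP; rewrite eqEsubset YA /=.
  apply/subsetP => z; rewrite !inE /= => xz; apply: (stC _ sY y) => //.
  have := subsetP YA _ yY; rewrite !inE /= cs => yx.
  exact: connect_trans yx xz.
have /set0Pn[x xA] := A0; exists x => //; apply/esym; apply: minA => //.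
  by apply/subsetP => y; rewrite !inE /= => xy; apply: stC xy xA.
by apply/set0Pn; exists x; rewrite !inE connect0.
Qed.

Lemma component_of rho x : matching rho -> exists2 A, A \in components rho & x \in A.
Proof.
move=> mr; exists [set y in setT | connect (union_graph rho) x y].
  by apply/imsetP; exists x.
by rewrite !inE connect0.
Qed.

Lemma component_disjoint rho A B x : matching rho ->
  A \in components rho -> B \in components rho -> x \in A -> x \in B -> A = B.
Proof.
move=> mr /(componentsP _ mr)[_ sA mA] /(componentsP _ mr)[_ sB mB] xA xB.
have n0 : A :&: B != set0 by apply/set0Pn; exists x; rewrite !inE xA.
by rewrite -(mA _ (subsetIl A B)) ?stableI // -{2}(mB _ (subsetIr A B)) ?stableI.
Qed.

Definition lists_components rho (ls : seq {set V}) :=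
  perm_eq ls (enum (components rho)).

Lemma lists_componentsP rho ls : matching rho ->
  lists_components rho ls <->
  [/\ uniq ls, {subset ls <= components rho} & forall x, exists2 A, A \in ls & x \in A].
Proof.
move=> mr; split=> [pls|[uls sls cls]].
  have ml A : (A \in ls) = (A \in components rho) by rewrite (perm_mem pls) mem_enum.
  split=> [|A|x]; first by rewrite (perm_uniq pls) enum_uniq.
    by rewrite ml.
  by have [A] := component_of x mr; rewrite -ml => ??; exists A.
apply: uniq_perm => //; first exact: enum_uniq.
move=> A; rewrite mem_enum; apply/idP/idP => [/sls//|cA].
have /(componentsP _ mr)[/set0Pn[x xA] _ _] := cA.
have [B Bls xB] := cls x.
by rewrite (component_disjoint mr cA (sls _ Bls) xA xB).
Qed.

End Matchings.

Section Walks.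
Variable n : nat.
Local Notation V := (bvert n).
Local Notation tau := (tau n).
Implicit Types (rho : {perm V}) (x y z p q : V) (A B Y : {set V}).

Lemma twistE p q rho x :
  twist (tperm p q) rho x = tperm p q (rho (tperm p q x)).
Proof. by rewrite /twist /conjg tpermV !permM. Qed.

Lemma twistK p q rho : twist (tperm p q) (twist (tperm p q) rho) = rho.
Proof. by apply/permP => x; rewrite !twistE !tpermK. Qed.

Lemma matching_twist p q rho : matching (twist (tperm p q) rho) = matching rho.
Proof.
have H r : matching r -> matching (twist (tperm p q) r).
  move=> /matchingP[rK rn]; apply/matchingP; split=> x; rewrite !twistE.
    by rewrite tpermK rK tpermK.
  by rewrite -(inj_eq (@perm_inj _ (tperm p q))) tpermK.
by apply/idP/idP => /H //; rewrite twistK.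
Qed.

Lemma mem_tperm p q Y x : (p \in Y) = (q \in Y) -> (tperm p q x \in Y) = (x \in Y).
Proof. by move=> e; case: tpermP => // ->. Qed.

Lemma stable_twist p q rho Y :
  (p \in Y) = (q \in Y) -> stable (twist (tperm p q) rho) Y = stable rho Y.
Proof.
have H r : (p \in Y) = (q \in Y) -> stable r Y -> stable (twist (tperm p q) r) Y.
  move=> e /stableP sY; apply/stableP => x xY; rewrite twistE mem_tperm //.
  have /sY[] : tperm p q x \in Y by rewrite mem_tperm.
  by have /sY[] := xY.
by move=> e; apply/idP/idP => /(H _ e) //; rewrite twistK.
Qed.

Lemma component_twist p q rho A :
  matching rho -> p \notin A -> q \notin A ->
  A \in components rho -> A \in components (twist (tperm p q) rho).
Proof.
move=> mr pA qA /(componentsP _ mr)[A0 sA mA].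
apply/componentsP; first by rewrite matching_twist.
split=> //; first by rewrite stable_twist // (negPf pA) (negPf qA).
move=> Y YA sY; apply: mA => //.
have notY z : z \notin A -> z \in Y = false.
  by move=> zA; apply: contraNF zA; apply: (subsetP YA).
by rewrite -(@stable_twist p q) // !notY.
Qed.

Lemma stable_avoid rho A Y p q : matching rho -> A \in components rho ->
  Y \subset A -> q \in A ->
  p \notin Y -> q \notin Y -> stable (twist (tperm p q) rho) Y -> Y = set0.
Proof.
move=> mr /(componentsP _ mr)[A0 sA mA] YA qA pY qY sY; apply/eqP.
apply: contraNT (qY) => Y0; rewrite (mA Y) //.
by rewrite -(@stable_twist p q) // (negPf pY) (negPf qY).
Qed.

(* Each component consists of two orbits of the walk, exchanged by tau; they are
   called its two colours below. *)
Definition walk rho x := rho (tau x).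

Lemma walk_inj rho : injective (walk rho).
Proof. by move=> x y /perm_inj /perm_inj. Qed.

Lemma walk_neq_tau rho t x : matching rho -> iter t (walk rho) x != tau x.
Proof.
move=> /matchingP[rK rn].
have [k] := ubnP t; elim: k t x => // k IH [|[|t]] x tk.
- by rewrite eq_sym tau_neq.
- by rewrite /= /walk rn.
have tk' : t < k by lia.
apply/eqP => e; have /eqP := IH t (walk rho x) tk'; apply.
have e' : walk rho (iter t (walk rho) (walk rho x)) = tau x by rewrite -iterSr -iterS.
by rewrite -[LHS]tauK -[tau (iter _ _ _)]rK -/(walk rho _) e'.
Qed.

Section Orbit.
Variables (rho : {perm V}) (A : {set V}) (q : V).
Hypotheses (mr : matching rho) (cA : A \in components rho) (qA : q \in A).
Local Notation f := (walk rho).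

Lemma rho_iter_walk t : rho (iter t.+1 f q) = tau (iter t f q).
Proof. by have /matchingP[rK _] := mr; rewrite iterS rK. Qed.

Lemma walk_component x :
  (x \in A) = (x \in fingraph.orbit f q) || (tau x \in fingraph.orbit f q).
Proof.
have [A0 sA mA] := componentsP _ mr cA.
have oE y : (y \in fingraph.orbit f q) = fconnect f q y by rewrite fconnect_orbit.
have fin y : (f y \in fingraph.orbit f q) = (y \in fingraph.orbit f q).
  by rewrite !oE -same_fconnect1_r //; apply: walk_inj.
set O := [set y | (y \in fingraph.orbit f q) || (tau y \in fingraph.orbit f q)].
suff -> : A = O by rewrite inE.
apply/esym/mA; last by apply/set0Pn; exists q; rewrite inE in_orbit.
  have itA t : iter t f q \in A.
    by elim: t => // t IH; rewrite iterS stable_rho // (stable_tau _ sA).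
  apply/subsetP => y; rewrite inE => /orP[|] /trajectP[t _ e].
    by rewrite e.
  by rewrite -(stable_tau _ sA) e.
apply/stableP => y; rewrite !inE => yO; split; last by rewrite tauK orbC.
have /matchingP[rK _] := mr.
have e1 : rho y = f (tau y) by rewrite /walk tauK.
have e2 : f (tau (rho y)) = y by rewrite /walk tauK rK.
by rewrite e1 fin -e1 -(fin (tau (rho y))) e2 orbC.
Qed.

Lemma walk_neq s t : iter s f q != tau (iter t f q).
Proof.
case: (leqP t s) => [ts|/ltnW st].
  by rewrite -(subnK ts) iterD walk_neq_tau.
rewrite -(subnK st) iterD; apply: contraNneq (walk_neq_tau (t - s) (iter s f q) mr).
by move=> e; rewrite {2}e tauK.
Qed.

Lemma orbit_tauN x : x \in fingraph.orbit f q -> tau x \notin fingraph.orbit f q.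
Proof.
move=> /trajectP[t _ ->]; apply/trajectP => -[s _ e].
by have := walk_neq s t; rewrite e eqxx.
Qed.

Lemma orbit_tau x : x \in A ->
  (tau x \in fingraph.orbit f q) = (x \notin fingraph.orbit f q).
Proof.
rewrite walk_component; case: (boolP (x \in _)) => [/orbit_tauN/negPf -> //|_ /=].
by [].
Qed.

Lemma orbit_rho x : x \in A ->
  (rho x \in fingraph.orbit f q) = (x \notin fingraph.orbit f q).
Proof.
move=> xA; rewrite -orbit_tau // -!fconnect_orbit.
have -> : rho x = f (tau x) by rewrite /walk tauK.
by rewrite -same_fconnect1_r //; apply: walk_inj.
Qed.

Definition arc a :=
  [set x | (x \in traject f q a) || (tau x \in traject f q a)].

Lemma arc_order : arc (fingraph.order f q) = A.
Proof. by apply/setP => x; rewrite inE walk_component. Qed.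

Lemma iter_walk_inj s t : s < fingraph.order f q -> t < fingraph.order f q ->
  iter s f q = iter t f q -> s = t.
Proof. by move=> sN tN e; rewrite -(findex_iter sN) e findex_iter. Qed.

Lemma arc_enum a : a <= fingraph.order f q ->
  perm_eq (enum (arc a)) (traject f q a ++ map tau (traject f q a)).
Proof.
move=> aN; apply: uniq_perm; first exact: enum_uniq.
  have u : uniq (traject f q a).
    by have := orbit_uniq f q; rewrite /fingraph.orbit -(subnKC aN) trajectD cat_uniq => /andP[].
  rewrite cat_uniq u map_inj_uniq ?u ?andbT; last exact: perm_inj.
  apply/hasPn => x /mapP[y /trajectP[t _ ->] ->].
  by apply/trajectP => -[s _ e]; have := walk_neq s t; rewrite e eqxx.
move=> x; rewrite mem_enum inE mem_cat; congr (_ || _).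
by rewrite -{2}[x]tauK mem_map //; apply: perm_inj.
Qed.

Lemma card_arc a : a <= fingraph.order f q -> #|arc a| = a.*2.
Proof.
move=> /arc_enum/perm_size; rewrite -cardE size_cat size_map size_traject => ->.
by rewrite addnn.
Qed.

Lemma card_component : #|A| = (fingraph.order f q).*2.
Proof. by rewrite -card_arc // arc_order. Qed.

Lemma sum_component (R : nmodType) (F : V -> R) :
  (\sum_(p in A) F p =
   \sum_(0 <= t < fingraph.order f q) (F (iter t f q) + F (tau (iter t f q))))%R.
Proof.
have -> : (\sum_(p in A) F p = \sum_(p <- enum (arc (fingraph.order f q))) F p)%R.
  by rewrite arc_order big_enum.
rewrite (perm_big _ (arc_enum (leqnn _))).
rewrite big_cat big_map /= big_split /=.
have E (G : V -> R) N : (\sum_(p <- traject f q N) G p = \sum_(0 <= t < N) G (iter t f q))%R.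
  elim: N => [|N IH]; first by rewrite big_nil big_geq.
  by rewrite trajectSr -cats1 big_cat big_seq1 big_nat_recr //= IH.
by rewrite !E.
Qed.

End Orbit.

Lemma bicolored_card (h : V -> V) Y (O : {set V}) : injective h ->
  (forall x, x \in Y -> h x \in Y) ->
  (forall x, x \in Y -> (h x \in O) = (x \notin O)) ->
  #|Y :&: O| = #|Y :\: O|.
Proof.
move=> hI hY hO; apply/eqP; rewrite eqn_leq; apply/andP; split.
  rewrite -(card_imset _ hI); apply/subset_leq_card/subsetP => z /imsetP[x].
  by rewrite !inE => /andP[xY xO] ->; rewrite hY // hO // xO.
rewrite -(card_imset _ hI); apply/subset_leq_card/subsetP => z /imsetP[x].
by rewrite !inE => /andP[xO xY] ->; rewrite hY // hO // xO.
Qed.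

(* A twist-stable set contains both endpoints or none: otherwise removing q and
   rho p, of the same colour, would leave a set balanced for rho, while Y itself
   is balanced for tau. *)
Lemma bicolored_twist rho p q Y (S O : {set V}) : matching rho -> Y \subset S ->
  (forall x, x \in S -> (rho x \in O) = (x \notin O)) ->
  (forall x, x \in S -> (tau x \in O) = (x \notin O)) ->
  stable (twist (tperm p q) rho) Y -> q \in Y -> p \in S -> q \in O -> p \notin O ->
  p \in Y.
Proof.
move=> mr /subsetP YS rO tO sY qY pS qO pO; apply: contraT => pY.
have [rK rn] := matchingP _ mr.
have := stable_rho q _ sY; rewrite matching_twist twistE tpermR qY => /(_ mr).
set r := rho p; have rp : r != p by rewrite rn.
have rq : r != q.
  apply/eqP => e; have := stable_rho q _ sY.
  by rewrite matching_twist twistE tpermR -/r e tpermR qY (negPf pY) => /(_ mr).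
rewrite tpermD 1?eq_sym // => rY.
have rinO : r \in O by rewrite rO.
have rZ x : x \in Y :\: [set q; r] -> rho x \in Y :\: [set q; r].
  rewrite !inE !negb_or => /andP[/andP[xq xr] xY].
  have xp : x != p by apply: contraNneq pY => <-.
  have := stable_rho x _ sY; rewrite matching_twist twistE xY => /(_ mr).
  rewrite (tpermD (z := x)) 1?eq_sym //.
  have rxp : rho x != p by apply: contraNneq xr => e; rewrite /r -e rK.
  case: (eqVneq (rho x) q) => [->|rxq]; first by rewrite tpermR (negPf pY).
  rewrite tpermD 1?eq_sym // => rxY.
  by rewrite /= rxY andbT (inj_eq (@perm_inj _ rho)) eq_sym.
have YZ : Y :\: [set q; r] \subset Y by apply: subsetDl.
have c1 := @bicolored_card rho _ O (@perm_inj _ rho) rZ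
  (fun x xZ => rO x (YS x (subsetP YZ x xZ))).
have c2 := @bicolored_card tau Y O (@perm_inj _ tau)
  (fun x xY => proj2 (stableP _ _ sY x xY)) (fun x xY => tO x (YS x xY)).
have e1 : (Y :\: [set q; r]) :\: O = Y :\: O.
  apply/setP => x; rewrite !inE; case: (boolP (x \in O)) => //= xO.
  by rewrite negb_or !(contraNneq _ xO) // => ->.
have e2 : Y :&: O = q |: (r |: ((Y :\: [set q; r]) :&: O)).
  apply/setP => x; rewrite !inE.
  case: eqVneq => [->|_] /=; first by rewrite qY.
  by case: eqVneq => [->|_] //=; rewrite rY.
have := c2; rewrite -e1 -c1 e2 !cardsU1 !inE !eqxx /= !(orbT, andbF, orbF) /=.
by rewrite eq_sym rq /= => /eqP; rewrite addnA -[X in _ == X]add0n eqn_add2r.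
Qed.

End Walks.

Section Surgery.
Variable n : nat.
Local Notation V := (bvert n).
Local Notation tau := (tau n).
Implicit Types (rho : {perm V}) (x y z p q : V) (A B Y : {set V}).
Implicit Types ls : seq {set V}.

Lemma lists_components_twist rho p q new old ls :
  matching rho -> lists_components rho (old ++ ls) ->
  p \in cover [set A in old] -> q \in cover [set A in old] ->
  uniq new -> {subset new <= components (twist (tperm p q) rho)} ->
  cover [set A in new] = cover [set A in old] ->
  lists_components (twist (tperm p q) rho) (new ++ ls).
Proof.
move=> mr /(lists_componentsP _ mr)[]; rewrite cat_uniq.
move=> /and3P[u1 /hasPn d u2] sub cov pold qold unew snew cnew.
have mr' : matching (twist (tperm p q) rho) by rewrite matching_twist.
have avoid z B : z \in cover [set A in old] -> B \in ls -> z \notin B.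
  move=> /bigcupP[A]; rewrite inE => Aold zA Bls; apply/negP => zB.
  have e : A = B.
    by apply: (component_disjoint mr (x := z)); rewrite ?sub // mem_cat ?Aold ?Bls ?orbT.
  by have := d _ Bls; rewrite /= -e Aold.
apply/(lists_componentsP _ mr'); split.
- rewrite cat_uniq unew u2 andbT /=; apply/hasPn => B Bls; apply/negP => Bnew.
  have /(componentsP _ mr')[/set0Pn[z zB] _ _] := snew _ Bnew.
  have zold : z \in cover [set A in old].
    by rewrite -cnew; apply/bigcupP; exists B; rewrite ?inE.
  by have := avoid z _ zold Bls; rewrite zB.
- move=> B; rewrite mem_cat => /orP[/snew //|Bls].
  by apply: component_twist; rewrite ?avoid // sub // mem_cat Bls orbT.
move=> x; have [B] := cov x; rewrite mem_cat => /orP[Bold xB|Bls xB]; last first.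
  by exists B => //; rewrite mem_cat Bls orbT.
have : x \in cover [set A in new].
  by rewrite cnew; apply/bigcupP; exists B; rewrite ?inE.
by move=> /bigcupP[C]; rewrite inE => Cnew xC; exists C => //; rewrite mem_cat Cnew.
Qed.

Section Surgeries.
Variables (rho : {perm V}) (A : {set V}) (q : V).
Hypotheses (mr : matching rho) (cA : A \in components rho) (qA : q \in A).
Local Notation f := (walk rho).
Local Notation O := [set x | x \in fingraph.orbit f q].

(* A set stable under the twisted matching that contains both endpoints or none
   of them is stable under rho, so minimality is inherited. *)
Lemma twist_component p : p \in A -> p \notin O ->
  A \in components (twist (tperm p q) rho).
Proof.
move=> pA pO; have [A0 sA mA] := componentsP _ mr cA.
have mr' : matching (twist (tperm p q) rho) by rewrite matching_twist.
apply/(componentsP _ mr'); split=> //; first by rewrite stable_twist // pA qA.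
move=> Y YA sY Y0; apply: mA => //; rewrite -(@stable_twist _ p q) //.
have rO x : x \in A -> (rho x \in O) = (x \notin O).
  by move=> xA; rewrite !inE (orbit_rho mr cA).
have tO x : x \in A -> (tau x \in O) = (x \notin O).
  by move=> xA; rewrite !inE (orbit_tau mr cA).
apply/idP/idP => [pY|qY].
  apply: (@bicolored_twist _ rho q p Y A (~: O)) => //.
  - by move=> x xA; rewrite !in_setC rO.
  - by move=> x xA; rewrite !in_setC tO.
  - by rewrite tpermC.
  - by rewrite in_setC.
  - by rewrite in_setC inE in_orbit.
by apply: (@bicolored_twist _ rho p q Y A O); rewrite // inE in_orbit.
Qed.

Lemma merge_component B p : B \in components rho -> p \in B -> A != B ->
  A :|: B \in components (twist (tperm p q) rho).
Proof.
move=> cB pB AB; have [A0 sA mA] := componentsP _ mr cA.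
have [B0 sB mB] := componentsP _ mr cB.
have mr' : matching (twist (tperm p q) rho) by rewrite matching_twist.
have sAB : stable rho (A :|: B) by apply: stableU.
have disj x : x \in A -> x \notin B.
  by move=> xA; apply: contraNN AB => xB; rewrite (component_disjoint mr cA cB xA xB).
apply/(componentsP _ mr'); split.
- by apply/set0Pn; exists q; rewrite inE qA.
- by rewrite stable_twist // !inE pB qA orbT.
move=> Y YAB sY Y0.
set P := [set x | x \in fingraph.orbit f p].
set Q := (O :&: A) :|: (~: P :&: B).
have rQ x : x \in A :|: B -> (rho x \in Q) = (x \notin Q).
  rewrite inE => /orP[xA|xB].
    have rxA : rho x \in A by rewrite (stable_rho _ mr).
    rewrite !inE rxA xA (negPf (disj _ xA)) (negPf (disj _ rxA)).
    by rewrite !andbT !andbF !orbF (orbit_rho mr cA).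
  have rxB : rho x \in B by rewrite (stable_rho _ mr).
  have nA y : y \in B -> y \notin A by move=> yB; apply: contraTN yB => /disj.
  rewrite !inE rxB xB (negPf (nA _ xB)) (negPf (nA _ rxB)).
  by rewrite !andbT !andbF /= (orbit_rho mr cB).
have tQ x : x \in A :|: B -> (tau x \in Q) = (x \notin Q).
  rewrite inE => /orP[xA|xB].
    have rxA : tau x \in A by rewrite (stable_tau _ sA).
    rewrite !inE rxA xA (negPf (disj _ xA)) (negPf (disj _ rxA)).
    by rewrite !andbT !andbF !orbF (orbit_tau mr cA).
  have rxB : tau x \in B by rewrite (stable_tau _ sB).
  have nA y : y \in B -> y \notin A by move=> yB; apply: contraTN yB => /disj.
  rewrite !inE rxB xB (negPf (nA _ xB)) (negPf (nA _ rxB)).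
  by rewrite !andbT !andbF /= (orbit_tau mr cB).
have qQ : q \in Q by rewrite !inE in_orbit qA.
have pQ : p \notin Q.
  rewrite !inE in_orbit /= orbF negb_and; apply/orP; right.
  by apply: contraTN pB => /disj.
have pqY : (p \in Y) = (q \in Y).
  apply/idP/idP => [pY|qY].
    apply: (@bicolored_twist _ rho q p Y (A :|: B) (~: Q)) => //.
    - by move=> x xA; rewrite !in_setC rQ.
    - by move=> x xA; rewrite !in_setC tQ.
    - by rewrite tpermC.
    - by rewrite inE qA.
    - by rewrite in_setC.
    - by rewrite in_setC qQ.
  by apply: (@bicolored_twist _ rho p q Y (A :|: B) Q) => //; rewrite inE pB orbT.
have sY' : stable rho Y by rewrite -(@stable_twist _ p q).
have part C : C \in components rho -> Y :&: C != set0 -> C \subset Y.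
  move=> /(componentsP _ mr)[_ sC mC] YC0.
  by rewrite -(mC (Y :&: C)) ?subsetIr ?subsetIl ?stableI.
have AY : (q \in Y) -> Y = A :|: B.
  move=> qY; apply/eqP; rewrite eqEsubset YAB subUset /=.
  apply/andP; split; apply: part => //; apply/set0Pn.
    by exists q; rewrite inE qY.
  by exists p; rewrite inE pqY qY.
apply: AY; have /set0Pn[y yY] := Y0.
have := subsetP YAB _ yY; rewrite inE => /orP[yA|yB].
  by apply: (subsetP (part A cA _)) => //; apply/set0Pn; exists y; rewrite inE yY.
rewrite -pqY.
by apply: (subsetP (part B cB _)) => //; apply/set0Pn; exists y; rewrite inE yY.
Qed.

Section Cut.
Variable a : nat.
Hypothesis a_bounds : 0 < a < fingraph.order f q.
Local Notation p := (iter a f q).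
Local Notation C := (arc rho q a).

Lemma mem_arcq : q \in C.
Proof.
by case: a a_bounds => // a' _; rewrite inE mem_head.
Qed.

Lemma memN_arc : p \notin C.
Proof.
have [a0 aN] := andP a_bounds.
rewrite inE negb_or; apply/andP; split; apply/trajectP => -[t ta].
  by move=> e; have := iter_walk_inj aN (ltn_trans ta aN) e; lia.
move=> e; have := walk_neq q mr t a.
by rewrite -e eqxx.
Qed.

Lemma iter_component t : iter t f q \in A.
Proof.
have [A0 sA mA] := componentsP _ mr cA.
by elim: t => // t IH; rewrite iterS stable_rho // (stable_tau _ sA).
Qed.

Lemma arc_sub : C \subset A.
Proof.
have [A0 sA mA] := componentsP _ mr cA.
apply/subsetP => x; rewrite inE => /orP[] /trajectP[t _ e].
  by rewrite e iter_component.
by rewrite -(stable_tau _ sA) e iter_component.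
Qed.

Lemma stable_arc : stable (twist (tperm p q) rho) C.
Proof.
have [a0 aN] := andP a_bounds.
have arcW t : t < a -> iter t f q \in C.
  by move=> ta; rewrite inE; apply/orP; left; apply/trajectP; exists t.
have arcT x : (tau x \in C) = (x \in C) by rewrite !inE tauK orbC.
have fixT t : tperm p q (tau (iter t f q)) = tau (iter t f q).
  by rewrite tpermD // ?walk_neq // (walk_neq q mr 0).
have fixW t : 0 < t < a -> tperm p q (iter t f q) = iter t f q.
  move=> /andP[t0 ta]; rewrite tpermD //; apply/eqP => e.
    by have := iter_walk_inj aN (ltn_trans ta aN) e; lia.
  by have := @iter_walk_inj _ rho q 0 t (ltn_trans a0 aN) (ltn_trans ta aN) e; lia.
have rho_p : rho p = tau (iter a.-1 f q).
  by rewrite -[in LHS](prednK a0) rho_iter_walk.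
apply/stableP => x xC; split; last by rewrite arcT.
rewrite twistE; move: xC; rewrite inE => /orP[/trajectP[t ta ->]|/trajectP[t ta e]].
  case: t ta => [|t] ta /=.
    by rewrite tpermR rho_p fixT arcT arcW //; lia.
  by rewrite -iterS fixW // rho_iter_walk // fixT arcT arcW //; lia.
rewrite -[x]tauK e fixT -/(f _) -iterS.
move: ta; rewrite leq_eqVlt => /orP[/eqP ->|ta]; first by rewrite tpermL mem_arcq.
by rewrite fixW // arcW.
Qed.

Lemma cut_components :
  C \in components (twist (tperm p q) rho) /\
  A :\: C \in components (twist (tperm p q) rho).
Proof.
have [A0 sA mA] := componentsP _ mr cA.
have mr' : matching (twist (tperm p q) rho) by rewrite matching_twist.
have pA := iter_component a.
have sA' : stable (twist (tperm p q) rho) A by rewrite stable_twist // pA qA.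
have sC := stable_arc; have CA := arc_sub; have qC := mem_arcq.
have pC := memN_arc.
have avoid (Z : {set V}) : Z \subset A -> p \notin Z -> q \notin Z ->
   stable (twist (tperm p q) rho) Z -> Z = set0.
  by move=> ZA pZ qZ; apply: (stable_avoid mr cA).
split; apply/(componentsP _ mr'); split=> //.
- by apply/set0Pn; exists q.
- move=> Y YC sY Y0.
  have pY : p \notin Y by apply: contraNN pC; apply: (subsetP YC).
  have qY : q \in Y.
    by apply: contraNT Y0 => qY; rewrite (avoid Y) // (subset_trans YC).
  apply/eqP; rewrite eqEsubset YC /= -setD_eq0; apply/eqP/avoid.
  + exact: subset_trans (subsetDl _ _) CA.
  + by rewrite inE (negPf pC) andbF.
  + by rewrite inE qY.
  + exact: stableD.
- by apply/set0Pn; exists p; rewrite inE pC.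
- exact: stableD.
move=> Y YD sY Y0.
have qY : q \notin Y by apply/negP => /(subsetP YD); rewrite inE qC.
have pY : p \in Y.
  apply: contraNT Y0 => pY; rewrite (avoid Y) //.
  exact: subset_trans YD (subsetDl _ _).
apply/eqP; rewrite eqEsubset YD /= -setD_eq0; apply/eqP/avoid.
- by rewrite setDDl subsetDl.
- by rewrite inE pY.
- by rewrite !in_setD qC /= andbF.
- by apply: stableD => //; apply: stableD.
Qed.

End Cut.
End Surgeries.

Lemma lists_merge rho A B ls p q : matching rho ->
  lists_components rho [:: A, B & ls] -> q \in A -> p \in B ->
  lists_components (twist (tperm p q) rho) (A :|: B :: ls).
Proof.
move=> mr lc qA pB; have [u sub cov] := (lists_componentsP _ mr).1 lc.
have cAB : cover [set C in [:: A; B]] = A :|: B.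
  by rewrite /cover (_ : [set C in [:: A; B]] = [set A; B]) ?bigcup_setU ?big_set1 //;
    apply/setP => C; rewrite !inE.
apply: (lists_components_twist (new := [:: A :|: B]) mr (old := [:: A; B])) => //.
- by rewrite cAB inE pB orbT.
- by rewrite cAB inE qA.
- move=> C; rewrite inE => /eqP ->; apply: merge_component => //.
  + by rewrite sub ?mem_head.
  + by rewrite sub // !inE eqxx orbT.
  by move: u; rewrite /= !inE negb_or -andbA => /andP[].
rewrite cAB /cover (_ : [set C in [:: A :|: B]] = [set A :|: B]) ?big_set1 //.
by apply/setP => C; rewrite !inE.
Qed.

Lemma lists_twist rho A ls p q : matching rho ->
  lists_components rho (A :: ls) -> q \in A -> p \in A ->
  p \notin fingraph.orbit (walk rho) q ->
  lists_components (twist (tperm p q) rho) (A :: ls).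
Proof.
move=> mr lc qA pA pO; have [u sub cov] := (lists_componentsP _ mr).1 lc.
have cAB : cover [set C in [:: A]] = A.
  rewrite /cover (_ : [set C in [:: A]] = [set A]) ?big_set1 //.
  by apply/setP => C; rewrite !inE.
apply: (lists_components_twist (new := [:: A]) mr (old := [:: A])); rewrite ?cAB //.
move=> C; rewrite inE => /eqP ->; apply: twist_component => //; last by rewrite inE.
by rewrite sub ?mem_head.
Qed.

Lemma lists_cut rho A ls q a : matching rho ->
  lists_components rho (A :: ls) -> q \in A ->
  0 < a < fingraph.order (walk rho) q ->
  lists_components (twist (tperm (iter a (walk rho) q) q) rho)
    [:: arc rho q a, A :\: arc rho q a & ls].
Proof.
move=> mr lc qA ab; have [u sub cov] := (lists_componentsP _ mr).1 lc.
have cA : A \in components rho by rewrite sub ?mem_head.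
have cAB : cover [set C in [:: A]] = A.
  rewrite /cover (_ : [set C in [:: A]] = [set A]) ?big_set1 //.
  by apply/setP => C; rewrite !inE.
have [c1 c2] := cut_components mr cA qA ab.
apply: (lists_components_twist (new := [:: arc rho q a; A :\: arc rho q a]) mr
  (old := [:: A])); rewrite ?cAB // ?iter_component //.
- rewrite /= andbT inE; apply/eqP => /setP/(_ q).
  by rewrite in_setD (mem_arcq ab).
- by move=> C; rewrite !inE => /orP[]/eqP ->.
rewrite /cover (_ : [set C in _] = [set arc rho q a; A :\: arc rho q a]).
  rewrite bigcup_setU !big_set1 -{1}(setIidPr (arc_sub mr cA qA a)).
  by rewrite setID.
by apply/setP => C; rewrite !inE.
Qed.

End Surgery.

(** * Weighted counts of monotone sequences *)

Section Colouring.
Local Open Scope ring_scope.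
Variables (T K : eqType).
Implicit Types (c : T -> K) (b : seq T) (L : seq (seq T)).

Definition colours_blocks c L :=
  all (fun b => constant (map c b)) L &&
  uniq [seq ohead (map c b) | b <- L].

Lemma colours_blocks_cons c x b L :
  colours_blocks c ((x :: b) :: L) =
  [&& all (fun y => c y == c x) b,
      Some (c x) \notin [seq ohead (map c b) | b <- L] & colours_blocks c L].
Proof.
rewrite /colours_blocks /= all_map -!andbA; congr (_ && _).
by rewrite andbCA.
Qed.

Lemma eq_colours_blocks c c' L :
  {in flatten L, c =1 c'} -> colours_blocks c L = colours_blocks c' L.
Proof.
move=> cc; have e b : b \in L -> map c b = map c' b.
  move=> bL; apply/eq_in_map => x xb; apply: cc; apply/flattenP; by exists b.
rewrite /colours_blocks; congr (_ && _).
  by apply: eq_in_all => b bL; rewrite e.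
by congr uniq; apply/eq_in_map => b bL; rewrite e.
Qed.

Lemma colours_blocks_perm c L L' :
  perm_eq L L' -> colours_blocks c L = colours_blocks c L'.
Proof.
move=> pL; rewrite /colours_blocks (perm_all _ pL); congr (_ && _).
exact: (perm_uniq (perm_map _ pL)).
Qed.

Lemma colours_blocks_perm1 c b b' L :
  perm_eq b b' -> colours_blocks c (b :: L) = colours_blocks c (b' :: L).
Proof.
move=> pb; elim/perm_eq_ind: pb => // [x m m' pm _|x y m|b1 b2 b3 -> //].
  by rewrite !colours_blocks_cons (perm_all _ pm).
rewrite !colours_blocks_cons /=; by case: (eqVneq (c x) (c y)) => [->|nxy].
Qed.

Lemma colours_blocks_same c L b x y :
  colours_blocks c L -> b \in L -> x \in b -> y \in b -> c x = c y.
Proof.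
move=> /andP[/allP /(_ b) H _] /H; case: b {H} => // z b /= /allP ab.
have e t : t \in z :: b -> c t = c z.
  by rewrite inE => /orP[/eqP -> //|/(map_f c)/ab/eqP].
by move=> /e -> /e ->.
Qed.

Lemma colours_blocks_diff c L b b' x y :
  colours_blocks c L -> b \in L -> b' \in L -> x \in b -> y \in b' ->
  c x = c y -> b = b'.
Proof.
move=> cL bL bL' xb yb cxy.
have H d z : d \in L -> z \in d -> ohead (map c d) = Some (c z).
  case: d => // t d dL zd /=; congr Some.
  by apply: (colours_blocks_same cL dL) => //; apply: mem_head.
have := H _ _ bL xb; rewrite cxy -(H _ _ bL' yb).
have /andP[_ u] := cL.
have mapinj (f : seq T -> option K) (s : seq (seq T)) : uniq (map f s) ->
    {in s &, injective f}.
  elim: s => // z s IH /= /andP[zs us] p q; rewrite !inE.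
  move=> /orP[/eqP ->|ps] /orP[/eqP ->|qs] // e.
  - by case/negP: zs; rewrite e map_f.
  - by case/negP: zs; rewrite -e map_f.
  - exact: IH.
exact: (mapinj (fun d => ohead (map c d)) L u b b' bL bL').
Qed.

Lemma sum_splits_all (R : comNzRingType) (a b : pred T) m :
  (forall z, ~~ (a z && b z)) ->
  \sum_(s <- splits m) (all a s.1 && all b s.2)%:R = (all (predU a b) m)%:R :> R.
Proof.
move=> ab; elim: m => [|x m IH]; first by rewrite splits_nil.
rewrite splits_cons /=.
under eq_bigr => s _ do rewrite -andbA -mulnb natrM.
under [X in _ + X]eq_bigr => s _ do rewrite andbCA -mulnb natrM.
rewrite -!mulr_sumr IH -mulrDl -natrD -natrM; congr (_%:R).
by move: (ab x); case: (a x); case: (b x) => //=; rewrite ?mul1n ?mul0n.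
Qed.

(* Merging the colours of x and y: either they agreed already, or the block was
   the union of two blocks, one for each of the two colours. *)
Lemma colours_blocks_merge (R : comNzRingType) c x y m L :
  let mg z := if z == c x then c y else z in
  (colours_blocks (mg \o c) ([:: x, y & m] :: L))%:R =
  (colours_blocks c ([:: x, y & m] :: L))%:R +
  \sum_(s <- splits m) (colours_blocks c [:: x :: s.1, y :: s.2 & L])%:R :> R.
Proof.
move=> mg.
have heads : [seq ohead (map (mg \o c) b) | b <- L] =
   [seq omap mg (ohead (map c b)) | b <- L].
  by apply: eq_map => -[|z b].
case: (eqVneq (c x) (c y)) => [exy|nxy].
  have mgE z : mg z = z by rewrite /mg exy; case: eqP => // ->.
  rewrite big1 ?addr0 => [|s _].
    by congr (nat_of_bool _)%:R; apply: eq_colours_blocks => z _; rewrite /= mgE.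
  by rewrite !colours_blocks_cons /= exy inE eqxx /= andbF.
have mgx : mg (c x) = c y by rewrite /mg eqxx.
have mgy : mg (c y) = c y by rewrite /mg; case: eqP.
rewrite !colours_blocks_cons /= [X in _ = (nat_of_bool (X && _ && _))%:R + _]eq_sym.
rewrite (negPf nxy) /= add0r mgx mgy eqxx /= heads.
under eq_bigr => s _ do rewrite !colours_blocks_cons /= inE negb_or.
set hs := [seq ohead _ | b <- L].
have hm : (Some (c y) \notin [seq omap mg (ohead [seq c i | i <- b]) | b <- L]) =
    (Some (c x) \notin hs) && (Some (c y) \notin hs).
  rewrite -negb_or; congr (~~ _); rewrite /hs.
  elim: (L) => //= b L' IH; rewrite !inE IH.
  rewrite orbACA; congr (_ || _); case: b => [|z b] //=.
  rewrite !(inj_eq (@Some_inj _)) /mg (eq_sym (c x)).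
  by case: (eqVneq (c z) (c x)) => _ //=; rewrite eqxx.
rewrite hm.
case: (boolP (Some (c x) \in hs)) => [xh|xh] /=.
  by rewrite andbF big1 // => s _; rewrite andbF /= !andbF.
case: (boolP (Some (c y) \in hs)) => [yh|yh] /=.
  by rewrite andbF big1 // => s _; rewrite !andbF.
have hz z b : z :: b \in L -> (c z != c x) && (c z != c y).
  move=> zL; apply/andP; split; [move: xh|move: yh]; apply: contraNneq => <-;
    by apply/mapP; exists (z :: b).
have -> : colours_blocks (mg \o c) L = colours_blocks c L.
  rewrite /colours_blocks heads; congr (_ && _).
    apply: eq_in_all => -[|z b] // /hz /andP[zx zy] /=; rewrite !all_map.
    apply: eq_all => t /=; rewrite {2}/mg (negPf zx) /mg.
    by case: (eqVneq (c t) (c x)) => // ->; rewrite ![_ == c z]eq_sym (negPf zx) (negPf zy).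
  congr uniq; apply/eq_in_map => -[|z b] // /hz /andP[zx _] /=.
  by rewrite /mg (negPf zx).
have -> : all (fun z => mg (c z) == c y) m =
    all (predU (fun z => c z == c x) (fun z => c z == c y)) m.
  apply: eq_all => z /=; rewrite /mg.
  by case: (eqVneq (c z) (c x)) => _ //=; rewrite eqxx.
rewrite -mulnb natrM -sum_splits_all => [|z]; last first.
  by apply/negP => /andP[/eqP -> e]; rewrite e in nxy.
rewrite mulr_suml; apply: eq_bigr => s _.
rewrite -natrM mulnb; congr (nat_of_bool _)%:R.
by rewrite (inj_eq (@Some_inj _)) nxy /= -!andbA.
Qed.

End Colouring.

Section Sequences.
Local Open Scope ring_scope.
Variable n : nat.
Local Notation V := (bvert n).
Local Notation tau := (tau n).
Local Notation X := (V * 'I_n)%type.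
Implicit Types (rho : {perm V}) (x y z p q : V) (A B : {set V}).
Implicit Types (ls : seq {set V}) (L : seq (seq {set V})).
Implicit Types (s : seq X).

Definition resulting s : {perm V} :=
  foldl (fun rho e => twist (transp e) rho) tau s.

Lemma resulting_rcons s e : resulting (rcons s e) = twist (transp e) (resulting s).
Proof. by rewrite /resulting foldl_rcons. Qed.

Lemma matching_resulting s : matching (resulting s).
Proof.
elim/last_ind: s => [|s e IH]; first exact: matching_tau.
by rewrite resulting_rcons matching_twist.
Qed.

Fixpoint weight_from rho s : coefField :=
  if s is e :: s' then
    weight rho (transp e) * weight_from (twist (transp e) rho) s'
  else 1.

Lemma weight_from_rcons s e : weight_from tau (rcons s e) =
  weight_from tau s * weight (resulting s) (transp e).
Proof.
rewrite /resulting; elim: s (Defs.tau n) => [|e' s IH] rho /=.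
  by rewrite mulr1 mul1r.
by rewrite IH mulrA.
Qed.

Lemma seq_weightE k (s : k.-tuple X) : seq_weight s = weight_from tau s.
Proof.
rewrite /seq_weight /partial_inv.
elim: k s (Defs.tau n) => [|k IH] s rho; first by rewrite big_ord0 tuple0.
rewrite (tuple_eta s) big_ord_recl /= tnth0; congr (_ * _).
rewrite -(IH (behead_tuple s)); apply: eq_bigr => i _.
by rewrite tnthS.
Qed.

Definition ordered s :=
  all (fun e => (e.1 < unbar e.2)%O) s && sorted leq [seq nat_of_ord e.2 | e <- s].

Definition merge_colours (c : V -> 'I_n) (e : X) : V -> 'I_n :=
  fun y => if c y == c (unbar e.2) then c e.1 else c y.

(* Two vertices have the same colour iff they lie in the same orbit of the group
   generated by tau and the transpositions of the sequence. *)
Definition seq_colour s : V -> 'I_n := foldl merge_colours (fun y => y.1) s.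

Lemma seq_colour_rcons s e :
  seq_colour (rcons s e) = merge_colours (seq_colour s) e.
Proof. by rewrite /seq_colour foldl_rcons. Qed.

Lemma seq_colour_sub s e x y :
  seq_colour s x = seq_colour s y -> seq_colour (rcons s e) x = seq_colour (rcons s e) y.
Proof. by rewrite seq_colour_rcons /merge_colours => ->. Qed.

Lemma seq_colour_mem s e : e \in s -> seq_colour s e.1 = seq_colour s (unbar e.2).
Proof.
elim/last_ind: s => // s e' IH; rewrite mem_rcons inE => /orP[/eqP ->|/IH].
  by rewrite seq_colour_rcons /merge_colours eqxx; case: eqP.
exact: seq_colour_sub.
Qed.

Lemma seq_colour_tau s x : seq_colour s (tau x) = seq_colour s x.
Proof.
elim/last_ind: s => [|s e IH]; first by rewrite /seq_colour /= tau_fst.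
exact: seq_colour_sub.
Qed.

Lemma seq_colour_resulting s x : seq_colour s (resulting s x) = seq_colour s x.
Proof.
elim/last_ind: s x => [|s e IH] x; first by rewrite /seq_colour /= tau_fst.
rewrite resulting_rcons /transp twistE.
have E y : seq_colour (rcons s e) (tperm e.1 (unbar e.2) y) = seq_colour (rcons s e) y.
  by case: tpermP => // ->; rewrite ?(@seq_colour_mem _ e) // mem_rcons mem_head.
by rewrite E (seq_colour_sub _ (IH _)) E.
Qed.

Lemma seq_colour_untouched s i y :
  all (fun e => (e.1.1 != i) && (e.2 != i)) s ->
  (seq_colour s y == i) = (y.1 == i).
Proof.
elim/last_ind: s y => // s e IH y; rewrite all_rcons => /andP[/andP[e1 e2] H].
rewrite seq_colour_rcons /merge_colours.
case: (eqVneq (seq_colour s y)) => [ey|_]; last exact: IH.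
rewrite (IH _ H) (negPf e1) -(IH _ H) ey (IH _ H).
by rewrite (negPf e2).
Qed.

Definition set_colour (c : V -> 'I_n) A : option 'I_n :=
  omap c [pick x in A].

Lemma set_colourE s A x :
  A \in components (resulting s) -> x \in A ->
  set_colour (seq_colour s) A = Some (seq_colour s x).
Proof.
move=> /(componentsP _ (matching_resulting s))[_ sA mA] xA.
rewrite /set_colour; case: pickP => [y yA /=|/(_ x)]; last by rewrite xA.
have e : [set z in A | seq_colour s z == seq_colour s x] = A.
  apply: mA; first by apply/subsetP => z; rewrite inE => /andP[].
    apply/stableP => z; rewrite !inE => /andP[zA zx].
    by rewrite seq_colour_resulting seq_colour_tau !zx; have [-> ->] := stableP _ _ sA z zA.
  by apply/set0Pn; exists x; rewrite inE xA eqxx.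
by congr Some; move: yA; rewrite /= -e inE => /andP[_ /eqP].
Qed.

Definition compatible s L := colours_blocks (set_colour (seq_colour s)) L.

(* L groups the components of rho into the orbits of the group generated by tau and
   the transpositions of the sequence. *)
Definition hcount k rho L : coefField :=
  \sum_(s : k.-tuple X) [&& ordered s, resulting s == rho & compatible s L]%:R
     * weight_from tau s.

Lemma sum_tuple_rcons (R : nmodType) (T : finType) k (F : seq T -> R) :
  \sum_(t : k.+1.-tuple T) F t = \sum_(t : k.-tuple T) \sum_(e : T) F (rcons t e).
Proof.
rewrite pair_big /=.
rewrite (reindex (fun p : k.-tuple T * T => [tuple of rcons p.1 p.2])) //=.
apply/onW_bij/inj_card_bij => [[t e] [t' e'] /(congr1 val)/= /rcons_inj[tt ->]|].
  by congr (_, _); apply: val_inj.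
by rewrite card_prod !card_tuple expnSr.
Qed.

Lemma hcount_perm k rho L L' : perm_eq L L' -> hcount k rho L = hcount k rho L'.
Proof.
by move=> pL; apply: eq_bigr => s _; rewrite /compatible (colours_blocks_perm _ pL).
Qed.

Lemma hcount_perm1 k rho b b' L :
  perm_eq b b' -> hcount k rho (b :: L) = hcount k rho (b' :: L).
Proof.
by move=> pb; apply: eq_bigr => s _; rewrite /compatible (colours_blocks_perm1 _ _ pb).
Qed.

End Sequences.

Section Steps.
Local Open Scope ring_scope.
Variable n : nat.
Local Notation V := (bvert n).
Local Notation tau := (tau n).
Local Notation X := (V * 'I_n)%type.
Implicit Types (rho : {perm V}) (x y z p q : V) (A B : {set V}).
Implicit Types (ls : seq {set V}) (L : seq (seq {set V})).
Implicit Types (s : seq X).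

Lemma lt_unbar p (i : 'I_n) : (p < unbar i)%O = (p.1 < i)%N.
Proof.
rewrite ltEprodlexi /= leEord ltEbool /=.
by rewrite ltn0 implybF -ltnNge; case: ltngtP.
Qed.

Lemma size_inv_type rho ls : lists_components rho ls -> size (inv_type rho) = size ls.
Proof.
by move=> lc; rewrite /inv_type size_sort size_map -cardE (perm_size lc) -cardE.
Qed.

Lemma weight_lists rho sigma ls ls' :
  lists_components rho ls -> lists_components (twist sigma rho) ls' ->
  weight rho sigma =
    if size ls' == (size ls).+1 then Cvar
    else if (size ls').+1 == size ls then Jvar
    else if inv_type (twist sigma rho) == inv_type rho then Tvar else 0.
Proof. by move=> l l'; rewrite -(size_inv_type l) -(size_inv_type l'). Qed.

Lemma weight_same rho sigma ls :
  lists_components rho ls -> lists_components (twist sigma rho) ls ->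
  weight rho sigma = Tvar.
Proof.
move=> l l'; rewrite (weight_lists l l').
have -> : inv_type (twist sigma rho) = inv_type rho.
  rewrite /inv_type; have -> // : components (twist sigma rho) = components rho.
  by apply/setP => A; rewrite -mem_enum -(perm_mem l') (perm_mem l) mem_enum.
by rewrite eqxx; case: ifP => [/eqP|_]; [lia|case: ifP => [/eqP|//]; lia].
Qed.

Definition half_pred A := (#|A|./2).-1.

Lemma half_predE rho A q : matching rho -> A \in components rho -> q \in A ->
  fingraph.order (walk rho) q = (half_pred A).+1.
Proof.
by move=> mr cA qA; rewrite /half_pred (card_component mr cA qA) doubleK prednK.
Qed.

Lemma card_half_pred rho A : matching rho -> A \in components rho ->
  #|A| = (half_pred A).+1.*2.
Proof.
move=> mr cA; have /(componentsP _ mr)[/set0Pn[q qA] _ _] := cA.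
by rewrite -(half_predE mr cA qA) (card_component mr cA qA).
Qed.

Lemma half_pred0 rho A x y : matching rho -> A \in components rho ->
  half_pred A = 0%N -> x \in A -> y \in A -> y.1 = x.1.
Proof.
move=> mr cA A0 xA; rewrite (walk_component mr cA xA) /fingraph.orbit.
rewrite (half_predE mr cA xA) A0 /= !inE.
by move=> /orP[/eqP -> //|/eqP <-]; rewrite tau_fst.
Qed.

Lemma hcount0 rho L : matching rho -> lists_components rho (flatten L) ->
  all (fun b => b != [::]) L ->
  hcount 0 rho L = (all (pred1 [:: 0%N]) (map (map half_pred) L))%:R.
Proof.
move=> mr lc nn; have [u sub cov] := (lists_componentsP _ mr).1 lc.
rewrite /hcount (big_pred1 [tuple]) => [|t]; last by rewrite [t]tuple0 /= eqxx.
rewrite /= mulr1 all_map; congr (nat_of_bool _)%:R.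
rewrite /resulting /=; apply/andP/allP => [[/eqP etau comp] b bL|H].
  have inL B : B \in b -> B \in flatten L by move=> Bb; apply/flattenP; exists b.
  have c1 B x : B \in b -> x \in B -> set_colour (@seq_colour n [::]) B = Some x.1.
    by move=> Bb xB; rewrite (set_colourE (s := [::]) _ xB) // /resulting /= etau sub // inL.
  have := allP nn b bL; case: b bL inL c1 => // A b bL inL c1 _.
  have cA : A \in components rho by rewrite sub // inL ?mem_head.
  have /(componentsP _ mr)[/set0Pn[x xA] sA mA] := cA.
  have A0 : half_pred A = 0%N.
    have eA : [set x; tau x] = A.
      apply: mA; last by apply/set0Pn; exists x; rewrite !inE eqxx.
        by apply/subsetP => y; rewrite !inE => /orP[]/eqP -> //; rewrite (stable_tau _ sA).
      by apply/stableP => y; rewrite -etau !inE => /orP[]/eqP ->; rewrite ?tauK eqxx ?orbT.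
    by rewrite /half_pred -eA cards2 eq_sym tau_neq.
  rewrite /= A0; case: b bL inL c1 => // B b bL inL c1.
  have cB : B \in components rho by rewrite sub // inL ?inE ?eqxx ?orbT.
  have /(componentsP _ mr)[/set0Pn[y yB] sB mB] := cB.
  have : set_colour (@seq_colour n [::]) A = set_colour (@seq_colour n [::]) B.
    by apply: (colours_blocks_same comp bL); rewrite !inE eqxx ?orbT.
  rewrite (c1 A x) ?mem_head // (c1 B y) ?inE ?eqxx ?orbT // => -[exy].
  have yA : y \in A by case: (fst_tau exy) => ->; rewrite ?(stable_tau _ sA).
  have eAB := component_disjoint mr cA cB yA yB.
  have [b1 [b2 eL]] : exists b1 b2, L = b1 ++ [:: A, B & b] :: b2.
    by have [p1 p2] := splitPr bL; exists p1, p2.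
  by move: u; rewrite eL flatten_cat cat_uniq /= eAB mem_head !andbF.
have single b : b \in L -> exists2 A, b = [:: A] & A \in components rho /\ half_pred A = 0%N.
  move=> bL; have := H b bL; have inL : {subset b <= flatten L}.
    by move=> B Bb; apply/flattenP; exists b.
  case: b bL inL => // A [|? ?] // bL inL /eqP [A0]; exists A => //; split=> //.
  by apply/sub/inL/mem_head.
have fstc A x y : A \in flatten L -> x \in A -> y \in A -> y.1 = x.1.
  move=> /flattenP[b /single[A' -> [cA' A0]]]; rewrite inE => /eqP ->.
  exact: (half_pred0 mr).
have etau : tau = rho.
  have [rK rn] := matchingP _ mr.
  apply/permP => x; have [A AL xA] := cov x.
  have /(componentsP _ mr)[_ sA _] := sub _ AL.
  have := fstc A x (rho x) AL xA; rewrite (stable_rho _ mr) // => /(_ xA)/esym e.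
  by case: (fst_tau e) => // ex; have := rn x; rewrite {1}ex eqxx.
split; first by rewrite etau.
have c1 B x : B \in flatten L -> x \in B -> set_colour (@seq_colour n [::]) B = Some x.1.
  by move=> Bb xB; rewrite (set_colourE (s := [::]) _ xB) // /resulting /= etau sub.
rewrite /compatible /colours_blocks; apply/andP; split.
  by apply/allP => b /single[A ->].
elim: (L) u single c1 sub {H fstc cov lc nn} => //= b L' IH u single c1 sub.
have [|A eb [cA A0]] := single b; first exact: mem_head.
move: u sub c1; rewrite eb /= => /andP[AL' uL'] sub c1.
rewrite IH ?andbT //; first last.
- by move=> B BL; apply: sub; rewrite inE BL orbT.
- by move=> B x BL; apply: c1; rewrite inE BL orbT.
- by move=> b' b'L; apply: single; rewrite inE b'L orbT.
apply/mapP => -[b' b'L]; have [|A' eb' [cA' A0']] := single b'; first by rewrite inE b'L orbT.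
have A'L : A' \in flatten L' by apply/flattenP; exists b' => //; rewrite eb' mem_head.
have /(componentsP _ mr)[/set0Pn[x xA] sA mA] := cA.
have /(componentsP _ mr)[/set0Pn[y yA] _ _] := cA'.
rewrite eb' /= (c1 A x) ?mem_head // (c1 A' y) // ?inE ?A'L ?orbT // => -[exy].
case/negP: AL'; suff -> : A = A' by [].
apply: (component_disjoint mr (x := y)) => //.
by case: (fst_tau exy) => -> //; rewrite (stable_tau _ sA).
Qed.

End Steps.

Arguments half_pred {n} A.

Section Peel.
Local Open Scope ring_scope.
Variable n : nat.
Local Notation V := (bvert n).
Local Notation tau := (tau n).
Local Notation X := (V * 'I_n)%type.
Implicit Types (rho : {perm V}) (x y z p q : V) (A B : {set V}).
Implicit Types (L : seq (seq {set V})) (m : seq {set V}).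
Implicit Types (s : seq X).

Lemma set_colour_sub s A B x : B \in components (resulting s) ->
  A != set0 -> A \subset B -> x \in B ->
  set_colour (seq_colour s) A = Some (seq_colour s x).
Proof.
move=> cB /set0Pn[y yA] AB xB; rewrite -(set_colourE cB xB).
rewrite {1}/set_colour; case: pickP => [z zA /=|/(_ y)]; last by rewrite yA.
by rewrite -(set_colourE cB (subsetP AB _ zA)).
Qed.

Lemma set_colour_merge c (e : X) A :
  set_colour (merge_colours c e) A =
  (if set_colour c A == Some (c (unbar e.2)) then Some (c e.1)
   else set_colour c A).
Proof.
rewrite /set_colour; case: pickP => //= x xA; rewrite /merge_colours.
by rewrite (inj_eq (@Some_inj _)); case: ifP.
Qed.

Lemma compatible_same s (e : X) L :
  seq_colour s e.1 = seq_colour s (unbar e.2) ->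
  compatible (rcons s e) L = compatible s L.
Proof.
move=> E; apply: eq_colours_blocks => B _.
by rewrite seq_colour_rcons set_colour_merge E; case: eqP.
Qed.

Section LastStep.
Variables (rho : {perm V}) (A : {set V}) (m : seq {set V}) (L : seq (seq {set V})).
Variable i : 'I_n.
Local Notation q := (unbar i).
Hypotheses (mr : matching rho) (qA : q \in A).
Hypothesis lc : lists_components rho (flatten ((A :: m) :: L)).

Let sub : {subset flatten ((A :: m) :: L) <= components rho}.
Proof. by have [] := (lists_componentsP _ mr).1 lc. Qed.

Let cA : A \in components rho.
Proof. by rewrite sub ?mem_head. Qed.

Definition last_step k p : coefField :=
  \sum_(s : k.-tuple X) [&& ordered s, resulting s == twist (tperm p q) rho &
     compatible (rcons s (p, i)) ((A :: m) :: L)]%:R * weight_from tau s.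

Lemma last_step_merge k B r p : perm_eq m (B :: r) -> p \in B ->
  last_step k p = hcount k (twist (tperm p q) rho) ((A :|: B :: r) :: L).
Proof.
move=> pm pB; apply: eq_bigr => s _.
case: eqP => [es|_]; last by rewrite !andbF.
congr ((nat_of_bool (_ && (_ && _)))%:R * _).
have lc' : lists_components rho (flatten ((A :: B :: r) :: L)).
  move: lc; rewrite /lists_components; apply: perm_trans.
  by rewrite /= perm_cons -cat_cons perm_cat2r perm_sym.
have l2 := lists_merge mr lc' qA pB.
have cAB : A :|: B \in components (resulting s).
  have mr' : matching (twist (tperm p q) rho) by rewrite matching_twist.
  by rewrite es; have [_ sb _] := (lists_componentsP _ mr').1 l2; rewrite sb ?mem_head.
have qAB : q \in A :|: B by rewrite inE qA.
have pAB : p \in A :|: B by rewrite inE pB orbT.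
have epq : seq_colour s p = seq_colour s q.
  by apply: Some_inj; rewrite -(set_colourE cAB pAB) -(set_colourE cAB qAB).
rewrite compatible_same // /compatible.
rewrite (@colours_blocks_perm1 _ _ _ _ [:: A, B & r]) ?perm_cons //.
rewrite !colours_blocks_cons /=.
have n0 (C : {set V}) y : y \in C -> C != set0 by move=> yC; apply/set0Pn; exists y.
rewrite (set_colour_sub cAB (n0 A _ qA) (subsetUl _ _) qAB).
rewrite (set_colour_sub cAB (n0 B _ pB) (subsetUr _ _) qAB).
by rewrite (set_colourE cAB qAB) eqxx.
Qed.

Lemma last_step_twist k p : p \in A -> p \notin fingraph.orbit (walk rho) q ->
  last_step k p = hcount k (twist (tperm p q) rho) ((A :: m) :: L).
Proof.
move=> pA pO; apply: eq_bigr => s _.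
case: eqP => [es|_]; last by rewrite !andbF.
have cA' : A \in components (resulting s).
  by rewrite es; apply: twist_component => //; rewrite inE.
rewrite compatible_same //.
by apply: Some_inj; rewrite -(set_colourE cA' pA) -(set_colourE cA' qA).
Qed.

Lemma last_step_cut k a : (0 < a < fingraph.order (walk rho) q)%N ->
  let p := iter a (walk rho) q in
  let C := arc rho q a in
  last_step k p = hcount k (twist (tperm p q) rho) ([:: C, A :\: C & m] :: L)
    + \sum_(y <- splits m)
       hcount k (twist (tperm p q) rho) [:: C :: y.1, A :\: C :: y.2 & L].
Proof.
move=> ab p C; rewrite exchange_big -big_split /=; apply: eq_bigr => s _.
rewrite -mulr_suml -mulrDl; congr (_ * _).
case: eqP => [es|_]; last by rewrite !andbF big1 ?addr0 // => y _; rewrite !andbF.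
case: (ordered s) => /=; last by rewrite big1 ?addr0.
have [c1 c2] := cut_components mr cA qA ab.
have qC : q \in C by apply: (mem_arcq ab).
have pD : p \in A :\: C by rewrite in_setD (memN_arc mr cA qA ab) (iter_component mr cA qA).
have CA : C \subset A := arc_sub mr cA qA a.
have := c1; have := c2; rewrite -es => c2' c1'.
rewrite /compatible.
set g := set_colour (seq_colour s); set g' := set_colour (seq_colour (rcons s (p, i))).
have gC x : x \in C -> g C = Some (seq_colour s x) by apply: set_colourE.
have gD x : x \in A :\: C -> g (A :\: C) = Some (seq_colour s x) by apply: set_colourE.
have g'E B : g' B = (if g B == g C then g (A :\: C) else g B).
  by rewrite /g' seq_colour_rcons set_colour_merge /= -(gC q) // -(gD p).
have g'A : g' A = g (A :\: C).
  rewrite g'E; have : g A = g C \/ g A = g (A :\: C).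
    have [x xA gA] : exists2 x, x \in A & g A = Some (seq_colour s x).
      by rewrite /g /set_colour; case: pickP => [x xA|/(_ q)]; [exists x|rewrite qA].
    rewrite gA; case: (boolP (x \in C)) => xC; [left|right]; first by rewrite (gC x).
    by rewrite (gD x) // in_setD xC.
  by case=> ->; rewrite ?eqxx //; case: eqP => // <-.
have -> : colours_blocks g' ((A :: m) :: L) =
    colours_blocks ((fun h => if h == g C then g (A :\: C) else h) \o g)
      ([:: C, A :\: C & m] :: L).
  rewrite -(@eq_colours_blocks _ _ g'); last by move=> B _; rewrite /= g'E.
  rewrite !colours_blocks_cons /= g'A (g'E C) (g'E (A :\: C)) eqxx.
  by case: (eqVneq (g (A :\: C)) (g C)) => [->|_]; rewrite eqxx.
exact: (colours_blocks_merge coefField g C (A :\: C) m L).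
Qed.

End LastStep.

End Peel.

Section MaximalLabel.
Local Open Scope ring_scope.
Variable n : nat.
Local Notation V := (bvert n).
Local Notation tau := (tau n).
Local Notation X := (V * 'I_n)%type.
Implicit Types (rho : {perm V}) (x y z p q : V) (A B : {set V}).
Implicit Types (L : seq (seq {set V})) (m b : seq {set V}).
Implicit Types (s : seq X) (e : X).

Definition trivial_block b := map half_pred b == [:: 0%N].

Section State.
Variables (rho : {perm V}) (L : seq (seq {set V})).
Hypotheses (mr : matching rho) (lc : lists_components rho (flatten L)).

Let sub : {subset flatten L <= components rho}.
Proof. by have [] := (lists_componentsP _ mr).1 lc. Qed.

Lemma same_block s x y b b' B B' : resulting s = rho -> compatible s L ->
  b \in L -> B \in b -> x \in B -> b' \in L -> B' \in b' -> y \in B' ->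
  seq_colour s x = seq_colour s y -> b = b'.
Proof.
move=> es cs bL Bb xB bL' Bb' yB' exy.
have inL c C : c \in L -> C \in c -> C \in components (resulting s).
  by move=> cL Cc; rewrite es; apply/sub/flattenP; exists c.
apply: (colours_blocks_diff cs bL bL' Bb Bb').
by rewrite (set_colourE (inL _ _ bL Bb) xB) (set_colourE (inL _ _ bL' Bb') yB') exy.
Qed.

Lemma block_of x : exists2 b, b \in L & exists2 B, B \in b & x \in B.
Proof.
have [_ _ cov] := (lists_componentsP _ mr).1 lc.
by have [B /flattenP[b bL Bb] xB] := cov x; exists b => //; exists B.
Qed.

Lemma same_colour_block s x y b B : resulting s = rho -> compatible s L ->
  b \in L -> B \in b -> x \in B -> seq_colour s x = seq_colour s y ->
  exists2 B', B' \in b & y \in B'.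
Proof.
move=> es cs bL Bb xB exy; have [b' bL' [B' Bb' yB']] := block_of y.
by exists B' => //; rewrite (same_block es cs bL Bb xB bL' Bb' yB').
Qed.

Lemma trivial_blockP b x y B : b \in L -> trivial_block b -> B \in b -> x \in B ->
  forall B', B' \in b -> y \in B' -> y.1 = x.1.
Proof.
move=> bL; case: b bL => [|C [|? ?]] bL // /eqP[C0] //.
rewrite inE => /eqP -> xC B'; rewrite inE => /eqP ->.
have cC : C \in components rho by apply/sub/flattenP; exists [:: C]; rewrite ?mem_head.
exact: half_pred0 mr cC C0 xC.
Qed.

Lemma nontrivial_mem s e : resulting s = rho -> compatible s L -> e \in s ->
  (e.1.1 < e.2)%N ->
  exists2 b, b \in L & ~~ trivial_block b /\ exists2 B, B \in b & unbar e.2 \in B.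
Proof.
move=> es cs /seq_colour_mem ec lt12.
have [b bL [B Bb pB]] := block_of e.1.
have [B' Bb' qB'] := same_colour_block es cs bL Bb pB ec.
exists b => //; split; last by exists B'.
apply/negP => tb; have := trivial_blockP bL tb Bb pB Bb' qB' => /= e12.
by rewrite e12 ltnn in lt12.
Qed.

End State.

Section Last.
Variables (rho : {perm V}) (A : {set V}) (m : seq {set V}) (L0 : seq (seq {set V})).
Variable i : 'I_n.
Local Notation q := (unbar i).
Local Notation L := ((A :: m) :: L0).
Hypotheses (mr : matching rho) (qA : q \in A).
Hypothesis lc : lists_components rho (flatten L).
Hypothesis nontriv : ~~ trivial_block (A :: m).
Hypothesis maxi : forall b, b \in L -> ~~ trivial_block b ->
  forall B, B \in b -> forall x, x \in B -> (x.1 <= i)%N.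

Lemma nontrivial_other : exists2 y, y.1 != i & exists2 B, B \in A :: m & y \in B.
Proof.
have [u sub _] := (lists_componentsP _ mr).1 lc.
have cA : A \in components rho by rewrite sub ?mem_head.
have [] := componentsP _ mr cA => _ sA _.
case: m nontriv u sub => [|B m'] nt u sub.
  have : half_pred A != 0%N by apply: contra nt => /eqP e; rewrite /trivial_block /= e.
  have := half_predE mr cA qA; case: (half_pred A) => // h oh _.
  exists (walk rho q); last first.
    by exists A; rewrite ?mem_head // /walk (stable_rho _ mr) // (stable_tau _ sA).
  apply/eqP => e; have /fst_tau[e'|e'] : q.1 = (walk rho q).1 by rewrite e.
    by have := @iter_walk_inj _ rho q 1 0; rewrite oh => /(_ isT isT e').
  by have := walk_neq_tau 1 q mr; rewrite /= e' eqxx.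
have cB : B \in components rho by rewrite sub // !inE eqxx orbT.
have /(componentsP _ mr)[/set0Pn[y yB] _ _] := cB.
exists y; last by exists B => //; rewrite !inE eqxx orbT.
apply/eqP => e; have yA : y \in A.
  by case: (@fst_tau _ q y) => [|->|->] //; rewrite (stable_tau _ sA).
by move: u; rewrite /= (component_disjoint mr cA cB yA yB) mem_head.
Qed.

Lemma last_index s e : resulting (rcons s e) = rho -> ordered (rcons s e) ->
  compatible (rcons s e) L -> e.2 = i.
Proof.
move=> es os cs; have [/allP lt srt] := andP os.
have le_i e' : e' \in rcons s e -> (e'.2 <= i)%N.
  move=> e's; have := lt e' e's; rewrite lt_unbar => lte.
  have [b bL [nb [B Bb qB]]] := nontrivial_mem mr lc es cs e's lte.
  exact: (maxi bL nb Bb qB).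
have lelast e' : e' \in rcons s e -> (e'.2 <= e.2)%N.
  move=> e's; move: srt; rewrite map_rcons => srt.
  have := srt; rewrite -rev_sorted rev_rcons /= path_sortedE; last first.
    by move=> a c d; apply: (fun h1 h2 => leq_trans h2 h1).
  move=> /andP[/allP H _].
  move: e's; rewrite mem_rcons inE => /orP[/eqP -> //|e's].
  by apply: H; rewrite mem_rev; apply/mapP; exists e'.
case: (boolP (all (fun e => (e.1.1 != i) && (e.2 != i)) (rcons s e))) => [un|].
  have [y yi [B Bm yB]] := nontrivial_other.
  have qi : seq_colour (rcons s e) q = i by apply/eqP; rewrite seq_colour_untouched.
  have : seq_colour (rcons s e) y = i.
    rewrite -{}qi; have [u sub _] := (lists_componentsP _ mr).1 lc.
    have inL C : C \in A :: m -> C \in components (resulting (rcons s e)).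
      by move=> Cm; rewrite es; apply/sub/flattenP; exists (A :: m); rewrite ?mem_head.
    apply: Some_inj; rewrite -(set_colourE (inL B Bm) yB).
    rewrite -(set_colourE (inL A (mem_head _ _)) qA).
    by apply: (colours_blocks_same cs (mem_head _ _) Bm (mem_head _ _)).
  by move/eqP; rewrite seq_colour_untouched // (negPf yi).
case/allPn => e' e's; rewrite negb_and !negbK => /orP[/eqP e1|/eqP e2].
  have := lt e' e's; rewrite lt_unbar e1 => lti.
  by have := le_i e' e's; rewrite leqNgt lti.
apply/val_inj/eqP; rewrite eqn_leq le_i ?mem_rcons ?mem_head //=.
by rewrite -e2 lelast.
Qed.

Lemma last_condition s p :
  [&& ordered (rcons s (p, i)), resulting (rcons s (p, i)) == rho
    & compatible (rcons s (p, i)) L] =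
  (has (fun B => p \in B) (A :: m) && (p.1 != i)) &&
  [&& ordered s, resulting s == twist (tperm p q) rho & compatible (rcons s (p, i)) L].
Proof.
have eres : (resulting (rcons s (p, i)) == rho) = (resulting s == twist (tperm p q) rho).
  rewrite resulting_rcons /transp /=; apply/eqP/eqP => [<-|->]; by rewrite twistK.
rewrite eres; case: eqP => [es|_]; last by rewrite !andbF.
have es' : resulting (rcons s (p, i)) = rho by apply/eqP; rewrite eres es.
case: (boolP (compatible _ _)) => cs; last by rewrite !andbF.
rewrite !andbT.
have os : ordered (rcons s (p, i)) -> ordered s.
  rewrite /ordered all_rcons map_rcons => /andP[/andP[_ ->]] /=.
  by rewrite -cats1 => /cat_sorted2[].
have cpq : seq_colour (rcons s (p, i)) p = seq_colour (rcons s (p, i)) q.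
  by apply: (@seq_colour_mem _ _ (p, i)); rewrite mem_rcons mem_head.
apply/idP/idP => [o|/andP[/andP[pb pi] o]].
  have [/allP lt srt] := andP o.
  have lpi : (p.1 < i)%N.
    by rewrite -lt_unbar; apply: (lt (p, i)); rewrite mem_rcons mem_head.
  rewrite (os o) andbT; apply/andP; split; last first.
    by apply/eqP => e; rewrite e ltnn in lpi.
  have [B Bm pB] := same_colour_block mr lc es' cs (mem_head _ _) (mem_head _ _) qA (esym cpq).
  by apply/hasP; exists B.
have [B Bm pB] := hasP pb.
have lpi : (p.1 < i)%N.
  rewrite ltn_neqAle (maxi (mem_head _ _) nontriv Bm pB) andbT.
  by apply: contraNneq pi => e; apply/eqP/val_inj.
have [/allP lt srt] := andP o.
rewrite /ordered all_rcons lt_unbar lpi /=; apply/andP; split; first by apply/allP.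
rewrite map_rcons -[sorted _ _]rev_sorted rev_rcons /=.
rewrite path_sortedE; last by move=> a c d; apply: (fun h1 h2 => leq_trans h2 h1).
rewrite rev_sorted srt andbT all_rev; apply/allP => _ /mapP[e es2 ->].
have es3 : e \in rcons s (p, i) by rewrite mem_rcons inE es2 orbT.
have := lt e es2; rewrite lt_unbar => lte.
have [b bL [nb [B' Bb qB]]] := nontrivial_mem mr lc es' cs es3 lte.
exact: (maxi bL nb Bb qB).
Qed.

Lemma hcountS k : hcount k.+1 rho L =
  \sum_(p : V) (has (fun B => p \in B) (A :: m) && (p.1 != i))%:R *
    (weight (twist (tperm p q) rho) (tperm p q) * last_step rho A m L0 i k p).
Proof.
rewrite /hcount (sum_tuple_rcons _ (fun s => [&& ordered s, resulting s == rho & compatible s L]%:R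
     * weight_from tau s)).
have E (s : k.-tuple X) : \sum_(e : X) [&& ordered (rcons s e),
        resulting (rcons s e) == rho & compatible (rcons s e) L]%:R
      * weight_from tau (rcons s e) =
   \sum_(p : V) [&& ordered (rcons s (p, i)),
        resulting (rcons s (p, i)) == rho & compatible (rcons s (p, i)) L]%:R
      * weight_from tau (rcons s (p, i)).
  set F := fun e : X => [&& ordered (rcons s e), resulting (rcons s e) == rho
      & compatible (rcons s e) L]%:R * weight_from tau (rcons s e).
  rewrite (eq_bigr (fun e : X => F (e.1, e.2))) => [|[] //].
  rewrite -(pair_bigA _ (fun p j => F (p, j))) /F /=.
  apply: eq_bigr => p _; rewrite (bigD1 i) //= big1 ?addr0 // => j ji.
  case: and3P => [[o /eqP r c]|_]; last by rewrite mul0r.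
  by have := last_index r o c => /= e; rewrite e eqxx in ji.
rewrite (eq_bigr _ (fun (s : k.-tuple X) _ => E s)) exchange_big; apply: eq_bigr => p _ /=.
rewrite /last_step !mulr_sumr; apply: eq_bigr => s _.
rewrite last_condition weight_from_rcons.
case: (has _ _ && _) => /=; last by rewrite !mul0r.
case: eqP => [es|_] /=; last by rewrite andbF !(mul0r, mulr0).
by rewrite es /transp /= mul1r [weight _ _ * _]mulrC mulrA.
Qed.

End Last.
End MaximalLabel.

Section CountCutJoin.
Local Open Scope ring_scope.
Variable n : nat.
Local Notation V := (bvert n).
Local Notation tau := (tau n).
Local Notation X := (V * 'I_n)%type.
Local Notation cutjoin := (cutjoin (2 * Cvar) Jvar Tvar).
Implicit Types (rho : {perm V}) (x y z p q : V) (A B : {set V}).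
Implicit Types (L : seq (seq {set V})) (m b : seq {set V}).

Definition block_sizes L := map (map half_pred) L.

#[local] Arguments block_sizes : simpl never.

Lemma block_sizes_cons b L : block_sizes (b :: L) = map half_pred b :: block_sizes L.
Proof. by []. Qed.

Definition nonempty_blocks L := all (fun b => b != [::]) L.

Section Step.
Variables (rho : {perm V}) (A : {set V}) (m : seq {set V}) (L0 : seq (seq {set V})).
Variables (i : 'I_n) (k : nat).
Local Notation q := (unbar i).
Local Notation L := ((A :: m) :: L0).
Hypotheses (mr : matching rho) (qA : q \in A).
Hypothesis lc : lists_components rho (flatten L).
Hypothesis nonemptyL0 : nonempty_blocks L0.
Hypothesis nontriv : ~~ trivial_block (A :: m).
Hypothesis maxi : forall b, b \in L -> ~~ trivial_block b ->
  forall B, B \in b -> forall x, x \in B -> (x.1 <= i)%N.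
Hypothesis IH : forall rho' L', matching rho' ->
  lists_components rho' (flatten L') -> nonempty_blocks L' ->
  hcount k rho' L' = cutjoin k (block_sizes L').

Let sub : {subset flatten L <= components rho}.
Proof. by have [] := (lists_componentsP _ mr).1 lc. Qed.

Let cA : A \in components rho.
Proof. by rewrite sub ?mem_head. Qed.

Let mr' p : matching (twist (tperm p q) rho).
Proof. by rewrite matching_twist. Qed.

Let ne B b : nonempty_blocks ((B :: b) :: L0).
Proof. exact: nonemptyL0. Qed.

Let ne2 B b B' b' : nonempty_blocks [:: B :: b, B' :: b' & L0].
Proof. exact: nonemptyL0. Qed.

Let G p := weight (twist (tperm p q) rho) (tperm p q) * last_step rho A m L0 i k p.

Lemma step_merge B r p : perm_eq m (B :: r) -> p \in B ->
  G p = Cvar * cutjoin k (((half_pred A + half_pred B).+1 :: map half_pred r)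
                           :: block_sizes L0).
Proof.
move=> pm pB.
have lc' : lists_components rho [:: A, B & r ++ flatten L0].
  move: lc; rewrite /lists_components; apply: perm_trans.
  by rewrite /= perm_cons -cat_cons perm_cat2r perm_sym.
have [u sub' _] := (lists_componentsP _ mr).1 lc'.
have cB : B \in components rho by rewrite sub' // !inE eqxx orbT.
have AB : A != B by move: u; rewrite /= !inE negb_or -andbA => /andP[].
have l2 := lists_merge mr lc' qA pB.
have cAB : A :|: B \in components (twist (tperm p q) rho).
  exact: merge_component.
have hAB : half_pred (A :|: B) = (half_pred A + half_pred B).+1.
  have AB0 : A :&: B = set0.
    apply/eqP; apply: contraNT AB => /set0Pn[x]; rewrite inE => /andP[xA xB].
    by rewrite (component_disjoint mr cA cB xA xB).
  have := cardsU A B; rewrite AB0 cards0 subn0 (card_half_pred (mr' p) cAB).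
  by rewrite (card_half_pred mr cA) (card_half_pred mr cB) -doubleD => /double_inj[->]; rewrite addnS.
rewrite /G (last_step_merge mr qA lc k pm pB) IH ?ne // block_sizes_cons /=.
rewrite hAB (weight_lists l2 (ls' := [:: A, B & r ++ flatten L0])) ?twistK //.
by rewrite eqxx.
Qed.

Lemma step_twist p : p \in A -> p \notin fingraph.orbit (walk rho) q ->
  G p = Tvar * cutjoin k (block_sizes L).
Proof.
move=> pA pO; have l2 := lists_twist mr lc qA pA pO.
rewrite /G; have -> : weight (twist (tperm p q) rho) (tperm p q) = Tvar.
  by apply: (weight_same l2); rewrite twistK; apply: lc.
by rewrite (last_step_twist mr qA lc k pA pO) (IH (L' := L) (mr' p) l2 (ne _ _)).
Qed.

Lemma step_cut a : (a < half_pred A)%N ->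
  G (iter a.+1 (walk rho) q) =
  Jvar * (cutjoin k ([:: a, (half_pred A).-1 - a & map half_pred m]%N :: block_sizes L0)
   + \sum_(y <- splits (map half_pred m))
       cutjoin k [:: a :: y.1, ((half_pred A).-1 - a)%N :: y.2 & block_sizes L0]).
Proof.
move=> ah; set p := iter a.+1 _ _; set C := arc rho q a.+1.
have oA := half_predE mr cA qA.
have ab : (0 < a.+1 < fingraph.order (walk rho) q)%N by rewrite oA ltnS.
have l2 : lists_components (twist (tperm p q) rho) [:: C, A :\: C & m ++ flatten L0].
  exact: (lists_cut mr lc qA ab).
have cardC : #|C| = a.+1.*2 by rewrite card_arc // ltnW //; case/andP: ab.
have hC : half_pred C = a by rewrite /half_pred cardC doubleK.
have hD : half_pred (A :\: C) = ((half_pred A).-1 - a)%N.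
  rewrite {1}/half_pred cardsD (setIidPr (arc_sub mr cA qA a.+1)) cardC.
  rewrite (card_half_pred mr cA) -doubleB doubleK subSS.
  by case: (half_pred A) ah => // h ah; rewrite subSn.
rewrite /G (last_step_cut mr qA lc k ab) -/p -/C IH ?ne // !block_sizes_cons /=.
rewrite hC hD (weight_lists l2 (ls' := [:: A & m ++ flatten L0])) ?twistK //.
have ns t : (t.+1 == t.+3) = false by elim: t.
rewrite /= ns eqxx; congr (_ * (_ + _)).
rewrite splits_map big_map !big_seq; apply: eq_bigr => y /splits_mem py.
rewrite IH ?ne2 // ?block_sizes_cons /= ?hC ?hD //.
move: l2; rewrite /lists_components; apply: perm_trans; rewrite perm_cons.
apply: perm_trans (permEl (perm_catCA y.1 [:: A :\: C] (y.2 ++ flatten L0))) _.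
by rewrite perm_cons catA perm_cat2r perm_sym.
Qed.

Lemma hcount_step : hcount k.+1 rho L = cutjoin k.+1 (block_sizes L).
Proof.
rewrite (hcountS mr qA lc nontriv maxi).
have [u _ cov] := (lists_componentsP _ mr).1 lc.
have um : uniq (A :: m) by move: u; rewrite /= mem_cat cat_uniq negb_or -andbA => /and4P[-> _ ->].
have subm : {subset A :: m <= components rho}.
  by move=> B Bm; apply/sub/flattenP; exists (A :: m); rewrite ?mem_head.
have hasE (p : V) (b : seq {set V}) : uniq b -> {subset b <= components rho} ->
    (has (fun B => p \in B) b)%:R = \sum_(B <- b) (p \in B)%:R :> coefField.
  elim: b => [|B b IHb] /=; first by rewrite big_nil.
  move=> /andP[Bb ub] sb; rewrite big_cons -IHb //; last first.
    by move=> C Cb; apply: sb; rewrite inE Cb orbT.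
  rewrite -natrD; congr _%:R; case: (boolP (p \in B)) => pB //=.
  case: hasP => // -[C Cb pC]; case/negP: Bb.
  by rewrite (component_disjoint mr _ _ pB pC) // sb ?mem_head // inE Cb orbT.
transitivity (\sum_(B <- A :: m) \sum_(p in B) (p.1 != i)%:R * G p).
  rewrite (eq_bigr (fun p => \sum_(B <- A :: m) (p \in B)%:R * ((p.1 != i)%:R * G p))).
    rewrite exchange_big; apply: eq_bigr => B _ /=.
    rewrite [RHS]big_mkcond; apply: eq_bigr => p _.
    by case: (p \in B); rewrite ?mul1r ?mul0r.
  by move=> p _; rewrite -mulr_suml -hasE // -/(G p) mulrA -natrM mulnb.
rewrite big_cons.
have nt : (half_pred A :: map half_pred m == [:: 0%N]) = false by apply/negbTE.
rewrite block_sizes_cons [RHS]cutjoin_cons /= nt mul0r add0r stepE /=.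
rewrite addrC -!addrA; congr (_ + _).
  rewrite picks_map big_map mulr_sumr picks_sum !big_seq.
  apply: eq_bigr => y /picks_mem py /=.
  have yc : y.1 \in components rho.
    by apply: subm; rewrite inE (perm_mem py) mem_head orbT.
  rewrite (eq_bigr (fun _ => Cvar * cutjoin k
     (((half_pred A + half_pred y.1).+1 :: map half_pred y.2) :: block_sizes L0))).
    rewrite sumr_const (card_half_pred mr yc) -muln2 mulrnA -mulrnAl mulr2n.
    by rewrite -(mulr_natr Cvar) -[LHS]mulr2n -[LHS]mulr_natl !mulrA.
  move=> p pB; rewrite -(step_merge py pB).
  suff -> : p.1 != i by rewrite mul1r.
  apply/eqP => e; have [_ sA _] := componentsP _ mr cA.
  have pA : p \in A by case: (@fst_tau _ q p) => [|->|->] //; rewrite (stable_tau _ sA).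
  move: um; rewrite /= (component_disjoint mr cA yc pA pB) => /andP[/negP[]].
  by rewrite (perm_mem py) mem_head.
rewrite (sum_component mr cA qA) (half_predE mr cA qA) big_nat_recl //=.
rewrite tau_fst eqxx !mul0r !add0r.
rewrite (eq_big_nat _ _ (F2 := fun a => Jvar * (cutjoin k
     ([:: a, (half_pred A).-1 - a & map half_pred m]%N :: block_sizes L0)
   + \sum_(y <- splits (map half_pred m))
       cutjoin k [:: a :: y.1, ((half_pred A).-1 - a)%N :: y.2 & block_sizes L0])
   + Tvar * cutjoin k (block_sizes L))).
  rewrite big_split /= -mulr_sumr big_split /= sumr_const_nat subn0 mulrDr addrC.
  congr (_ + _).
  by rewrite -mulrnAr -[in LHS]mulr_natl.
move=> a /andP[_ ah].
have oA := half_predE mr cA qA.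
have ni : (iter a.+1 (walk rho) q).1 != i.
  apply/eqP => e; have /fst_tau[e'|e'] : q.1 = (iter a.+1 (walk rho) q).1 by rewrite e.
    by have := @iter_walk_inj _ rho q a.+1 0; rewrite oA !ltnS => /(_ ah isT e').
  by have := walk_neq_tau a.+1 q mr; rewrite e' eqxx.
have [_ sA _] := componentsP _ mr cA.
rewrite tau_fst -iterS ni !mul1r step_cut // step_twist //.
  by rewrite (stable_tau _ sA) (iter_component mr cA qA).
by apply: (orbit_tauN mr); rewrite -fconnect_orbit fconnect_iter.
Qed.

End Step.
End CountCutJoin.

Section HCount.
Local Open Scope ring_scope.
Variable n : nat.
Local Notation V := (bvert n).
Local Notation tau := (tau n).
Local Notation X := (V * 'I_n)%type.
Local Notation cutjoin := (cutjoin (2 * Cvar) Jvar Tvar).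
Implicit Types (rho : {perm V}) (x y z p q : V) (A B : {set V}).
Implicit Types (L : seq (seq {set V})) (m b : seq {set V}).

Lemma trivial_block_perm b b' : perm_eq b b' -> trivial_block b = trivial_block b'.
Proof.
move=> pb; have pm : perm_eq (map half_pred b) (map half_pred b') by apply: perm_map.
rewrite /trivial_block; apply/eqP/eqP => e; move: pm; rewrite e.
  by rewrite perm_sym => /perm_small_eq ->.
by move/perm_small_eq => ->.
Qed.

Lemma hcount_cutjoin k rho L : matching rho ->
  lists_components rho (flatten L) -> nonempty_blocks L ->
  hcount k rho L = cutjoin k (block_sizes L).
Proof.
elim: k rho L => [|k IH] rho L mr lc nn.
  by rewrite hcount0.
have [_ sub cov] := (lists_componentsP _ mr).1 lc.
case: (boolP (all (@trivial_block n) L)) => [tL|].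
  rewrite cutjoin_trivial ?all_map //; apply: big1 => s _.
  case: and3P => [[os /eqP es cs]|_]; last by rewrite mul0r.
  have /andP[/allP lt _] := os.
  case/tupleP: s es cs lt {os} => e s es cs lt.
  have := lt e (mem_head _ _); rewrite lt_unbar => lte.
  have [b bL []] := nontrivial_mem mr lc es cs (mem_head _ _) lte.
  by rewrite (allP tL).
case/allPn => b0 b0L nt0.
pose P j := has (fun b => ~~ trivial_block b && has (fun B => unbar j \in B) b) L.
have PB b B x : b \in L -> ~~ trivial_block b -> B \in b -> x \in B -> P x.1.
  move=> bL nb Bb xB; apply/hasP; exists b => //; rewrite nb; apply/hasP; exists B => //.
  have /(componentsP _ mr)[_ sB _] : B \in components rho.
    by apply/sub/flattenP; exists b.
  by case: (@fst_tau _ x (unbar x.1)) => [|->|->] //; rewrite (stable_tau _ sB).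
have [x0 Px0] : exists j, P j.
  case: b0 b0L nt0 => [b0L|B b b0L nt0]; first by have := allP nn _ b0L.
  have /(componentsP _ mr)[/set0Pn[x xB] _ _] : B \in components rho.
    by apply/sub/flattenP; exists (B :: b); rewrite ?mem_head.
  by exists x.1; apply: PB b0L nt0 (mem_head _ _) xB.
have [i Pi maxi] : exists2 i, P i & forall j, P j -> (j <= i)%N.
  by case: (arg_maxnP (fun j : 'I_n => nat_of_ord j) Px0) => i Pi mi; exists i.
have /hasP[b bL /andP[nb /hasP[A Ab qA]]] := Pi.
have pb := perm_to_rem Ab; have pL := perm_to_rem bL.
set m := rem A b in pb; set L0 := rem b L in pL.
rewrite (hcount_perm _ _ pL) (hcount_perm1 _ _ _ pb).
rewrite (cutjoin_perm _ _ _ _ (perm_map (map half_pred) pL)) map_cons.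
rewrite (cutjoin_perm1 _ _ _ _ _ (perm_map half_pred pb)).
apply: (hcount_step (i := i)) => //.
- move: lc; rewrite /lists_components; apply: perm_trans.
  rewrite perm_sym; apply: perm_trans (perm_flatten pL) _ => /=.
  by rewrite -cat_cons perm_cat2r.
- by move: nn; rewrite /nonempty_blocks (perm_all _ pL) => /andP[].
- by rewrite -(trivial_block_perm pb).
move=> b'; rewrite inE => /orP[/eqP ->|b'L] nt' B Bb x xB; apply: maxi.
  by apply: (PB b B) => //; rewrite (perm_mem pb).
by apply: (PB b' B) => //; rewrite (perm_mem pL) inE b'L orbT.
Qed.

Definition seq_group (s : seq X) : {group {perm V}} :=
  <<tau |: [set transp x | x in s]>>%G.

Lemma seq_colour_group s g x : g \in seq_group s -> seq_colour s (g x) = seq_colour s x.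
Proof.
pose H := [set h : {perm V} | [forall y, seq_colour s (h y) == seq_colour s y]].
have gH : group_set H.
  apply/group_setP; split; first by rewrite inE; apply/forallP => y; rewrite perm1.
  move=> a b; rewrite !inE => /forallP Ha /forallP Hb; apply/forallP => y.
  by rewrite permM (eqP (Hb _)).
have : seq_group s \subset Group gH.
  rewrite gen_subG; apply/subsetP => h; rewrite !inE => /orP[/eqP ->|/imsetP[e es ->]].
    by apply/forallP => y; rewrite seq_colour_tau.
  apply/forallP => y; rewrite /transp; case: tpermP => // ->.
    by rewrite seq_colour_mem.
  by rewrite (seq_colour_mem es).
by move=> /subsetP sH /sH; rewrite inE => /forallP/(_ x)/eqP.
Qed.

Lemma seq_group_rcons s e : seq_group s \subset seq_group (rcons s e).
Proof.
apply: genS; apply: setUS; apply/subsetP => h /imsetP[e' es ->].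
by apply/imsetP; exists e' => //; rewrite mem_rcons inE es orbT.
Qed.

Lemma seq_colour_orbit s x y : seq_colour s x = seq_colour s y ->
  y \in orbit 'P (seq_group s) x.
Proof.
elim/last_ind: s x y => [|s e IH] x y.
  rewrite /seq_colour /= => /fst_tau[->|->]; first exact: orbit_refl.
  by apply/orbitP; exists tau; rewrite // mem_gen // !inE eqxx.
have up a c : c \in orbit 'P (seq_group s) a -> c \in orbit 'P (seq_group (rcons s e)) a.
  by move=> /orbitP[g gs <-]; apply/orbitP; exists g => //; apply: subsetP gs; apply: seq_group_rcons.
have epq : e.1 \in orbit 'P (seq_group (rcons s e)) (unbar e.2).
  apply/orbitP; exists (transp e); last by rewrite /= /aperm tpermR.
  by rewrite mem_gen // !inE; apply/orP; right; apply/imsetP; exists e; rewrite ?mem_rcons ?mem_head.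
pose cls a := if seq_colour s a == seq_colour s (unbar e.2) then e.1 else a.
have oc a : cls a \in orbit 'P (seq_group (rcons s e)) a.
  rewrite /cls; case: eqP => [h|_]; last exact: orbit_refl.
  exact: orbit_trans epq (up _ _ (IH _ _ h)).
have ce a : seq_colour (rcons s e) a = seq_colour s (cls a).
  by rewrite seq_colour_rcons /merge_colours /cls; case: ifP.
rewrite !ce => /IH/up h.
have := oc x; have := oc y; rewrite orbit_sym => oy ox.
exact: orbit_trans (orbit_trans oy h) ox.
Qed.

Lemma transitive_colours s : (0 < n)%N ->
  [transitive seq_group s, on [set: V] | 'P] =
  [forall x, forall y, seq_colour s x == seq_colour s y].
Proof.
move=> n0; pose x0 : V := (Ordinal n0, false).
apply/idP/idP => [tr|H].
  apply/forallP => x; apply/forallP => y.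
  have [g gs ->] := atransP2 tr (in_setT x) (in_setT y).
  by rewrite /= /aperm seq_colour_group.
apply/imsetP; exists x0; rewrite ?inE //; apply/setP => y; rewrite inE; apply/esym.
by apply/seq_colour_orbit/eqP; have /forallP/(_ y) := forallP H x0.
Qed.

End HCount.

(** * The number of labelled matchings *)

Section Counting.
Variable n : nat.
Local Notation V := (bvert n).
Local Notation tau := (tau n).
Implicit Types (rho : {perm V}) (x y p q : V) (A B : {set V}).
Implicit Types (ls pre post : seq {set V}) (m : seq nat).

Definition sizes ls := [seq #|A| | A <- ls].

Definition labelled_matchings m : seq ({perm V} * seq {set V}) :=
  [seq (rho, ls) | rho <- enum [pred rho | matching rho],
     ls <- [seq ls <- permutations (enum (components rho))
           | sizes ls == map double m]].

Lemma labelled_matchings_uniq m : uniq (labelled_matchings m).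
Proof.
apply: allpairs_uniq_dep => [|rho _|[r1 l1] [r2 l2] _ _ [-> ->]] //.
  exact: enum_uniq.
by apply: filter_uniq; apply: permutations_uniq.
Qed.

Lemma mem_labelled_matchings m rho ls :
  ((rho, ls) \in labelled_matchings m) =
  [&& matching rho, lists_components rho ls & sizes ls == map double m].
Proof.
apply/allpairsPdep/and3P => [[r [l [r1 l1 [-> ->]]]]|[r1 l1 sz]].
  move: r1 l1; rewrite mem_enum inE mem_filter mem_permutations => -> /andP[-> ?].
  by split.
exists rho, ls; split=> //; first by rewrite mem_enum.
by rewrite mem_filter sz mem_permutations.
Qed.

Lemma sum_const_size (T U : eqType) (s : seq T) (t : T -> seq U) c :
  (forall o, o \in s -> size (t o) = c) ->
  size [seq (o, u) | o <- s, u <- t o] = (size s * c)%N.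
Proof.
elim: s => //= o s IH H; rewrite size_cat size_map H ?mem_head // IH // => u us.
by apply: H; rewrite inE us orbT.
Qed.

Lemma sizes_cat l1 l2 : sizes (l1 ++ l2) = sizes l1 ++ sizes l2.
Proof. exact: map_cat. Qed.

Lemma sizes_cons A ls : sizes (A :: ls) = #|A| :: sizes ls.
Proof. by []. Qed.

Lemma sizes_split m1 m2 ls : sizes ls = m1 ++ m2 ->
  exists l1 l2, [/\ ls = l1 ++ l2, sizes l1 = m1 & sizes l2 = m2].
Proof.
move=> e; exists (take (size m1) ls), (drop (size m1) ls).
by rewrite cat_take_drop /sizes map_take map_drop -/(sizes ls) e take_size_cat // drop_size_cat.
Qed.

Lemma perm_middle (T : eqType) (s1 s2 s3 : seq T) :
  perm_eq (s1 ++ s2 ++ s3) (s2 ++ s1 ++ s3).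
Proof. by rewrite perm_catCA. Qed.

Lemma lists_middle rho pre new post :
  lists_components rho (pre ++ new ++ post) <-> lists_components rho (new ++ pre ++ post).
Proof.
rewrite /lists_components; split; apply: perm_trans; exact: perm_middle.
Qed.

Section CutMerge.
Variables (m1 m2 : seq nat) (a b : nat).
Hypotheses (a_gt0 : 0 < a) (b_gt0 : 0 < b).
Let k := size m1.
Local Notation merged := (labelled_matchings (m1 ++ (a + b) :: m2)).
Local Notation cut := (labelled_matchings (m1 ++ [:: a, b & m2])).

Definition rooted1 := [seq (o, x) | o <- merged, x <- enum (nth set0 o.2 k)].
Definition rooted2 := [seq (o, xy) | o <- cut,
   xy <- [seq (x, y) | x <- enum (nth set0 o.2 k), y <- enum (nth set0 o.2 k.+1)]].

Lemma mergedP o : o \in merged -> exists pre A post,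
  [/\ o.2 = pre ++ A :: post, size pre = k, matching o.1,
      lists_components o.1 (A :: pre ++ post) &
      sizes pre = map double m1 /\ #|A| = (a + b).*2 /\ sizes post = map double m2].
Proof.
case: o => rho ls; rewrite mem_labelled_matchings => /and3P[mr lc /eqP].
rewrite map_cat => /sizes_split[pre [[|A post] [els szp]]] //= [cA szpost].
exists pre, A, post; split=> //.
- by rewrite -(size_map (fun A => #|A|) pre) -/(sizes pre) szp size_map.
- by move: lc; rewrite els (lists_middle rho pre [:: A] post).
Qed.

Lemma cutP o : o \in cut -> exists pre A B post,
  [/\ o.2 = pre ++ [:: A, B & post], size pre = k, matching o.1,
      lists_components o.1 ([:: A, B & pre ++ post]) &
      [/\ sizes pre = map double m1, #|A| = a.*2, #|B| = b.*2 & sizes post = map double m2]].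
Proof.
case: o => rho ls; rewrite mem_labelled_matchings => /and3P[mr lc /eqP].
rewrite map_cat => /sizes_split[pre [[|A [|B post]] [els szp]]] //= [cA cB szpost].
exists pre, A, B, post; split=> //.
- by rewrite -(size_map (fun A => #|A|) pre) -/(sizes pre) szp size_map.
- by move: lc; rewrite els (lists_middle rho pre [:: A; B] post).
Qed.

Lemma size_rooted1 : size rooted1 = (size merged * (a + b).*2)%N.
Proof.
apply: sum_const_size => o /mergedP[pre [A [post [-> szp _ _ [_ [cA _]]]]]].
by rewrite -szp nth_cat ltnn subnn /= -cardE.
Qed.

Lemma size_rooted2 : size rooted2 = (size cut * (a.*2 * b.*2))%N.
Proof.
apply: sum_const_size => o /cutP[pre [A [B [post [-> szp _ _ [_ cA cB _]]]]]].
rewrite size_allpairs -!cardE -szp !nth_cat ltnn ltnNge leqnSn /= subnn.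
by rewrite subSnn /= cA cB.
Qed.

Definition cut_map (z : {perm V} * seq {set V} * V) :
    {perm V} * seq {set V} * (V * V) :=
  let: ((rho, ls), x) := z in
  let y := iter a (walk rho) x in
  let A := nth set0 ls k in
  ((twist (tperm y x) rho,
    take k ls ++ [:: arc rho x a, A :\: arc rho x a & drop k.+1 ls]), (x, y)).

Definition merge_map (z : {perm V} * seq {set V} * (V * V)) :
    {perm V} * seq {set V} * V :=
  let: ((rho, ls), (x, y)) := z in
  ((twist (tperm y x) rho,
    take k ls ++ (nth set0 ls k :|: nth set0 ls k.+1) :: drop k.+2 ls), x).

Lemma rooted1P z : z \in rooted1 ->
  cut_map z \in rooted2 /\ merge_map (cut_map z) = z.
Proof.
case: z => -[rho ls] x /allpairsPdep[o [x' [om xA [eo ex]]]]; subst o x'.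
have [pre [A [post [/= els szp mr lc [sz1 [cA sz2]]]]]] := mergedP om.
subst ls; rewrite /= -szp nth_cat ltnn subnn /= in xA *.
rewrite mem_enum in xA.
rewrite take_size_cat // drop_cat ltnNge leqnSn /= subSnn /= drop0.
have [_ sub _] := (lists_componentsP _ mr).1 lc.
have cpA : A \in components rho by rewrite sub ?mem_head.
have oab : fingraph.order (walk rho) x = (a + b)%N.
  by apply: double_inj; rewrite -(card_component mr cpA xA).
have ab : 0 < a < fingraph.order (walk rho) x by rewrite oab; lia.
have l2 := lists_cut mr lc xA ab.
have arcA := arc_sub mr cpA xA a.
have cC : #|arc rho x a| = a.*2 by apply: card_arc => //; lia.
split.
  apply/allpairsPdep; eexists; eexists; split; last reflexivity.
    rewrite mem_labelled_matchings matching_twist mr /=; apply/andP; split.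
      exact: (lists_middle _ pre [:: arc rho x a; A :\: arc rho x a] post).2.
    rewrite sizes_cat !sizes_cons sz1 sz2 cC.
    by rewrite cardsD (setIidPr arcA) cC cA doubleD addKn map_cat.
  apply/allpairsP; exists (x, iter a (walk rho) x); split=> //=;
    rewrite mem_enum -szp nth_cat ?ltnn ?subnn /=.
    exact: mem_arcq.
  rewrite ltnNge leqnSn /= subSnn /= in_setD.
  by rewrite (memN_arc mr cpA xA ab) (iter_component mr cpA xA).
rewrite twistK take_size_cat // !nth_cat ltnn subnn ltnNge leqnSn subSnn /=.
rewrite drop_cat ltnNge leqW //= -addn2 addKn /= -{1}(setIidPr arcA) setID.
by rewrite drop0.
Qed.

Lemma rooted2P z : z \in rooted2 ->
  merge_map z \in rooted1 /\ cut_map (merge_map z) = z.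
Proof.
case: z => -[rho ls] [x y] /allpairsPdep[o [xy [oc xyA [eo ex]]]]; subst o xy.
have [pre [A [B [post [/= els szp mr lc [sz1 cA cB sz2]]]]]] := cutP oc.
move: xyA => /allpairsP[[x' y'] /= [xA yB [ex ey]]]; subst x' y' ls.
rewrite mem_enum -szp nth_cat ltnn subnn /= in xA.
rewrite mem_enum -szp nth_cat ltnNge leqnSn /= subSnn /= in yB.
have [u sub _] := (lists_componentsP _ mr).1 lc.
have cpA : A \in components rho by rewrite sub ?mem_head.
have cpB : B \in components rho by rewrite sub // !inE eqxx orbT.
have AB : A != B by move: u; rewrite /= !inE negb_or -andbA => /andP[].
have AB0 : A :&: B = set0.
  apply/eqP; apply: contraNT AB => /set0Pn[z]; rewrite inE => /andP[zA zB].
  by rewrite (component_disjoint mr cpA cpB zA zB).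
have l2 := lists_merge mr lc xA yB.
set rho' := twist (tperm y x) rho in l2 *.
have mr' : matching rho' by rewrite matching_twist.
have [_ sub' _] := (lists_componentsP _ mr').1 l2.
have cpAB : A :|: B \in components rho' by rewrite sub' ?mem_head.
have xAB : x \in A :|: B by rewrite inE xA.
have yAB : y \in A :|: B by rewrite inE yB orbT.
have cAB : #|A :|: B| = (a + b).*2 by rewrite cardsU AB0 cards0 subn0 cA cB doubleD.
have yO : y \in fingraph.orbit (walk rho') x.
  apply: contraT => yO; have := twist_component mr' cpAB xAB yAB.
  rewrite inE twistK => /(_ yO) cAB'.
  have eA := component_disjoint mr cpA cAB' xA xAB.
  by have /setP/(_ y) := AB0; rewrite !inE yB eA yAB.
have [t tO ey] := trajectP yO.
have t0 : 0 < t.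
  case: t ey {tO} => // exy; move: yB; rewrite exy => xB.
  by have /setP/(_ x) := AB0; rewrite !inE xA xB.
have tab : 0 < t < fingraph.order (walk rho') x by rewrite t0.
have [] := cut_components mr' cpAB xAB tab; rewrite -ey twistK => cpC _.
have eC := component_disjoint mr cpA cpC xA (mem_arcq tab).
have ta : t = a.
  by apply: double_inj; rewrite -cA eC card_arc // ltnW.
subst t.
have szp' : size pre = k by [].
split.
  rewrite /= take_size_cat // nth_cat -szp ltnn subnn /= nth_cat ltnNge leqnSn subSnn /=.
  rewrite drop_cat ltnNge leqW //= -addn2 addKn /= drop0.
  apply/allpairsPdep; exists (rho', pre ++ (A :|: B) :: post), x; split=> //.
    rewrite mem_labelled_matchings mr' /=; apply/andP; split.
      exact: (lists_middle _ pre [:: A :|: B] post).2.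
    by rewrite sizes_cat sizes_cons sz1 sz2 cAB map_cat.
  by rewrite mem_enum -szp nth_cat ltnn subnn.
have tk X : take k (pre ++ X) = pre by rewrite -szp take_size_cat.
have nk Y Z : nth set0 (pre ++ Y :: Z) k = Y by rewrite -szp nth_cat ltnn subnn.
have nk1 Y Y' Z : nth set0 (pre ++ [:: Y, Y' & Z]) k.+1 = Y'.
  by rewrite -szp nth_cat ltnNge leqnSn subSnn.
have dk Y Z : drop k.+1 (pre ++ Y :: Z) = Z.
  by rewrite -szp drop_cat ltnNge leqnSn subSnn /= drop0.
have dk1 Y Y' Z : drop k.+2 (pre ++ [:: Y, Y' & Z]) = Z.
  by rewrite -szp drop_cat ltnNge leqW //= -addn2 addKn /= drop0.
rewrite /cut_map /merge_map -/rho' -ey twistK !(tk, nk, nk1, dk, dk1).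
rewrite -eC setDUl setDv set0U.
by rewrite (_ : B :\: A = B) //; apply/setDidPl; rewrite disjoint_sym -setI_eq0 AB0.
Qed.

Lemma cut_merge_count : size merged * (a + b).*2 = size cut * (a.*2 * b.*2).
Proof.
rewrite -size_rooted1 -size_rooted2.
have u1 : uniq rooted1.
  apply: allpairs_uniq_dep => [|o _|[? ?] [? ?] _ _ [-> ->]] //.
    exact: labelled_matchings_uniq.
  exact: enum_uniq.
have u2 : uniq rooted2.
  apply: allpairs_uniq_dep => [|o _|[? ?] [? ?] _ _ [-> ->]] //.
    exact: labelled_matchings_uniq.
  by apply: allpairs_uniq => [||[? ?] [? ?] _ _ [-> ->]] //; apply: enum_uniq.
apply/eqP; rewrite eqn_leq; apply/andP; split.
  rewrite -(size_map cut_map); apply: uniq_leq_size.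
    rewrite map_inj_in_uniq // => z z' zin zin' e.
    by rewrite -(rooted1P zin).2 -(rooted1P zin').2 e.
  by move=> _ /mapP[z zin ->]; have [] := rooted1P zin.
rewrite -(size_map merge_map); apply: uniq_leq_size.
  rewrite map_inj_in_uniq // => z z' zin zin' e.
  by rewrite -(rooted2P zin).2 -(rooted2P zin').2 e.
by move=> _ /mapP[z zin ->]; have [] := rooted2P zin.
Qed.

End CutMerge.
End Counting.

Section Numerator.
Variable n : nat.
Local Notation V := (bvert n).
Local Notation tau := (tau n).
Implicit Types (rho : {perm V}) (x y p q : V) (A B : {set V}).
Implicit Types (ls pre post : seq {set V}) (m : seq nat).

Lemma component_tau A x : A \in components tau -> x \in A -> A = [set x; tau x].
Proof.
move=> /(componentsP _ (matching_tau n))[_ sA mA] xA; apply/esym/mA.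
- by apply/subsetP => y; rewrite !inE => /orP[]/eqP -> //; rewrite (stable_tau _ sA).
- by apply/stableP => y; rewrite !inE => /orP[]/eqP ->; rewrite ?tauK eqxx ?orbT.
- by apply/set0Pn; exists x; rewrite !inE eqxx.
Qed.

Lemma card_components_tau : #|components tau| = n.
Proof.
pose P (i : 'I_n) := [set unbar i; tau (unbar i)].
have PI : injective P.
  move=> i j /setP/(_ (unbar i)); rewrite !inE eqxx /= => /esym/orP[/eqP[]//|/eqP e].
  by have := congr1 fst e; rewrite tau_fst.
rewrite -[RHS]card_ord -(card_imset _ PI); apply: eq_card => A.
apply/idP/imsetP => [cA|[i _ ->]].
  have /(componentsP _ (matching_tau n))[/set0Pn[x xA] sA _] := cA.
  exists x.1 => //; apply: component_tau => //.
  by case: (@fst_tau _ x (unbar x.1)) => [|->|->] //; rewrite (stable_tau _ sA).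
have [B cB iB] := component_of (unbar i) (matching_tau n).
by rewrite /P -(component_tau cB iB).
Qed.

Lemma matching_ones rho ls : matching rho -> lists_components rho ls ->
  sizes ls = nseq (size ls) 2 -> rho = tau.
Proof.
move=> mr lc sz; have [rK rn] := matchingP _ mr.
have [_ sub cov] := (lists_componentsP _ mr).1 lc.
apply/permP => x; have [A Als xA] := cov x.
have /(componentsP _ mr)[_ sA _] := sub _ Als.
have cA2 : #|A| = 2.
  have /(map_f (fun A : {set V} => #|A|)) := Als; rewrite -/(sizes ls) sz.
  by move=> /nseqP[].
have h0 : half_pred A = 0 by rewrite /half_pred cA2.
have rxA : rho x \in A by rewrite stable_rho.
have := half_pred0 mr (sub _ Als) h0 xA rxA => /esym/fst_tau[e|//].
by have := rn x; rewrite e eqxx.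
Qed.

Lemma size_labelled_ones : size (labelled_matchings n (nseq n 1)) = n`!.
Proof.
have e2 k ls : size ls = k ->
    (sizes ls == map double (nseq k 1)) = all (fun A => #|A| == 2) ls.
  elim: ls k => [|A ls IH] [|k] //= [/IH].
  by rewrite eqseq_cons => <-.
have lsn ls : lists_components tau ls -> size ls = n.
  by move=> lc; rewrite (perm_size lc) -cardE card_components_tau.
have -> : size (labelled_matchings n (nseq n 1)) =
    size [seq (tau, ls) | ls <- permutations (enum (components tau))].
  apply/perm_size/uniq_perm; first exact: labelled_matchings_uniq.
    by rewrite map_inj_uniq ?permutations_uniq // => ? ? [].
  move=> [rho ls]; rewrite mem_labelled_matchings.
  apply/and3P/mapP => [[mr lc /eqP sz]|[ls' ls'p [-> ->]]].
    have szn : size ls = n by rewrite -(size_map (fun A : {set V} => #|A|)) -/(sizes ls) sz size_map size_nseq.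
    have er : rho = tau.
      by apply: (matching_ones mr lc); rewrite sz szn map_nseq.
    by exists ls; rewrite -?er // mem_permutations er in lc *.
  rewrite mem_permutations in ls'p; rewrite e2 ?lsn //; split=> //; first exact: matching_tau.
  have [_ sub _] := (lists_componentsP _ (matching_tau n)).1 ls'p.
  apply/allP => A /sub cA.
  have /(componentsP _ (matching_tau n))[/set0Pn[x xA] _ _] := cA.
  by rewrite (component_tau cA xA) cards2 (eq_sym x) tau_neq.
by rewrite size_map size_permutations ?enum_uniq // -cardE card_components_tau.
Qed.

Lemma labelled_matchings_count m : all (leq 1) m -> sumn m = n ->
  size (labelled_matchings n m) * \prod_(a <- m) a.*2 = n`! * 2 ^ n.
Proof.
have [d] := ubnP (sumn (map predn m)); elim: d m => // d IH m dm pm sm.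
case: (boolP (all (pred1 1) m)) => [m1|].
  have em : m = nseq (size m) 1 by apply/all_pred1P.
  have sz : size m = n by rewrite -sm {2}em sumn_nseq mul1n.
  by rewrite em sz size_labelled_ones big_nseq iter_muln_1.
case/allPn => a am a1; case/splitPr: am dm pm sm => m1 m2 dm pm sm.
have a2 : 1 < a by move: pm; rewrite all_cat /= => /and3P[_]; case: a a1 {dm sm} => [|[|]].
have ea : a = (a.-1 + 1)%N by rewrite addn1 prednK // ltnW.
have a10 : 0 < a.-1 by rewrite -ltnS prednK // ltnW.
have := @cut_merge_count n m1 m2 a.-1 1 a10 isT; rewrite -ea.
have := IH (m1 ++ [:: a.-1, 1 & m2]); rewrite !big_cat /= !big_cons => IH' H.
have {}IH' := IH' _ _ _; rewrite -IH' => {IH'}.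
- move: H; set x := size _; set y := size _; set p1 := \prod_(_ <- m1) _.
  set p2 := \prod_(_ <- m2) _; set a' := a.-1.*2; set a'' := a.*2; set t := 1.*2.
  move=> H; transitivity ((x * a'') * (p1 * p2)); first by ring.
  by rewrite H; ring.
- move: dm; rewrite !map_cat !sumn_cat /= ltnS => dm; apply: leq_trans dm.
  by rewrite ltn_add2l; case: (a.-1) a10 => // c _ /=; rewrite ?add0n ltn_add2r.
- by move: pm; rewrite !all_cat /= a10 => /and3P[-> _ ->].
- by rewrite -sm !sumn_cat /= {2}ea -addnA.
Qed.

End Numerator.

Section HurwitzSum.
Local Open Scope ring_scope.
Variables (n : nat) (m : seq nat).
Hypothesis n_gt0 : (0 < n)%N.
Local Notation V := (bvert n).
Local Notation X := (V * 'I_n)%type.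
Local Notation lab_type := {ffun 'I_(size m) -> {set V}}.
Implicit Types (rho : {perm V}) (lab : lab_type).

Definition lab_seq lab := [seq lab j | j <- enum 'I_(size m)].

Lemma size_lab_seq lab : size (lab_seq lab) = size m.
Proof. by rewrite size_map size_enum_ord. Qed.

Lemma lab_seq_inj : injective lab_seq.
Proof.
move=> l1 l2 e; apply/ffunP => j.
have /(_ j) H : {in enum 'I_(size m), l1 =1 l2} by apply/eq_in_map.
by apply: H; rewrite mem_enum.
Qed.

Lemma sizes_lab_seq lab :
  (sizes (lab_seq lab) == map double m) =
  [forall j : 'I_(size m), #|lab j| == (nth 0%N m j).*2].
Proof.
have em : map double m = [seq (nth 0%N m j).*2 | j : 'I_(size m) <- enum 'I_(size m)].
  rewrite -[in LHS](mkseq_nth 0%N m) /mkseq -val_enum_ord -!map_comp.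
  by apply: eq_map.
rewrite em /sizes -map_comp; apply/eqP/forallP => [/eq_in_map H j|H].
  by apply/eqP/H; rewrite mem_enum.
by apply/eq_in_map => j _; apply/eqP/H.
Qed.

Lemma labellingE rho lab :
  labelling rho lab =
  lists_components rho (lab_seq lab) && (sizes (lab_seq lab) == map double m).
Proof.
rewrite /labelling sizes_lab_seq andbA; congr (_ && _).
have eu : injectiveb lab = uniq (lab_seq lab) by [].
rewrite eu; apply/andP/idP => [[u /eqP lc]|lc].
  apply: uniq_perm => //; first exact: enum_uniq.
  move=> A; rewrite mem_enum -lc; apply/mapP/imsetP => [[j _ ->]|[j _ ->]]; exists j => //.
  by rewrite mem_enum.
split; first by rewrite (perm_uniq lc) enum_uniq.
apply/eqP/setP => A; rewrite -[RHS]mem_enum -(perm_mem lc).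
apply/imsetP/mapP => [[j _ ->]|[j _ ->]]; exists j => //.
by rewrite mem_enum.
Qed.

Lemma card_labellings :
  #|[pred x : {perm V} * lab_type | matching x.1 && labelling x.1 x.2]| =
  size (labelled_matchings n m).
Proof.
rewrite cardE -(size_map (fun x : {perm V} * lab_type => (x.1, lab_seq x.2))).
apply/perm_size/uniq_perm; last 1 first.
- move=> [rho ls]; rewrite mem_labelled_matchings.
  apply/mapP/idP => [[[r lab]]|/and3P[mr lc sz]].
    by rewrite mem_enum inE labellingE /= => H [-> ->].
  have szl : size ls = size m.
    by rewrite -(size_map (fun A : {set V} => #|A|)) -/(sizes ls) (eqP sz) size_map.
  pose lab : lab_type := [ffun j => nth set0 ls (nat_of_ord j)].
  have els : lab_seq lab = ls.
    rewrite -[RHS](mkseq_nth set0) szl /mkseq -val_enum_ord -map_comp.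
    by apply: eq_map => j; rewrite /= ffunE.
  by exists (rho, lab); rewrite ?mem_enum ?inE /= ?labellingE els // mr lc sz.
- rewrite map_inj_uniq ?enum_uniq // => -[r1 l1] [r2 l2] [-> /lab_seq_inj ->] //.
- exact: labelled_matchings_uniq.
Qed.

Lemma transitive_compatible s ls : lists_components (resulting s) ls ->
  [transitive seq_group s, on [set: V] | 'P] = compatible s [:: ls].
Proof.
move=> lc; rewrite transitive_colours //.
have [_ sub cov] := (lists_componentsP _ (matching_resulting s)).1 lc.
rewrite /compatible /colours_blocks /= !andbT.
apply/forallP/idP => [H|cst x].
  case: ls lc sub {cov} => //= A ls _ sub.
  have ne B : B \in A :: ls -> exists2 x, x \in B & set_colour (seq_colour s) B = Some (seq_colour s x).
    move=> Bl; have cB := sub _ Bl.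
    have /(componentsP _ (matching_resulting s))[/set0Pn[x xB] _ _] := cB.
    by exists x => //; apply: set_colourE.
  rewrite all_map; apply/allP => B Bls /=.
  have [x _ ->] := ne A (mem_head _ _).
  have [|y _ ->] := ne B; first by rewrite inE Bls orbT.
  by have /forallP/(_ x)/eqP -> := H y.
apply/forallP => y; have [A Als xA] := cov x; have [B Bls yB] := cov y.
have cok : colours_blocks (set_colour (seq_colour s)) [:: ls].
  by rewrite /colours_blocks /= cst.
have := colours_blocks_same cok (mem_head _ _) Als Bls.
by rewrite (set_colourE (sub _ Als) xA) (set_colourE (sub _ Bls) yB) => -[->].
Qed.

Lemma monotone_transitiveE (s : seq X) : monotone_transitive s =
  ordered s && [transitive seq_group s, on [set: V] | 'P].
Proof. by rewrite /monotone_transitive andbA. Qed.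

Lemma hurwitz_sum k : (m != [::]) -> 
  \sum_(x : k.-tuple X * lab_type
       | monotone_transitive x.1 && labelling (partial_inv x.1 k) x.2)
    seq_weight x.1 =
  (size (labelled_matchings n m))%:R
    * connected (2 * Cvar) Jvar Tvar k (map predn m).
Proof.
move=> m0; rewrite -card_labellings mulrC mulr_natr -sumr_const.
have E rho lab : matching rho -> labelling rho lab ->
    connected (2 * Cvar) Jvar Tvar k (map predn m) =
    \sum_(s : k.-tuple X | monotone_transitive s && (resulting s == rho)) seq_weight s.
  move=> mr; rewrite labellingE => /andP[lc sz].
  have ne : nonempty_blocks [:: lab_seq lab].
    by rewrite /nonempty_blocks /= -size_eq0 size_lab_seq size_eq0 m0.
  have lc1 : lists_components rho (flatten [:: lab_seq lab]) by rewrite /= cats0.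
  have := hcount_cutjoin k mr lc1 ne; rewrite block_sizes_cons /connected.
  have -> : map half_pred (lab_seq lab) = map predn m.
    have -> : map half_pred (lab_seq lab) = [seq a./2.-1 | a <- sizes (lab_seq lab)].
      by rewrite /sizes -map_comp; apply: eq_map.
    by rewrite (eqP sz) -map_comp; apply: eq_map => a /=; rewrite doubleK.
  move=> <-; rewrite [RHS]big_mkcond; apply: eq_bigr => s _.
  rewrite seq_weightE monotone_transitiveE.
  case: (ordered s) => /=; last by rewrite mul0r.
  case: eqP => [es|_] /=; last by rewrite andbF mul0r.
  rewrite andbT.
  rewrite (@transitive_compatible s (lab_seq lab)) ?es //.
  by case: compatible; rewrite ?mul1r ?mul0r.
rewrite [RHS](eq_bigr (fun x : {perm V} * lab_type => \sum_(s : k.-tuple X |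
   monotone_transitive s && (resulting s == x.1)) seq_weight s)); last first.
  by move=> [rho lab]; rewrite inE /= => /andP[mr lr]; apply: (E rho lab).
transitivity (\sum_(s : k.-tuple X) \sum_(lab : lab_type)
    (if monotone_transitive s && labelling (resulting s) lab then seq_weight s else 0)).
  rewrite pair_bigA /= [LHS]big_mkcond; apply: eq_bigr => -[s lab] _ /=.
  by rewrite /partial_inv take_oversize ?size_tuple.
transitivity (\sum_(rho : {perm V}) \sum_(lab : lab_type) \sum_(s : k.-tuple X)
    (if matching rho && labelling rho lab && (monotone_transitive s && (resulting s == rho))
     then seq_weight s else 0)).
  rewrite exchange_big [RHS]exchange_big; apply: eq_bigr => lab _ /=.
  rewrite [RHS]exchange_big; apply: eq_bigr => s _ /=.
  rewrite (bigD1 (resulting s)) //= eqxx andbT matching_resulting /= andbC.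
  rewrite big1 ?addr0 // => rho; rewrite eq_sym => /negPf ->.
  by rewrite !andbF.
rewrite pair_bigA /= [RHS]big_mkcond; apply: eq_bigr => -[rho lab] _ /=.
rewrite inE /=; case: (_ && _) => /=; last by rewrite big1.
by rewrite [RHS]big_mkcond.
Qed.

End HurwitzSum.

Import Order.TTheory Num.Theory.
Local Open Scope ring_scope.

(** * The recursion for the normalized numbers *)

Section Genus.
Variables (R : comNzRingType) (u v w : R).
Local Notation connected := (connected u v w).

(* With m = [m_1 - 1; ...; m_q - 1], the hypothesis says 2 g = k + 2 - n - q < 0. *)
Lemma connected_genus k m :
  (k + 2 < sumn m + size m + size m)%N -> connected k m = 0.
Proof.
elim/ltn_ind: k m => -[|k] IH [|i m] //= H.
  by rewrite connected0; case: i m H => [|i] [|j m].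
rewrite connectedS.
rewrite big_seq big1 => [|y /picks_mem py]; last first.
  rewrite IH ?mulr0 //=; have := perm_size py; have := perm_sumn py => /=; lia.
rewrite IH ?mulr0 //=; last by lia.
rewrite big_nat big1 ?mulr0 ?addr0 // => a /andP[_ ai].
rewrite IH ?add0r //=; last by lia.
rewrite big_seq big1 // => y /splits_mem py.
rewrite big_nat big1 // => k1 /andP[_ k1k].
have := perm_size py; have := perm_sumn py; rewrite size_cat sumn_cat => e1 e2.
case: (ltnP (k1 + 2) (sumn (a :: y.1) + size (a :: y.1) + size (a :: y.1))) => h1.
  by rewrite IH ?mul0r // ltnS.
rewrite [X in _ * X]IH ?mulr0 /= ?ltnS ?leq_subr //; move: h1 H => /=; rewrite e1 e2.
move: (sumn y.1) (sumn y.2) (size y.1) (size y.2) => S1 S2 s1 s2; clear IH e1 e2 py; lia.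
Qed.

End Genus.

Section IndexSums.
Variable R : comNzRingType.

Lemma picks_rem (T : eqType) (s : seq T) (f : T -> seq T -> R) :
  (forall x s1 s2, perm_eq s1 s2 -> f x s1 = f x s2) ->
  \sum_(y <- picks s) f y.1 y.2 = \sum_(x <- s) f x (rem x s).
Proof.
move=> fP; rewrite [RHS]picks_sum !big_seq; apply: eq_bigr => y /picks_mem py.
apply: fP; rewrite -(perm_cons y.1) -(permPl py).
by apply: perm_to_rem; rewrite (perm_mem py) mem_head.
Qed.

Lemma splits_sets (T : finType) (e : seq T) (D : {set T}) (f : seq T -> seq T -> R) :
  uniq e -> {in e, forall x, x \notin D} ->
  \sum_(y <- splits e) f y.1 y.2 =
  \sum_(I : {set T} | (D \subset I) && (I \subset D :|: [set x in e]))
     f [seq x <- e | x \in I] [seq x <- e | x \notin I].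
Proof.
elim: e D f => [|x e IH] D f /=.
  move=> _ _; rewrite splits_nil (big_pred1 D) // => I.
  rewrite (_ : [set x in [::]] = set0) ?setU0; last by apply/setP => z; rewrite !inE.
  by rewrite /= eqEsubset andbC.
move=> /andP[xe ue] eD; rewrite splits_cons.
have xD : x \notin D by apply: eD; rewrite mem_head.
rewrite [RHS](bigID (fun I : {set T} => x \in I)) /=; congr (_ + _).
  rewrite (IH (x |: D) (fun a b => f (x :: a) b)) //; last first.
    move=> z ze; rewrite !inE negb_or eD ?inE ?ze ?orbT // andbT.
    by apply: contraNneq xe => <-.
  apply: eq_big => [I|I /andP[/subsetP/(_ x)]]; last first.
    by rewrite !inE eqxx => /(_ isT) -> _.
  have -> : D :|: [set z in x :: e] = x |: D :|: [set z in e].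
    by apply/setP => z; rewrite !inE -orbA orbCA.
  by rewrite subUset sub1set; case: (x \in I); rewrite ?andbF ?andbT.
rewrite (IH D (fun a b => f a (x :: b))) //; last first.
  by move=> z ze; apply: eD; rewrite inE ze orbT.
have xN : x \notin D :|: [set x in e] by rewrite !inE negb_or xD.
apply: eq_big => [I|I /andP[_ /subsetP/(_ x)]]; last first.
  by case: (x \in I) => // /(_ isT); rewrite (negPf xN).
rewrite -andbA; congr (_ && _).
have -> : D :|: [set z in x :: e] = x |: (D :|: [set x in e]).
  by apply/setP => z; rewrite !inE orbCA.
apply/idP/andP => [sI|[/subsetP sI xI]].
  split; first exact: subset_trans sI (subsetUr _ _).
  by apply: contraNN xN; apply: (subsetP sI).
apply/subsetP => z zI; have := sI z zI; rewrite in_setU1 => /orP[/eqP ez|//].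
by rewrite -ez zI in xI.
Qed.

Lemma sum_compositions (F : nat -> nat -> R) N :
  \sum_(a < N.+2) \sum_(b < N.+2 | [&& (0 < a)%N, (0 < b)%N & (a + b == N.+1)%N]) F a b
  = \sum_(0 <= c < N) F (N - c)%N c.+1.
Proof.
have E (a : 'I_N.+2) : \sum_(b < N.+2 | [&& (0 < a)%N, (0 < b)%N & (a + b == N.+1)%N]) F a b
    = if (0 < a < N.+1)%N then F a (N.+1 - a)%N else 0.
  case: ifP => ha.
    have h : (N.+1 - a < N.+2)%N by lia.
    rewrite (big_pred1 (Ordinal h)) // => b; rewrite /= -val_eqE /=.
    case/andP: ha => -> aN /=; apply/andP/eqP => [[b0 /eqP]|eb]; first by lia.
    by split; [|apply/eqP]; lia.
  by rewrite big1 // => b /and3P[a0 b0 /eqP ab]; move: ha; rewrite a0 /=; lia.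
rewrite (eq_bigr _ (fun a _ => E a)) -(big_mkord xpredT (fun a => if (0 < a < N.+1)%N then F a (N.+1 - a)%N else 0)).
rewrite big_nat_recl //= add0r big_nat_recr //= ltnn addr0.
rewrite big_nat_rev /= add0n; apply: eq_big_nat => c /andP[_ cN].
rewrite ifT; last by lia.
by congr F; lia.
Qed.

End IndexSums.

Lemma natr_coefField_neq0 n : (0 < n)%N -> n%:R != 0 :> coefField.
Proof.
move=> n0; rewrite -(rmorph_nat (@tofrac _)) tofrac_eq0.
rewrite -mpoly.mpolyC_nat mpoly.mpolyC_eq0.
by rewrite Num.Theory.pnatr_eq0 -lt0n.
Qed.

Lemma Cvar_neq0 : Cvar != 0.
Proof.
rewrite /Cvar tofrac_eq0; apply/eqP => /(congr1 (mpoly.mcoeff (mpoly.mnm1 0))).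
by rewrite mpoly.mcoeffX mpoly.mcoeff0 eqxx => /eqP; rewrite oner_eq0.
Qed.

Lemma Jvar_neq0 : Jvar != 0.
Proof.
rewrite /Jvar tofrac_eq0; apply/eqP => /(congr1 (mpoly.mcoeff (mpoly.mnm1 1))).
by rewrite mpoly.mcoeffX mpoly.mcoeff0 eqxx => /eqP; rewrite oner_eq0.
Qed.

Lemma twoC_neq0 : 2 * Cvar != 0.
Proof. exact: mulf_neq0 (natr_coefField_neq0 (ltn0Sn 1)) Cvar_neq0. Qed.

Lemma Jvar_expf_neq0 a : Jvar ^+ a != 0.
Proof. by rewrite expf_neq0 // Jvar_neq0. Qed.

Local Notation conn := (connected (2 * Cvar) Jvar Tvar).

Definition part_weight (a : nat) : coefField := a%:R * (2 * Cvar) * Jvar ^+ a.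

Lemma part_weight_neq0 a : (0 < a)%N -> part_weight a != 0.
Proof.
move=> a0.
exact: mulf_neq0 (mulf_neq0 (natr_coefField_neq0 a0) twoC_neq0) (Jvar_expf_neq0 a).
Qed.

Lemma prod_part_weight_neq0 m : is_composition m -> \prod_(a <- m) part_weight a != 0.
Proof.
move=> pm; rewrite prodf_seq_neq0; apply/allP => a /(allP pm) a0.
by rewrite part_weight_neq0.
Qed.

Lemma mul_regroup (F : comNzRingType) (x t c j p cm jm : F) :
  x * (t * c) * j * (p * cm * jm) = x * t * p * (c * cm) * (j * jm).
Proof. by ring. Qed.

Lemma prod_part_weight m : \prod_(a <- m) part_weight a =
  (\prod_(a <- m) a.*2)%:R * Cvar ^+ size m * Jvar ^+ sumn m.
Proof.
elim: m => [|a m IH]; first by rewrite !big_nil !expr0 !mulr1.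
rewrite !big_cons IH /part_weight /= natrM -muln2 natrM exprS exprD.
by rewrite mul_regroup.
Qed.

Lemma cancel_count (F : fieldType) (s x f c j t p : F) :
  s != 0 -> s * p = f * t -> s * x / (f * c * j * t) = x / (p * c * j).
Proof.
move=> s0 e; have -> : f * c * j * t = s * (p * c * j).
  by rewrite !mulrA e; ring.
by rewrite -mulf_div divff ?mul1r.
Qed.

Lemma hurwitz_connected (k : nat) (h : int) m :
  is_composition m -> m != [::] ->
  h - 2 + (sumn m)%:Z + (size m)%:Z = k%:Z ->
  hurwitz h m = conn k (map predn m) / \prod_(a <- m) part_weight a.
Proof.
move=> pm m0 hk; rewrite /hurwitz hk /=.
have n0 : (0 < sumn m)%N by case: m pm m0 {hk} => // a m /= /andP[a0 _] _; lia.
have sp : (sumn m = sumn (map predn m) + size m)%N.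
  by elim: m pm {m0 hk n0} => //= a m IH /andP[a0 /IH ->]; lia.
case: (lerP 0 h) => [h0|h0] /=; last first.
  by rewrite connected_genus ?mul0r // size_map; lia.
rewrite (hurwitz_sum n0 k m0).
have cnt := labelled_matchings_count pm (erefl (sumn m)).
have : (size (labelled_matchings (sumn m) m))%:R * (\prod_(a <- m) a.*2)%:R
   = (sumn m)`!%:R * 2 ^+ sumn m :> coefField by rewrite -natrX -!natrM cnt.
rewrite prod_part_weight; apply: cancel_count.
have := natr_coefField_neq0 (n := (sumn m)`! * 2 ^ sumn m).
rewrite muln_gt0 fact_gt0 expn_gt0 /= => /(_ isT).
by rewrite -cnt natrM mulf_eq0 negb_or => /andP[s0 _]; apply: s0.
Qed.

Section Positions.
Variables (m : seq nat) (r : 'I_(size m)).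
Local Notation part j := (nth 0%N m j).
Let others := [seq j <- enum 'I_(size m) | j != r].

Lemma perm_nth_others s : size s = size m ->
  perm_eq s (nth 0%N s r :: [seq nth 0%N s j | j : 'I_(size m) <- others]).
Proof.
move=> es; have {1}-> : s = [seq nth 0%N s j | j : 'I_(size m) <- enum 'I_(size m)].
  by rewrite -[LHS](mkseq_nth 0%N) es /mkseq -val_enum_ord -map_comp.
rewrite -(map_cons (fun j : 'I_(size m) => nth 0%N s j)); apply: perm_map.
rewrite /others -(rem_filter r (enum_uniq _)); apply: perm_to_rem.
by rewrite mem_enum.
Qed.

Lemma nth_replace_others v s : {subset s <= others} ->
  [seq nth 0%N (set_nth 0%N m r v) j | j : 'I_(size m) <- s] =
  [seq part j | j : 'I_(size m) <- s].
Proof.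
move=> so; apply/eq_in_map => j /so; rewrite mem_filter => /andP[jr _].
by rewrite nth_set_nth /= val_eqE (negPf jr).
Qed.

Lemma perm_replace v :
  perm_eq (set_nth 0%N m r v) (v :: [seq part j | j : 'I_(size m) <- others]).
Proof.
have := perm_nth_others (s := set_nth 0%N m r v).
rewrite size_set_nth (maxn_idPr (ltn_ord r)) => /(_ erefl).
by rewrite nth_set_nth /= eqxx nth_replace_others.
Qed.

Lemma perm_merge_parts j : j \in others ->
  perm_eq (merge_parts m r j)
    ((part r + part j)%N :: [seq part l | l : 'I_(size m) <- rem j others]).
Proof.
move=> jo; rewrite /merge_parts; set v := (part r + part j)%N.
set m' := set_nth _ _ _ _.
have jr : j != r by move: jo; rewrite mem_filter => /andP[].
have szm : size m' = size m by rewrite size_set_nth (maxn_idPr (ltn_ord r)).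
have nj : nth 0%N m' j = part j by rewrite nth_set_nth /= val_eqE (negPf jr).
rewrite -(perm_cons (part j)).
have -> : perm_eq (part j :: take j m' ++ drop j.+1 m') =1 perm_eq m'.
  have em' : m' = take j m' ++ part j :: drop j.+1 m'.
    by rewrite -nj -drop_nth ?szm // cat_take_drop.
  apply/permPl; rewrite perm_sym {1}em'.
  by have /permEl := perm_catCA (take j m') [:: part j] (drop j.+1 m').
apply: perm_trans (perm_replace v) _.
apply: perm_trans (perm_cons2C _ _ _); rewrite perm_cons.
exact: (perm_map (fun l : 'I_(size m) => part l) (perm_to_rem jo)).
Qed.

Lemma perm_split_part a b :
  perm_eq (split_part m r a b) [:: b, a & [seq part j | j : 'I_(size m) <- others]].
Proof.
have := perm_nth_others (erefl (size m)).
have em : m = take r m ++ part r :: drop r.+1 m.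
  by rewrite -drop_nth // cat_take_drop.
rewrite {1}em (permPl (permEl (perm_catCA (take r m) [:: part r] (drop r.+1 m)))).
rewrite /= perm_cons => pr.
rewrite /split_part (permPl (permEl (perm_catCA (take r m) [:: a; b] (drop r.+1 m)))).
by apply: perm_trans (perm_cons2C _ _ _) _; rewrite !perm_cons.
Qed.

Lemma perm_sub_replace (I : {set 'I_(size m)}) a : r \in I ->
  perm_eq (sub_replace I r a)
    (a :: [seq part j | j : 'I_(size m) <- [seq j <- others | j \in I]]).
Proof.
move=> rI; rewrite /sub_replace -(@nth_replace_others a); last first.
  by move=> j; rewrite mem_filter => /andP[].
have {2}-> : a = nth 0%N (set_nth 0%N m r a) r by rewrite nth_set_nth /= eqxx.
rewrite -(map_cons (fun j : 'I_(size m) => nth 0%N (set_nth 0%N m r a) j)).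
apply: perm_map; apply: uniq_perm; first exact: enum_uniq.
  rewrite cons_uniq /others mem_filter mem_filter eqxx andbF /=.
  by apply/filter_uniq/filter_uniq/enum_uniq.
move=> j; rewrite mem_enum in_cons 2!mem_filter mem_enum.
by case: eqVneq => [->|_] /=; rewrite ?rI ?andbT.
Qed.

End Positions.

Lemma composition_perm (m m' : seq nat) : perm_eq m m' -> is_composition m = is_composition m'.
Proof. exact: perm_all. Qed.

Lemma hurwitz_perm_connected (k : nat) (h : int) (m m' : seq nat) :
  perm_eq m m' -> is_composition m' -> m' != [::] ->
  h - 2 + (sumn m')%:Z + (size m')%:Z = k%:Z ->
  hurwitz h m = conn k (map predn m') / \prod_(a <- m') part_weight a.
Proof.
move=> pm cm m0 hk; rewrite (@hurwitz_connected k).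
- by rewrite (connected_perm _ _ _ _ (perm_map predn pm)) (perm_big _ pm).
- by rewrite (composition_perm pm).
- by rewrite -size_eq0 (perm_size pm) size_eq0.
- by rewrite (perm_sumn pm) (perm_size pm).
Qed.

Lemma sumn_predn m : is_composition m -> sumn m = (sumn (map predn m) + size m)%N.
Proof. by elim: m => //= a m IH /andP[a0 /IH ->]; lia. Qed.

Lemma hurwitz_convolution (h K : nat) (m1 m1' m2 m2' : seq nat) :
  perm_eq m1 m1' -> is_composition m1' -> m1' != [::] ->
  perm_eq m2 m2' -> is_composition m2' -> m2' != [::] ->
  (h + (sumn m1' + size m1') + (sumn m2' + size m2') = K + 4)%N ->
  \sum_(h1 < h.+1) \sum_(h2 < h.+1 | (h1 + h2 == h)%N)
    hurwitz h1 m1 * hurwitz h2 m2 =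
  (\sum_(0 <= k1 < K.+1) conn k1 (map predn m1') * conn (K - k1) (map predn m2'))
   / ((\prod_(a <- m1') part_weight a) * \prod_(a <- m2') part_weight a).
Proof.
move=> p1 c1 n1 p2 c2 n2 hK.
have two m : is_composition m -> m != [::] -> (2 <= sumn m + size m)%N.
  by case: m => // a m; rewrite /is_composition /= => /andP[a0 _] _; lia.
have t1 := two _ c1 n1; have t2 := two _ c2 n2.
pose e1 := (sumn m1' + size m1' - 2)%N; pose e2 := (sumn m2' + size m2' - 2)%N.
have hK' : (K = h + e1 + e2)%N.
  by rewrite /e1 /e2; lia.
pose P1 := \prod_(a <- m1') part_weight a; pose P2 := \prod_(a <- m2') part_weight a.
have E (h1 : 'I_h.+1) : \sum_(h2 < h.+1 | (h1 + h2 == h)%N) hurwitz h1 m1 * hurwitz h2 m2 =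
   conn (h1 + e1) (map predn m1') * conn (h - h1 + e2) (map predn m2') / (P1 * P2).
  have h1h : (h1 <= h)%N by rewrite -ltnS.
  have hh : (h - h1 < h.+1)%N by rewrite ltnS leq_subr.
  rewrite (big_pred1 (Ordinal hh)) => [|h2]; last first.
    by rewrite /= -val_eqE /=; apply/eqP/eqP; lia.
  rewrite (hurwitz_perm_connected (k := h1 + e1) p1) //; last by rewrite /e1; lia.
  rewrite (hurwitz_perm_connected (k := h - h1 + e2) p2) //=; last by rewrite /e2; lia.
  by rewrite mulf_div.
rewrite (eq_bigr _ (fun h1 _ => E h1)) -mulr_suml; congr (_ / _).
rewrite [RHS](big_cat_nat (n := e1)) //=; last by lia.
rewrite [X in _ = X + _]big_nat [X in _ = X + _]big1 => [|k1 /andP[_ k1e]]; last first.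
  rewrite connected_genus ?mul0r // size_map -sumn_predn //; lia.
rewrite add0r [RHS](big_cat_nat (n := (e1 + h.+1)%N)) //=; try lia.
rewrite [X in _ = _ + X]big_nat [X in _ = _ + X]big1 => [|k1 /andP[k1e k1K]]; last first.
  rewrite [X in _ * X]connected_genus ?mulr0 // size_map -sumn_predn //; lia.
rewrite addr0 -[X in \sum_(X <= _ < _) _]add0n big_addn addKn big_mkord.
apply: eq_bigr => h1 _; congr (_ * conn _ _).
by have := ltn_ord h1; lia.
Qed.

Lemma sum_covering_pairs (T : finType) (R : nmodType) (r : T)
    (F : {set T} -> {set T} -> R) :
  \sum_(I1 : {set T}) \sum_(I2 : {set T}
     | (I1 :|: I2 == [set: T]) && (I1 :&: I2 == [set r])) F I1 I2 =
  \sum_(I : {set T} | r \in I) F I (r |: ~: I).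
Proof.
rewrite [RHS]big_mkcond; apply: eq_bigr => I1 _.
case: ifP => rI.
  apply: big_pred1 => I2; apply/andP/eqP => [[/eqP U /eqP I]|->].
    apply/setP => x; have /setP/(_ x) := U; have /setP/(_ x) := I.
    by rewrite !inE; case: eqP => [->|_]; rewrite ?rI; case: (x \in I1); case: (x \in I2).
  split; apply/eqP/setP => x; rewrite !inE; first by case: (x \in I1); rewrite ?orbT.
  by case: eqP => [->|_]; rewrite ?rI //=; case: (x \in I1).
apply: big1 => I2 /andP[_ /eqP/setP/(_ r)]; rewrite !inE rI eqxx //.
Qed.

Section Ratios.
Variables (F : fieldType) (x y c jx jy p : F).
Hypotheses (x0 : x != 0) (y0 : y != 0) (c0 : c != 0) (jx0 : jx != 0) (jy0 : jy != 0).

Lemma ratio_merge z : x + y != 0 -> p != 0 ->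
  x * (c * (y * z)) / (x * c * jx * (y * c * jy * p)) =
  (x + y) * (z / ((x + y) * c * (jx * jy) * p)).
Proof. by move=> xy0 p0; field; rewrite xy0 x0 y0 c0 jx0 jy0 p0. Qed.

Lemma ratio_split j w z : w != 0 -> p != 0 ->
  w * (j * z) / (w * c * (jx * jy) * p) =
  c * j * (x * y) * (z / (x * c * jx * (y * c * jy * p))).
Proof. by move=> w0 p0; field; rewrite w0 x0 y0 c0 jx0 jy0 p0. Qed.

End Ratios.

Section Recursion.
Variables (h : nat) (m : seq nat) (r : 'I_(size m)).
Hypothesis cm : is_composition m.
Variables (K N : nat).
Local Notation part j := (nth 0%N m j).
Hypothesis hK : (h + sumn m + size m = K + 3)%N.
Hypothesis partr : part r = N.+1.
Let others := [seq j <- enum 'I_(size m) | j != r].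
Let parts (s : seq 'I_(size m)) := [seq part j | j : 'I_(size m) <- s].
Let f (j : 'I_(size m)) := (part j).-1.
Let P s := \prod_(a <- parts s) part_weight a.

Let part_gt0 (j : 'I_(size m)) : (0 < part j)%N.
Proof. exact: all_nthP cm j (ltn_ord j). Qed.

Let composition_parts s : is_composition (parts s).
Proof. by apply/allP => a /mapP[j _ ->]. Qed.

Let composition_cons a s : (0 < a)%N -> is_composition (a :: parts s).
Proof. by move=> a0; rewrite /is_composition /= a0; apply: composition_parts. Qed.

Let P_neq0 s : P s != 0.
Proof. exact: prod_part_weight_neq0. Qed.

Let map_predn_parts s : map predn (parts s) = map f s.
Proof. by rewrite /parts -map_comp. Qed.

Let pm : perm_eq m (N.+1 :: parts others).
Proof. by rewrite -partr; apply: (perm_nth_others r). Qed.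

Let euler : (h + (N.+1 + sumn (parts others)) + (size (parts others)).+1 = K + 3)%N.
Proof. exact: etrans (congr2 (fun a b => h + a + b)%N (esym (perm_sumn pm))
  (esym (perm_size pm))) hK. Qed.

Let sum_filter (a : pred 'I_(size m)) s :
  (sumn (parts s) = sumn (parts [seq j <- s | a j]) + sumn (parts [seq j <- s | ~~ a j]))%N.
Proof. by elim: s => //= j s ->; case: (a j) => /=; lia. Qed.

Let size_filter2 (a : pred 'I_(size m)) s :
  (size s = size [seq j <- s | a j] + size [seq j <- s | ~~ a j])%N.
Proof. by elim: s => //= j s ->; case: (a j) => /=; lia. Qed.

Lemma recursion_lhs :
  N.+1%:R * hurwitz h m =
  N.+1%:R * conn K.+1 (N :: map f others) / (part_weight N.+1 * P others).
Proof.
rewrite (hurwitz_perm_connected (k := K.+1) pm (@composition_cons N.+1 _ isT) isT) /=;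
  last by have := euler; lia.
by rewrite map_predn_parts big_cons mulrA.
Qed.

Lemma recursion_merge :
  \sum_(j < size m | j != r) (N.+1 + part j)%N%:R * hurwitz h (merge_parts m r j) =
  N.+1%:R * (2 * Cvar * (\sum_(y <- picks (map f others))
     y.1.+1%:R * conn K ((N + y.1).+1 :: y.2)))
   / (part_weight N.+1 * P others).
Proof.
rewrite picks_map big_map /=.
rewrite (@picks_rem _ _ others (fun j s => (f j).+1%:R * conn K ((N + f j).+1 :: map f s))); last first.
  move=> j s1 s2 p12; congr (_ * _); apply: connected_perm.
  by rewrite perm_cons perm_map.
have -> (G : 'I_(size m) -> coefField) :
    \sum_(j < size m | j != r) G j = \sum_(j <- others) G j.
  by rewrite /others big_filter big_enum_cond.
rewrite !mulr_sumr mulr_suml !big_seq.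
apply: eq_bigr => j jo.
have pmj : perm_eq (merge_parts m r j) ((N.+1 + part j)%N :: parts (rem j others)).
  by rewrite -partr; apply: perm_merge_parts.
have po := perm_to_rem jo.
have sp : sumn (parts others) = (part j + sumn (parts (rem j others)))%N.
  by rewrite (perm_sumn (perm_map _ po)).
have szp : size (parts others) = (size (parts (rem j others))).+1.
  by rewrite (perm_size (perm_map _ po)).
rewrite (hurwitz_perm_connected (k := K) pmj (@composition_cons (N.+1 + part j) _ isT) isT) /=;
  last by have := euler; rewrite sp szp; lia.
have fj : (f j).+1 = part j by rewrite prednK.
have -> : (N + part j)%N = (N + f j).+1 by rewrite -fj addnS.
rewrite map_predn_parts big_cons -/(P (rem j others)).
have -> : P others = part_weight (part j) * P (rem j others).
  by rewrite /P /parts (perm_big _ (perm_map _ po)) big_cons.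
rewrite fj.
have n1 := natr_coefField_neq0 (ltn0Sn N); have n2 := natr_coefField_neq0 (part_gt0 j).
have n3 : N.+1%:R + (part j)%:R != 0 :> coefField.
  by rewrite -natrD; apply: natr_coefField_neq0.
rewrite /part_weight exprD natrD.
exact/esym/(ratio_merge n1 n2 twoC_neq0 (Jvar_expf_neq0 _) (Jvar_expf_neq0 _) _ n3 (P_neq0 _)).
Qed.

Lemma recursion_twist :
  (N.+1 * (N.+1 - 1))%N%:R * Tvar * hurwitz (h%:Z - 1) m =
  N.+1%:R * (Tvar * (N%:R * conn K (N :: map f others)))
   / (part_weight N.+1 * P others).
Proof.
rewrite (hurwitz_perm_connected (k := K) pm (@composition_cons N.+1 _ isT) isT) /=;
  last by have := euler; lia.
rewrite map_predn_parts big_cons subn1 /= natrM -!mulrA; congr (_ * _).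
by rewrite [RHS]mulrCA.
Qed.

Lemma recursion_split c : (c < N)%N ->
  2 * Cvar * Jvar * ((N - c) * c.+1)%N%:R * hurwitz (h%:Z - 2) (split_part m r (N - c) c.+1) =
  N.+1%:R * (Jvar * conn K [:: c, N.-1 - c & map f others]%N)
    / (part_weight N.+1 * P others).
Proof.
move=> cN; have ps : perm_eq (split_part m r (N - c) c.+1) [:: c.+1, (N - c)%N & parts others].
  exact: perm_split_part.
have cs : is_composition [:: c.+1, (N - c)%N & parts others].
  by rewrite /is_composition /= subn_gt0 cN; apply: composition_parts.
rewrite (hurwitz_perm_connected (k := K) ps cs isT) /=;
  last by have := euler; lia.
rewrite map_predn_parts !big_cons predn_sub -/(P others).
rewrite mulnC natrM; apply/esym; rewrite {1}/part_weight.
have -> : Jvar ^+ N.+1 = Jvar ^+ c.+1 * Jvar ^+ (N - c).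
  by rewrite -exprD; congr (_ ^+ _); lia.
have n1 := natr_coefField_neq0 (ltn0Sn N); have n2 := natr_coefField_neq0 (ltn0Sn c).
have n3 : (N - c)%:R != 0 :> coefField by rewrite natr_coefField_neq0 ?subn_gt0.
exact: (ratio_split n2 n3 twoC_neq0 (Jvar_expf_neq0 _) (Jvar_expf_neq0 _) _ _ n1 (P_neq0 _)).
Qed.

Lemma recursion_disconnected c : (c < N)%N ->
  2 * Cvar * Jvar * ((N - c) * c.+1)%N%:R *
    (\sum_(h1 < h.+1) \sum_(h2 < h.+1 | (h1 + h2 == h)%N)
     \sum_(I1 : {set 'I_(size m)}) \sum_(I2 : {set 'I_(size m)}
         | (I1 :|: I2 == [set: 'I_(size m)]) && (I1 :&: I2 == [set r]))
       hurwitz h1 (sub_replace I1 r c.+1) * hurwitz h2 (sub_replace I2 r (N - c))) =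
  N.+1%:R * (Jvar * \sum_(y <- splits (map f others)) \sum_(0 <= k1 < K.+1)
         conn k1 (c :: y.1) * conn (K - k1) ((N.-1 - c)%N :: y.2))
    / (part_weight N.+1 * P others).
Proof.
move=> cN.
pose A (I : {set 'I_(size m)}) := [seq j <- others | j \in I].
pose B (I : {set 'I_(size m)}) := [seq j <- others | j \notin I].
pose G I := \sum_(0 <= k1 < K.+1) conn k1 (c :: map f (A I))
   * conn (K - k1) ((N.-1 - c)%N :: map f (B I)).
have PAB I : P others = P (A I) * P (B I).
  rewrite /A /B; move: others => s; rewrite /P /parts !big_map !big_filter.
  exact: (bigID (fun j => j \in I)).
have conv (I : {set 'I_(size m)}) : r \in I -> \sum_(h1 < h.+1) \sum_(h2 < h.+1 | (h1 + h2 == h)%N)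
    hurwitz h1 (sub_replace I r c.+1) * hurwitz h2 (sub_replace (r |: ~: I) r (N - c))
   = G I / ((part_weight c.+1 * P (A I)) * (part_weight (N - c) * P (B I))).
  move=> rI.
  have p1 : perm_eq (sub_replace I r c.+1) (c.+1 :: parts (A I)) by apply: perm_sub_replace.
  have p2 : perm_eq (sub_replace (r |: ~: I) r (N - c)) ((N - c)%N :: parts (B I)).
    have := @perm_sub_replace m r (r |: ~: I) (N - c); rewrite setU11 => /(_ isT).
    congr (perm_eq _ (_ :: map _ _)); apply: eq_in_filter => j.
    by rewrite mem_filter !inE => /andP[/negPf -> _].
  have Nc0 : (0 < N - c)%N by rewrite subn_gt0.
  rewrite (hurwitz_convolution (K := K) p1 (@composition_cons c.+1 _ isT) isT
     p2 (@composition_cons _ _ Nc0) isT).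
    rewrite !map_cons !map_predn_parts predn_sub.
    by congr (_ / (_ * _)); rewrite big_cons.
  have e1 : sumn (parts others) = (sumn (parts (A I)) + sumn (parts (B I)))%N.
    exact: sum_filter.
  have e2 : size (parts others) = (size (parts (A I)) + size (parts (B I)))%N.
    by rewrite !size_map; apply: size_filter2.
  by have := euler; rewrite /= e1 e2; lia.
rewrite splits_map big_map /=.
have ou : uniq others by apply/filter_uniq/enum_uniq.
rewrite (@splits_sets _ _ others [set r] (fun a b => \sum_(0 <= k1 < K.+1)
   conn k1 (c :: map f a) * conn (K - k1) ((N.-1 - c)%N :: map f b))) //; last first.
  by move=> j; rewrite mem_filter inE => /andP[].
rewrite (eq_bigl (fun I : {set 'I_(size m)} => r \in I)); last first.
  move=> I; rewrite sub1set (_ : _ :|: _ = setT) ?subsetT ?andbT //.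
  by apply/setP => j; rewrite !inE mem_filter mem_enum andbT orbN.
rewrite -/(G _).
transitivity (2 * Cvar * Jvar * ((N - c) * c.+1)%N%:R * \sum_(I : {set 'I_(size m)} | r \in I)
    G I / ((part_weight c.+1 * P (A I)) * (part_weight (N - c) * P (B I)))).
  congr (_ * _).
  under eq_bigr => h1 _.
    under eq_bigr => h2 _ do rewrite sum_covering_pairs.
    rewrite exchange_big /=.
    over.
  rewrite exchange_big; apply: eq_bigr => I rI; exact: conv.
rewrite !mulr_sumr mulr_suml; apply: eq_bigr => I rI.
rewrite (PAB I) mulnC natrM {3}/part_weight.
have -> : Jvar ^+ N.+1 = Jvar ^+ c.+1 * Jvar ^+ (N - c).
  by rewrite -exprD; congr (_ ^+ _); lia.
have -> : part_weight c.+1 * P (A I) * (part_weight (N - c) * P (B I)) =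
   part_weight c.+1 * (part_weight (N - c) * (P (A I) * P (B I))).
  by rewrite mulrACA -mulrA.
have n1 := natr_coefField_neq0 (ltn0Sn N); have n2 := natr_coefField_neq0 (ltn0Sn c).
have n3 : (N - c)%:R != 0 :> coefField by rewrite natr_coefField_neq0 ?subn_gt0.
exact/esym/(ratio_split n2 n3 twoC_neq0 (Jvar_expf_neq0 _) (Jvar_expf_neq0 _) _ _ n1
  (mulf_neq0 (P_neq0 _) (P_neq0 _))).
Qed.

End Recursion.

Theorem theorem5p18 :
  (forall a : nat,
     (0 - 2 + a%:Z + 1 <= 0 :> int) ->
     hurwitz 0 [:: a] = (a == 1%N)%:R / (2 * Cvar * Jvar))
  /\
  (forall (h : nat) (m : seq nat) (r : 'I_(size m)),
     is_composition m ->
     (1 <= h%:Z - 2 + (sumn m)%:Z + (size m)%:Z :> int) ->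
     let mr := nth 0%N m r in
     mr%:R * hurwitz h m =
       \sum_(j < size m | j != r)
          (mr + nth 0%N m j)%N%:R * hurwitz h (merge_parts m r j)
       + (mr * (mr - 1))%N%:R * Tvar * hurwitz (h%:Z - 1) m
       + \sum_(a < mr.+1) \sum_(b < mr.+1
               | [&& (0 < a)%N, (0 < b)%N & (a + b == mr)%N])
           2 * Cvar * Jvar * (a * b)%N%:R *
           (hurwitz (h%:Z - 2) (split_part m r a b)
            + \sum_(h1 < h.+1) \sum_(h2 < h.+1 | (h1 + h2 == h)%N)
              \sum_(I1 : {set 'I_(size m)})
              \sum_(I2 : {set 'I_(size m)}
                    | (I1 :|: I2 == [set: 'I_(size m)])
                      && (I1 :&: I2 == [set r]))
                hurwitz h1 (sub_replace I1 r b)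
                * hurwitz h2 (sub_replace I2 r a))).
Proof.
split=> [a|h m r cm hk mr].
  case: a => [|[|a]] ha; last by lia.
    by rewrite /hurwitz mul0r.
  rewrite (@hurwitz_connected 0) // connected0 /= big_seq1 /part_weight.
  by rewrite !mulr1n !mul1r expr1.
have [N emr] : exists N, mr = N.+1.
  by exists mr.-1; rewrite prednK //; apply: all_nthP cm r (ltn_ord r).
have [K hK] : exists K, (h + sumn m + size m = K + 3)%N.
  by exists (h + sumn m + size m - 3)%N; move: hk; lia.
rewrite /mr in emr *; rewrite emr.
rewrite (@sum_compositions _ (fun a b => 2 * Cvar * Jvar * (a * b)%N%:R *
   (hurwitz (h%:Z - 2) (split_part m r a b)
    + \sum_(h1 < h.+1) \sum_(h2 < h.+1 | (h1 + h2 == h)%N)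
      \sum_(I1 : {set 'I_(size m)})
      \sum_(I2 : {set 'I_(size m)}
            | (I1 :|: I2 == [set: 'I_(size m)])
              && (I1 :&: I2 == [set r]))
        hurwitz h1 (sub_replace I1 r b)
        * hurwitz h2 (sub_replace I2 r a))) N).
rewrite (recursion_lhs cm hK emr) (recursion_merge cm hK emr).
rewrite (recursion_twist cm hK emr).
under [X in _ = _ + X]eq_big_nat => c /andP[_ cN].
  rewrite mulrDr (recursion_split cm hK emr cN) (recursion_disconnected cm hK emr cN).
  rewrite -mulrDl -!mulrDr.
  over.
rewrite -mulr_suml -!mulr_sumr -!mulrDl -!mulrDr; congr (_ * _ / _).
rewrite connectedS; congr (_ + _ + _ * _).
Qed.
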